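(* Consider random $n\times n$ matrices $$M_{m,n}=\frac1nA_{m,n}T_mA_{m,n}^*,$$ where $A_{m,n}$ is an $n\times m$ random matrix whose entries $A_{jk}^{(m,n)}$ are i.i.d. complex random variables with $$\mathbf{E}(A_{jk}^{(m,n)})=\mathbf{E}((A_{jk}^{(m,n)})^2)=0,\qquad\mathbf{E}(|A_{jk}^{(m,n)}|^2)=1,$$ $$\sup_{m,n}\max_{1\le j\le n,\,1\le k\le m}\mathbf{E}(|A_{jk}^{(m,n)}|^4)\le a_4<\infty,$$ and $T_m$ is a real diagonal $m\times m$ matrix with diagonal entries $t_1,\dots,t_m$. Assume that $$m\to\infty,\qquad n\to\infty,\qquad\frac mn\to c<\infty,$$ and that the normalized counting measure $\sigma_m(\Delta)=\frac1m\#\{l:t_l\in\Delta\}$ of eigenvalues of $T_m$ converges weakly to a limit $\sigma$ as $m\to\infty$. Then the normalized eigenvalue counting measure of $M_{m,n}$ converges weakly in probability to the nonrandom measure whose Stieltjes transform $f$ is the unique solution of the functional equation $$f(z)=-\left(z-c\int\frac{t\,\sigma(dt)}{1+tf(z)}\right)^{-1}$$ in the class of functions that are defined and analytic for non-real $z$ and satisfy $$\mathrm{Im}f(z)\cdot\mathrm{Im}z>0\ \ (\mathrm{Im}z\neq0),\qquad\sup_{y\ge1}y|f(iy)|=1.$$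
   Context: For a Hermitian $n\times n$ matrix with eigenvalues $\lambda_1,\dots,\lambda_n$ (counted with multiplicity), the normalized eigenvalue counting measure is $\Delta\mapsto\frac1n\#\{i:\lambda_i\in\Delta\}$ for Borel $\Delta\subset\mathbf{R}$. The Stieltjes transform of a probability measure $\mu$ on $\mathbf{R}$ is $\int\frac{\mu(d\lambda)}{\lambda-z}$, $\mathrm{Im}z\ne0$. The limit $\sigma$ is a probability measure on $\mathbf{R}$. The $t_l=t_l^{(m)}$ are nonrandom; it is also allowed that they are i.i.d. random variables independent of $A_{m,n}$. The law of the entries may depend on $(m,n)$. Weak convergence in probability of random measures $N_n$ to a nonrandom measure $N$ means that $\int\varphi\,dN_n\to\int\varphi\,dN$ in probability for each bounded continuous $\varphi$. *)

(* Defs.v *)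
From HB Require Import structures.
From mathcomp Require Import all_boot all_order all_algebra.
From mathcomp Require Import all_classical all_reals all_analysis.
From mathcomp Require Import complex.
Import Order.TTheory GRing.Theory Num.Theory.
Import numFieldNormedType.Exports.

Set Implicit Arguments.
Unset Strict Implicit.
Unset Printing Implicit Defensive.

Local Open Scope classical_set_scope.
Local Open Scope ring_scope.
Local Open Scope complex_scope.

Section Families.
Context {R : realType} {d : measure_display} {T : measurableType d}.
Variable P : probability T R.

Definition independent_family {d'} {E : measurableType d'} (I : finType)
    (X : I -> T -> E) :=
  forall (J : {set I}) (B : I -> set E),
    (forall i, measurable (B i)) ->
    P (\bigcap_(i in [set` J]) (X i @^-1` B i)) =
    (\prod_(i in J) P (X i @^-1` B i))%E.

Definition iid_family {d'} {E : measurableType d'} (I : finType)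
    (X : I -> T -> E) :=
  [/\ forall i, measurable_fun setT (X i),
      independent_family X
    & forall i j (B : set E), measurable B ->
        P (X i @^-1` B) = P (X j @^-1` B)].

Definition family_sigma_algebra {d'} {E : measurableType d'} (I : Type)
    (X : I -> T -> E) : set_system T :=
  <<s \bigcup_i preimage_set_system setT (X i) measurable >>.

Definition independent_families {d1 d2} {E1 : measurableType d1}
    {E2 : measurableType d2} (I1 I2 : Type)
    (X : I1 -> T -> E1) (Y : I2 -> T -> E2) :=
  forall U V : set T,
    family_sigma_algebra X U -> family_sigma_algebra Y V ->
    P (U `&` V) = (P U * P V)%E.

End Families.

(* R[i] carries no measurable structure: a complex random variable is handled
   through the identification of R[i] with R * R and its product (Borel)
   sigma-algebra. *)
Definition complex_pair {R : realType} (z : R[i]) :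
    measurableTypeR R * measurableTypeR R :=
  (complex.Re z, complex.Im z).

(* [fine] is harmless on integrable variables, e.g. as soon as the second
   absolute moment is finite. *)
Definition complex_expectation {R : realType} {d} {T : measurableType d}
    (P : probability T R) (X : T -> R[i]) : R[i] :=
  fine 'E_P[fun w => complex.Re (X w)]
    +i* fine 'E_P[fun w => complex.Im (X w)].

Section Measures.
Context {R : realType}.

Local Notation borelR := (measurableTypeR R).

Definition complex_integral (mu : {measure set borelR -> \bar R})
    (g : R -> R[i]) : R[i] :=
  (\int[mu]_x complex.Re (g x)) +i* (\int[mu]_x complex.Im (g x)).

Definition stieltjes (mu : {measure set borelR -> \bar R}) (z : R[i]) : R[i] :=
  complex_integral mu (fun x => (x%:C - z)^-1).

Lemma inv_nat_ge0 (k : nat) : 0 <= (k%:R : R)^-1.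
Proof. by rewrite invr_ge0 ler0n. Qed.

(* Delta |-> #{i < size s : s_i \in Delta} / size s. *)
Definition normalized_counting (s : seq R) : {measure set borelR -> \bar R} :=
  mscale (NngNum (inv_nat_ge0 (size s)))
    (msum (fun i => dirac (nth 0 s i : borelR)) (size s)).

Definition cvg_weakly (mu : nat -> {measure set borelR -> \bar R})
    (nu : {measure set borelR -> \bar R}) :=
  forall phi : R -> R, continuous phi -> bounded_fun phi ->
    (\int[mu k]_x phi x) @[k --> \oo] --> \int[nu]_x phi x.

Definition cvg_weakly_in_probability {d} {T : measurableType d}
    (P : probability T R) (mu : nat -> T -> {measure set borelR -> \bar R})
    (nu : {measure set borelR -> \bar R}) :=
  forall phi : R -> R, continuous phi -> bounded_fun phi ->
  forall eps : R, 0 < eps ->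
    P [set w | eps < `|\int[mu k w]_x phi x - \int[nu]_x phi x|]
      @[k --> \oo] --> 0%E.

End Measures.

Section Matrices.
Context {R : realType}.

Definition sample_matrix (m n : nat) (A : 'M[R[i]]_(n, m)) (t : 'I_m -> R) :
    'M[R[i]]_n :=
  (n%:R)^-1 *: (A *m diag_mx (\row_l (t l)%:C) *m (A ^t*)%sesqui).

(* The roots of the characteristic polynomial, with multiplicity; they are real
   for a Hermitian matrix, so that taking real parts only changes the type. *)
Definition eigenvalues (n : nat) (M : 'M[R[i]]_n) : seq R :=
  [seq complex.Re z | z <- sval (closed_field_poly_normal (char_poly M))].

End Matrices.

Section LimitEquation.
Context {R : realType}.

(* Complex differentiability: [derivable] is taken over the field R[i]. *)
Definition analytic_off_real (f : R[i] -> R[i]) :=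
  forall z : R[i], complex.Im z != 0 ->
    derivable (f : R[i]^o -> R[i]^o) (z : R[i]^o) (1 : R[i]^o).

Definition solution_class (f : R[i] -> R[i]) :=
  [/\ analytic_off_real f,
      forall z : R[i], complex.Im z != 0 -> 0 < complex.Im (f z) * complex.Im z
    & ereal_sup [set (y * ComplexField.Normc.normc (f (0 +i* y)))%:E
                | y in [set y : R | 1 <= y]] = 1%E].

Definition limit_equation (c : R) (sigma : probability (measurableTypeR R) R)
    (f : R[i] -> R[i]) :=
  forall z : R[i], complex.Im z != 0 ->
    f z = - (z - c%:C * complex_integral sigma
                          (fun t => t%:C / (1 + t%:C * f z)))^-1.

Definition unique_solution (c : R) (sigma : probability (measurableTypeR R) R)
    (f : R[i] -> R[i]) :=
  [/\ solution_class f, limit_equation c sigma f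
    & forall g : R[i] -> R[i], solution_class g -> limit_equation c sigma g ->
        forall z : R[i], complex.Im z != 0 -> g z = f z].

End LimitEquation.

Section Model.
Context {R : realType} {d : measure_display} {T : measurableType d}.
Variable P : probability T R.

Definition entry_pair (m n : nat) (A : T -> 'M[R[i]]_(n, m))
    (jk : 'I_n * 'I_m) (w : T) : measurableTypeR R * measurableTypeR R :=
  complex_pair (A w jk.1 jk.2).

Definition nonrandom_t (t : forall m : nat, T -> 'I_m -> R)
    (sigma : probability (measurableTypeR R) R) :=
  exists2 t0 : forall m : nat, 'I_m -> R,
    forall m w l, t m w l = t0 m l
  & cvg_weakly (fun m => normalized_counting (codom (t0 m))) sigma.

Definition iid_t (A : forall m n : nat, T -> 'M[R[i]]_(n, m))
    (t : forall m : nat, T -> 'I_m -> R)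
    (sigma : probability (measurableTypeR R) R) :=
  let tl m (l : 'I_m) (w : T) : measurableTypeR R := t m w l in
  [/\ forall m, iid_family P (tl m),
      forall m n, independent_families P (tl m) (entry_pair (A m n))
    & cvg_weakly_in_probability P
        (fun m w => normalized_counting (codom (t m w))) sigma].

End Model.

(* Main.v *)
Require Import Defs.
From HB Require Import structures.
From mathcomp Require Import all_boot all_order all_algebra.
From mathcomp Require Import all_classical all_reals all_analysis.
From mathcomp Require Import measurable_realfun complex ring lra.
Import Order.TTheory GRing.Theory Num.Theory.
Import numFieldNormedType.Exports.

(** The proof is the resolvent method.  For Im z > 0 let G = (M - z)^-1 be the
resolvent of M = n^-1 A T A^*, and let s(z) = n^-1 tr G, the Stieltjes transform of
the eigenvalue counting measure of M ([ntrace_stieltjes]).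

Writing a_l for the columns of A, the identity M G = 1 + z G becomes
1 + z s = n^-1 \sum_l t_l (a_l^* G a_l) / n ([ntrace_column_form]).  Since M is a sum
of rank one matrices, the form a_l^* G a_l / n is q_l / (1 + t_l q_l), where q_l is
the same form for the matrix with the l-th column removed ([column_form_remove]),
whose resolvent is independent of a_l.  The entries being centered with variance 1
and bounded fourth moment, q_l differs from the normalized trace of that resolvent by
an amount of second moment O(1/n) ([moment2_quadratic_form], [integral_defect_le]),
and removing a column moves the normalized trace by O(1/n) only ([tr_rank_one]).
Hence 1 + z s is close to n^-1 \sum_l t_l s / (1 + t_l s) as long as Im s is bounded
below ([ntrace_self_consistent]).  The constants in these estimates depend on a
bound for the weights t_l.  Weights beyond a level L are set to 0; by the rank one
bound this moves s by at most (number of such weights) / (n Im z)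
([ntrace_restrict]), which the weak convergence of the weights makes small with L
large.  The same estimates at z = iy with y large give i y s(iy) close to -1, that
is, tightness of the counting measures ([ntrace_tight], [stieltjes_tight]).

The passage to the limit goes through filters.  On pairs (k, w) of an index and an
outcome, [prob_filter] is the filter along which convergence means convergence in
probability, and convergence along it follows from convergence to one and the same
limit along every finer ultrafilter ([cvg_ultra]).  Along an ultrafilter no
subsequence has to be extracted: by tightness the counting measures converge weakly
to a probability measure ([helly], [limit_measure]).  Its Stieltjes transform
satisfies the functional equation ([limit_equation_upper]); no lower bound on Im s
has to be proved beforehand, because the limit of s is the transform of a
probability measure and has Im > 0.

It remains to see that all these limits agree.  At a fixed z two solutions f1, f2
satisfy f1 - f2 = (f1 - f2) f1 f2 c \int t^2 / ((1 + t f1) (1 + t f2)) sigma(dt).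
Taking the imaginary part of the equation gives
|f|^2 c \int t^2 / |1 + t f|^2 sigma(dt) < 1 for each solution ([energy_lt]), so by
the inequality 2 a b <= a^2 + b^2 the factor of f1 - f2 on the right has modulus less
than 1, and f1 = f2 ([equation_unique]).  A probability measure is determined by its
Stieltjes transform ([stieltjes_inj]), so the ultrafilter limits are one measure.

Weights that are not random are handled as random variables that are constant,
which are independent of everything ([independent_cst]). *)

Set Implicit Arguments.
Unset Strict Implicit.
Unset Printing Implicit Defensive.
Local Open Scope classical_set_scope.
Local Open Scope ring_scope.
Local Open Scope complex_scope.
Local Notation normc := ComplexField.Normc.normc.
Local Notation Rez := (@complex.Re _).
Local Notation Imz := (@complex.Im _).


(** * Complex numbers through their coordinates *)

Section ComplexNumbers.
Context {R : realType}.
Implicit Types (x y z : R[i]) (a b : R).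

Lemma normc_sqrE x : normc x ^+ 2 = Rez x ^+ 2 + Imz x ^+ 2.
Proof. by case: x => a b /=; rewrite sqr_sqrtr// addr_ge0// sqr_ge0. Qed.

Lemma normc_ge0 x : 0 <= normc x.
Proof. by case: x => a b /=; exact: sqrtr_ge0. Qed.

Lemma normc_real a : normc (a%:C) = `|a|.
Proof. by rewrite /= expr0n /= addr0 sqrtr_sqr. Qed.

Lemma abs_Re_le x : `|Rez x| <= normc x.
Proof.
rewrite -[leLHS]ger0_norm// -ler_sqr ?nnegrE ?normr_ge0 ?normc_ge0//.
by rewrite normc_sqrE normr_id real_normK ?num_real// lerDl sqr_ge0.
Qed.

Lemma abs_Im_le x : `|Imz x| <= normc x.
Proof.
rewrite -[leLHS]ger0_norm// -ler_sqr ?nnegrE ?normr_ge0 ?normc_ge0//.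
by rewrite normc_sqrE normr_id real_normK ?num_real// lerDr sqr_ge0.
Qed.

Lemma normc_le_abs x : normc x <= `|Rez x| + `|Imz x|.
Proof.
rewrite -ler_sqr ?nnegrE ?addr_ge0 ?normc_ge0// normc_sqrE.
rewrite -(real_normK (num_real (Rez x))) -(real_normK (num_real (Imz x))).
have := normr_ge0 (Rez x); have := normr_ge0 (Imz x); nra.
Qed.

Lemma normcD x y : normc (x + y) <= normc x + normc y.
Proof. exact: (@le_normcD R). Qed.

Lemma normc_opp x : normc (- x) = normc x.
Proof. exact: (@normcN R). Qed.

Lemma normcB x y : normc (x - y) <= normc x + normc y.
Proof. by rewrite -(normc_opp y) normcD. Qed.

Lemma normcBC x y : normc (x - y) = normc (y - x).
Proof. by rewrite -normc_opp opprB. Qed.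

Lemma normcM x y : normc (x * y) = normc x * normc y.
Proof. exact: ComplexField.Normc.normcM. Qed.

Lemma normcV x : normc x^-1 = (normc x)^-1.
Proof. exact: ComplexField.Normc.normcV. Qed.

Lemma normc_eq0 x : (normc x == 0) = (x == 0).
Proof.
by apply/eqP/eqP => [/ComplexField.Normc.eq0_normc//|->]; rewrite ComplexField.Normc.normc0.
Qed.

Lemma normc_gt0 x : (0 < normc x) = (x != 0).
Proof. by rewrite lt_neqAle normc_ge0 andbT eq_sym normc_eq0. Qed.

Lemma normc_conj x : normc (x^*)%R = normc x.
Proof. by case: x => a b /=; rewrite sqrrN. Qed.

Lemma mulcJ x : (x^*)%R * x = (normc x ^+ 2)%:C.
Proof.
rewrite normc_sqrE; case: x => a b; apply/eqP; rewrite eq_complex /=.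
by apply/andP; split; apply/eqP; ring.
Qed.

Lemma Re_mul x y : Rez (x * y) = Rez x * Rez y - Imz x * Imz y.
Proof. by case: x => a b; case: y. Qed.

Lemma Im_mul x y : Imz (x * y) = Rez x * Imz y + Imz x * Rez y.
Proof. by case: x => a b; case: y. Qed.

Lemma Re_add x y : Rez (x + y) = Rez x + Rez y.
Proof. by case: x => a b; case: y. Qed.

Lemma Im_add x y : Imz (x + y) = Imz x + Imz y.
Proof. by case: x => a b; case: y. Qed.

Lemma Re_opp x : Rez (- x) = - Rez x. Proof. by case: x. Qed.

Lemma Im_opp x : Imz (- x) = - Imz x. Proof. by case: x. Qed.

Lemma cRe_conj x : Rez (x^*)%R = Rez x. Proof. by case: x. Qed.

Lemma cIm_conj x : Imz (x^*)%R = - Imz x. Proof. by case: x. Qed.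

Lemma Re_inv x : Rez x^-1 = Rez x / normc x ^+ 2.
Proof. by rewrite normc_sqrE; case: x. Qed.

Lemma Im_inv x : Imz x^-1 = - Imz x / normc x ^+ 2.
Proof. by rewrite normc_sqrE; case: x => a b /=; rewrite mulNr. Qed.

Lemma complexP x y : Rez x = Rez y -> Imz x = Imz y -> x = y.
Proof. by case: x; case: y => /= ? ? ? ? -> ->. Qed.

Lemma Re_sum (I : Type) (r : seq I) (p : pred I) (F : I -> R[i]) :
  Rez (\sum_(i <- r | p i) F i) = \sum_(i <- r | p i) Rez (F i).
Proof. by apply: (big_morph Rez Re_add). Qed.

Lemma Im_sum (I : Type) (r : seq I) (p : pred I) (F : I -> R[i]) :
  Imz (\sum_(i <- r | p i) F i) = \sum_(i <- r | p i) Imz (F i).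
Proof. by apply: (big_morph Imz Im_add). Qed.

Lemma normc_sum (I : Type) (r : seq I) (p : pred I) (F : I -> R[i]) :
  normc (\sum_(i <- r | p i) F i) <= \sum_(i <- r | p i) normc (F i).
Proof.
elim/big_ind2 : _ => //; first by rewrite ComplexField.Normc.normc0.
by move=> x1 x2 y1 y2 h1 h2; apply: le_trans (normcD _ _) _; exact: lerD.
Qed.

Lemma Im_neq0 x : Imz x != 0 -> x != 0.
Proof. by apply: contraNneq => ->. Qed.

End ComplexNumbers.

(** * Resolvents of Hermitian matrices *)

HB.lock Definition resolvent (R : realType) (n : nat) (M : 'M[R[i]]_n) (z : R[i]) :
  'M[R[i]]_n := invmx (M - z%:M).

HB.lock Definition sesq (R : realType) (n : nat) (u v : 'cV[R[i]]_n) : R[i] :=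
  ((u ^t* )%sesqui *m v) 0 0.

Section Resolvent.
Context {R : realType} {n : nat}.
Local Notation C := R[i].
Local Open Scope sesquilinear_scope.
Implicit Types (M G : 'M[C]_n) (u v a : 'cV[C]_n) (z : C).

Definition sqnorm v : R := \sum_j normc (v j 0) ^+ 2.

Lemma sqnorm_ge0 v : 0 <= sqnorm v.
Proof. by apply: sumr_ge0 => j _; exact: sqr_ge0. Qed.

Lemma sqnorm_eq0 v : sqnorm v = 0 -> v = 0.
Proof.
move=> /eqP; rewrite psumr_eq0 => [/allP v0|j _]; last exact: sqr_ge0.
apply/matrixP => j k; rewrite ord1 mxE; apply/eqP; rewrite -normc_eq0.
by have := v0 j (mem_index_enum _); rewrite sqrf_eq0.
Qed.

Lemma sesqE u v : sesq u v = \sum_j (u j 0)^*%R * v j 0.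
Proof. by rewrite sesq.unlock mxE; apply: eq_bigr => j _; rewrite !mxE. Qed.

Lemma sesq_sqnorm v : sesq v v = (sqnorm v)%:C.
Proof. by rewrite sesqE rmorph_sum; apply: eq_bigr => j _; rewrite mulcJ. Qed.

Lemma sesqJ u v : ((sesq u v)^*)%R = sesq v u.
Proof.
rewrite !sesqE rmorph_sum; apply: eq_bigr => j _.
by rewrite rmorphM /= conjCK mulrC.
Qed.

Lemma sesqBr u v w : sesq u (v - w) = sesq u v - sesq u w.
Proof.
by rewrite !sesqE -sumrB; apply: eq_bigr => j _; rewrite !mxE mulrBr.
Qed.

Lemma sesqZr (k : C) u v : sesq u (k *: v) = k * sesq u v.
Proof.
by rewrite !sesqE mulr_sumr; apply: eq_bigr => j _; rewrite !mxE mulrCA.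
Qed.

Lemma sesqZl (k : C) u v : sesq (k *: u) v = (k^*)%R * sesq u v.
Proof. by rewrite -sesqJ sesqZr rmorphM /= sesqJ. Qed.

Lemma sesq_adj M u v : sesq u (M *m v) = sesq (M ^t* *m u) v.
Proof.
by rewrite sesq.unlock trmx_mul map_mxM trmxCK mulmxA.
Qed.

Lemma sesq_le (r : R) u v : 0 < r ->
  normc (sesq u v) <= (r * sqnorm u + r^-1 * sqnorm v) / 2.
Proof.
move=> r0; rewrite sesqE; apply: le_trans (normc_sum _ _ _) _.
rewrite /sqnorm !mulr_sumr -big_split /= mulr_suml; apply: ler_sum => j _.
rewrite normcM normc_conj; set x := normc _; set y := normc _.
have -> : (r * x ^+ 2 + r^-1 * y ^+ 2) / 2 = x * y + r * (x - r^-1 * y) ^+ 2 / 2.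
  by field; rewrite gt_eqF.
by rewrite lerDl divr_ge0// mulr_ge0 ?sqr_ge0// ltW.
Qed.

Lemma resolvent_unit M z : M ^t* = M -> Imz z != 0 -> M - z%:M \in unitmx.
Proof.
move=> hM z0; rewrite unitmxE unitfE; apply/negP => /det0P[v v0 vM].
pose u := v ^t*.
have Mu : M *m u = (z^*)%R *: u.
  have : v *m M = z *: v.
    by apply/eqP; rewrite -subr_eq0 -mul_mx_scalar -mulmxBr vM.
  move=> /(congr1 (fun X => X ^t*)); rewrite trmx_mul map_mxM hM.
  by move=> ->; rewrite /u linearZ /= map_mxZ.
have := sesq_adj M u u; rewrite hM Mu.
rewrite sesqZr sesqZl conjCK sesq_sqnorm.
move=> /(congr1 Imz); rewrite !Im_mul /= !mulr0 !add0r cIm_conj => /eqP.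
rewrite -subr_eq0 -mulrBl mulf_eq0 -opprD oppr_eq0 -mulr2n mulrn_eq0 /= (negbTE z0) /=.
move=> /eqP /sqnorm_eq0 u0; move: v0; rewrite -[v]trmxCK -/u u0.
by rewrite linear0 map_mx0 eqxx.
Qed.

Section Hermitian.
Variables (M : 'M[C]_n) (z : C).
Hypotheses (hM : M ^t* = M) (z0 : Imz z != 0).
Local Notation G := (resolvent M z).

Lemma mul_resolvent : (M - z%:M) *m G = 1%:M.
Proof. by rewrite resolvent.unlock mulmxV// resolvent_unit. Qed.

Lemma resolvent_mul : G *m (M - z%:M) = 1%:M.
Proof. by rewrite resolvent.unlock mulVmx// resolvent_unit. Qed.

Lemma mulM_resolvent : M *m G = 1%:M + z *: G.
Proof.
have := mul_resolvent; rewrite mulmxBl mul_scalar_mx => /eqP.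
by rewrite subr_eq => /eqP.
Qed.

Let Mz_adj : (M - z%:M) ^t* = M - (z^*)%R%:M.
Proof. by rewrite linearB /= map_mxB hM tr_scalar_mx map_scalar_mx. Qed.

Lemma adj_resolvent_mul : G ^t* *m (M - (z^*)%R%:M) = 1%:M.
Proof. by rewrite -Mz_adj -map_mxM -trmx_mul mul_resolvent trmx1 map_mx1. Qed.

Lemma mul_adj_resolvent : (M - (z^*)%R%:M) *m G ^t* = 1%:M.
Proof. by rewrite -Mz_adj -map_mxM -trmx_mul resolvent_mul trmx1 map_mx1. Qed.

Let diffM : (M - (z^*)%R%:M) - (M - z%:M) = (z - (z^*)%R)%:M.
Proof. by rewrite opprB addrC subrKA raddfB. Qed.

(** The resolvent identity for the pair of conjugate points z, z^*; the two
    orders of the factors are what makes the resolvent normal. *)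
Lemma resolvent_subJ : G - G ^t* = (z - (z^*)%R) *: (G ^t* *m G).
Proof.
rewrite scalemxAl -mul_mx_scalar -diffM mulmxBr adj_resolvent_mul mulmxBl mul1mx.
by rewrite -mulmxA mul_resolvent mulmx1.
Qed.

Lemma resolvent_subJ' : G - G ^t* = (z - (z^*)%R) *: (G *m G ^t*).
Proof.
rewrite scalemxAl -mul_mx_scalar -diffM mulmxBr mulmxBl resolvent_mul mul1mx.
by rewrite -mulmxA mul_adj_resolvent mulmx1.
Qed.

Lemma subcJ_Im (x : C) : x - (x^*)%R = 0 +i* (Imz x *+ 2).
Proof. by apply: complexP; case: x => a b /=; ring. Qed.

Let subJ v : sesq v (G *m v) - ((sesq v (G *m v))^*)%R
           = sesq v ((G - G ^t*) *m v).
Proof. by rewrite mulmxBl sesqBr [sesq v (G ^t* *m v)]sesq_adj trmxCK sesqJ. Qed.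

(** The quadratic form of the resolvent identity; it controls |G v| by the
    imaginary part of the form. *)
Lemma Im_sesq_resolvent v : Imz (sesq v (G *m v)) = Imz z * sqnorm (G *m v).
Proof.
have := subJ v; rewrite resolvent_subJ -scalemxAl sesqZr -mulmxA.
rewrite (sesq_adj (G ^t*)) trmxCK sesq_sqnorm !subcJ_Im => /(congr1 Imz) /=.
rewrite mul0r add0r mulrnAl => /eqP; rewrite eqr_pMn2r// => /eqP; lra.
Qed.

Lemma sqnorm_adj_resolvent v : sqnorm (G ^t* *m v) = sqnorm (G *m v).
Proof.
have E : sesq v (G *m (G ^t* *m v)) = (sqnorm (G ^t* *m v))%:C.
  by rewrite sesq_adj sesq_sqnorm.
have := subJ v; rewrite resolvent_subJ' -scalemxAl sesqZr -mulmxA.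
rewrite E !subcJ_Im => /(congr1 Imz) /=.
rewrite mul0r add0r mulrnAl => /eqP; rewrite eqr_pMn2r// Im_sesq_resolvent.
by move=> /eqP/(mulfI z0).
Qed.

End Hermitian.

Section UpperHalfPlane.
Variables (M : 'M[C]_n) (z : C).
Hypotheses (hM : M ^t* = M) (z0 : 0 < Imz z).
Local Notation G := (resolvent M z).
Let z_neq0 : Imz z != 0. Proof. by rewrite gt_eqF. Qed.

(** Im z |G v|^2 = Im (v* G v), and the right hand side is at most |v| |G v|. *)
Lemma sqnorm_resolvent_le v : sqnorm (G *m v) <= sqnorm v / Imz z ^+ 2.
Proof.
have h1 := sesq_le v (G *m v) (ltac:(by rewrite invr_gt0) : 0 < (Imz z)^-1).
have h2 := le_trans (ler_norm _) (abs_Im_le (sesq v (G *m v))).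
have := le_trans h2 h1; rewrite Im_sesq_resolvent// invrK => h.
rewrite ler_pdivlMr ?exprn_gt0//.
have : Imz z * (sqnorm (G *m v) * Imz z ^+ 2)
     <= Imz z * sqnorm v.
  rewrite -subr_ge0; have : 0 <= Imz z ^+ 2 * ((Imz z)^-1 * sqnorm v - Imz z * sqnorm (G *m v)).
    by rewrite mulr_ge0 ?sqr_ge0//; lra.
  by congr (_ <= _); field.
by rewrite ler_pM2l.
Qed.

Lemma normc_sesq_resolvent_le v : normc (sesq v (G *m v)) <= sqnorm v / Imz z.
Proof.
have h1 := sesq_le v (G *m v) (ltac:(by rewrite invr_gt0) : 0 < (Imz z)^-1).
apply: le_trans h1 _; rewrite invrK.
have := sqnorm_resolvent_le v; rewrite -(ler_pM2l z0).
have -> : Imz z * (sqnorm v / Imz z ^+ 2) = sqnorm v / Imz z by field.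
rewrite [_^-1 * _]mulrC; lra.
Qed.

Lemma normc_sesq_resolvent_sqr_le v :
  normc (sesq v (G *m (G *m v))) <= sqnorm (G *m v).
Proof.
rewrite sesq_adj; apply: le_trans (sesq_le _ _ ltr01) _.
rewrite sqnorm_adj_resolvent// invr1 !mul1r; lra.
Qed.

Let sqnorm_delta (j : 'I_n) : sqnorm (delta_mx j 0) = 1.
Proof.
rewrite /sqnorm (bigD1 j)//= big1 => [|k kj].
  by rewrite mxE !eqxx normc_real normr1 expr1n addr0.
by rewrite mxE (negbTE kj) normc_real normr0 expr0n.
Qed.

Lemma sum_sqr_resolvent_le :
  \sum_j \sum_k normc (G j k) ^+ 2 <= n%:R / Imz z ^+ 2.
Proof.
rewrite exchange_big /= -[n in n%:R]card_ord -sumr_const mulr_suml.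
apply: ler_sum => k _; have := sqnorm_resolvent_le (delta_mx k 0).
rewrite sqnorm_delta -colE; congr (_ <= _).
by apply: eq_bigr => j _; rewrite mxE.
Qed.

Lemma normc_tr_resolvent_le : normc (\tr G) <= n%:R / Imz z.
Proof.
apply: le_trans (normc_sum _ _ _) _.
rewrite -[n in n%:R]card_ord -sumr_const mulr_suml.
apply: ler_sum => k _; have := normc_sesq_resolvent_le (delta_mx k 0).
rewrite sqnorm_delta -colE; congr (normc _ <= _).
rewrite sesqE (bigD1 k)//= big1 => [|j jk].
  by rewrite !mxE !eqxx conjC1 mul1r addr0.
by rewrite !mxE (negbTE jk) conjC0 mul0r.
Qed.

End UpperHalfPlane.

Section RankOne.
Variables (M : 'M[C]_n) (z : C) (a : 'cV[C]_n) (r : R).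
Hypotheses (hM : M ^t* = M) (z0 : 0 < Imz z).
Let z_neq0 : Imz z != 0. Proof. by rewrite gt_eqF. Qed.

Definition rank_one : 'M[C]_n := r%:C *: (a *m a ^t*).
Local Notation G := (resolvent M z).
Local Notation G' := (resolvent (M + rank_one) z).

Lemma rank_one_herm : rank_one ^t* = rank_one.
Proof.
rewrite /rank_one linearZ /= map_mxZ trmx_mul map_mxM trmxCK.
by congr (_ *: _); apply: complexP; rewrite /= ?oppr0.
Qed.

Lemma add_rank_one_herm : (M + rank_one) ^t* = M + rank_one.
Proof. by rewrite linearD /= map_mxD hM rank_one_herm. Qed.

Let hM' := add_rank_one_herm.

Let outer_mul N : rank_one *m (N *m a) = (r%:C * sesq a (N *m a)) *: a.
Proof.
rewrite /rank_one -scalemxAl -mulmxA [a ^t* *m _]mx11_scalar.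
by rewrite sesq.unlock mul_mx_scalar scalerA.
Qed.

Let resolvent_diff : G - G' = G' *m rank_one *m G.
Proof.
have {1}-> : G = G' *m (M + rank_one - z%:M) *m G by rewrite resolvent_mul// mul1mx.
have {2}-> : G' = G' *m ((M - z%:M) *m G) by rewrite mul_resolvent// mulmx1.
rewrite -mulmxA -mulmxBr -mulmxBl -[RHS]mulmxA.
by congr (_ *m (_ *m _)); rewrite [M + rank_one]addrC -(addrA rank_one) addrK.
Qed.

Local Notation q := (sesq a (G *m a)).

(** Sherman-Morrison formula, tested on the vector a. *)
Lemma resolvent_rank_one : G *m a = (1 + r%:C * q) *: (G' *m a).
Proof.
have := congr1 (fun X => X *m a) resolvent_diff.
rewrite /= mulmxBl -!mulmxA outer_mul -scalemxAr => /eqP.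
by rewrite subr_eq => /eqP {1}->; rewrite scalerDl scale1r addrC.
Qed.

(** A zero denominator would give G a = 0 by the preceding formula, hence q = 0
    and a denominator equal to 1. *)
Lemma rank_one_denom_neq0 : 1 + r%:C * q != 0.
Proof.
apply/eqP => q0; have := resolvent_rank_one; rewrite q0 scale0r => Ga0.
by move: q0; rewrite Ga0 sesqE big1 => [|j _];
  rewrite ?mulr0 ?addr0 ?mxE ?mulr0//; apply/eqP; rewrite oner_eq0.
Qed.

Lemma sesq_rank_one : r%:C * sesq a (G' *m a) = r%:C * q / (1 + r%:C * q).
Proof.
apply: (mulIf rank_one_denom_neq0); rewrite mulfVK ?rank_one_denom_neq0//.
rewrite -mulrA; congr (_ * _).
by rewrite [in RHS]resolvent_rank_one sesqZr mulrC.
Qed.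

(** The factor r of the perturbation cancels between r a*G^2 a and
    |1 + r q| >= |r| Im q = |r| Im z |G a|^2, so that the bound does not depend
    on the size of the perturbation. *)
Lemma tr_rank_one : normc (\tr G - \tr G') <= (Imz z)^-1.
Proof.
have d0 := rank_one_denom_neq0.
have -> : \tr G - \tr G' = (1 + r%:C * q)^-1 * (r%:C * sesq a (G *m (G *m a))).
  rewrite -raddfB /= resolvent_diff /rank_one -scalemxAr -!scalemxAl linearZ /=.
  have -> : \tr (G' *m (a *m a ^t*) *m G) = sesq a (G *m (G' *m a)).
    by rewrite sesq.unlock mulmxA -mulmxA mxtrace_mulC -mulmxA trace_mx11.
  rewrite mulrCA; congr (_ * _).
  have E := resolvent_rank_one; set k := 1 + _ in d0 E *.
  by rewrite E -scalemxAr sesqZr mulKf.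
rewrite normcM normcV mulrC ler_pdivrMr ?normc_gt0// normcM normc_real.
rewrite [leRHS]mulrC ler_pdivlMr// -mulrA.
apply: le_trans (abs_Im_le _).
rewrite Im_add Im_mul /= mul0r addr0 add0r Im_sesq_resolvent// normrM.
rewrite ler_wpM2l// normrM (gtr0_norm z0) mulrC ler_pM2l//.
rewrite (ger0_norm (sqnorm_ge0 _)); exact: normc_sesq_resolvent_sqr_le.
Qed.

End RankOne.
End Resolvent.

(** * The sample matrix as a sum of rank one matrices *)

(** The normalized trace of the resolvent is the Stieltjes transform of the
    eigenvalue counting measure. *)
HB.lock Definition ntrace (R : realType) (m n : nat) (A : 'M[R[i]]_(n, m)) (z : R[i])
  (t : 'I_m -> R) : R[i] := n%:R^-1 * \tr (resolvent (sample_matrix A t) z).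

HB.lock Definition column_form (R : realType) (m n : nat) (A : 'M[R[i]]_(n, m))
  (z : R[i]) (t : 'I_m -> R) (l : 'I_m) : R[i] :=
  n%:R^-1 * sesq (col l A) (resolvent (sample_matrix A t) z *m col l A).

Section SampleMatrix.
Context {R : realType} {m n : nat}.
Local Notation C := R[i].
Local Open Scope sesquilinear_scope.
Variable A : 'M[C]_(n, m).
Implicit Types (t : 'I_m -> R) (l : 'I_m).

Definition remove t l : 'I_m -> R := fun k => if k == l then 0 else t k.

Lemma sample_matrixE t :
  sample_matrix A t = \sum_l rank_one (col l A) (t l / n%:R).
Proof.
rewrite /sample_matrix; apply/matrixP => j k.
rewrite mxE mxE summxE mulr_sumr; apply: eq_bigr => l _.
rewrite mul_mx_diag !mxE big_ord1 !mxE rmorphM fmorphV rmorph_nat.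
by rewrite /= [A j l * _]mulrC -!mulrA mulrCA.
Qed.

Lemma sample_matrix_remove t l :
  sample_matrix A t
  = sample_matrix A (remove t l) + rank_one (col l A) (t l / n%:R).
Proof.
rewrite !sample_matrixE (bigD1 l)//= [in RHS](bigD1 l)//= /remove eqxx.
rewrite /rank_one mul0r scale0r add0r addrC; congr (_ + _).
by apply: eq_bigr => k /negbTE ->.
Qed.

Lemma sample_matrix_herm t : (sample_matrix A t) ^t* = sample_matrix A t.
Proof.
rewrite sample_matrixE linear_sum /= map_mx_sum.
by apply: eq_bigr => l _; exact: rank_one_herm.
Qed.

Section NormalizedTrace.
Variable z : C.
Hypothesis z0 : 0 < Imz z.
Hypothesis n0 : (0 < n)%N.
Let nR0 : 0 < n%:R :> R. Proof. by rewrite ltr0n. Qed.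
Let nC0 : n%:R != 0 :> C. Proof. by rewrite pnatr_eq0 -lt0n. Qed.
Let z_neq0 : Imz z != 0. Proof. by rewrite gt_eqF. Qed.

Local Notation ntrace := (ntrace A z).
Local Notation column_form := (column_form A z).

Lemma normc_ntrace_le t : normc (ntrace t) <= (Imz z)^-1.
Proof.
rewrite ntrace.unlock normcM normcV -(rmorph_nat (real_complex R)) normc_real normr_nat.
rewrite ler_pdivrMl//.
exact: normc_tr_resolvent_le (sample_matrix_herm t) z0.
Qed.

Lemma normc_column_form_le t l :
  normc (column_form t l) <= sqnorm (col l A) / n%:R / Imz z.
Proof.
rewrite column_form.unlock normcM normcV -(rmorph_nat (real_complex R)) normc_real normr_nat.
rewrite ler_pdivrMl// [leRHS]mulrA [n%:R * _]mulrC divfK ?gt_eqF//.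
exact: normc_sesq_resolvent_le (sample_matrix_herm t) z0 _.
Qed.

Let rank_oneC (x : R) : (x / n%:R)%:C = x%:C * n%:R^-1 :> C.
Proof. by rewrite rmorphM fmorphV rmorph_nat. Qed.

(** The rank one formula with r = t_l / n. It trades the form in the full
    resolvent for a form in a resolvent that does not involve column l, hence is
    independent of it. *)
Lemma column_form_remove t l :
  1 + (t l)%:C * column_form (remove t l) l != 0 /\
  (t l)%:C * column_form t l
  = (t l)%:C * column_form (remove t l) l
    / (1 + (t l)%:C * column_form (remove t l) l).
Proof.
have h := sample_matrix_herm (remove t l).
have := rank_one_denom_neq0 (col l A) (t l / n%:R) h z0.
have := sesq_rank_one (col l A) (t l / n%:R) h z0.
rewrite -(sample_matrix_remove t l).
have E (x : C) : (t l / n%:R)%:C * x = (t l)%:C * (n%:R^-1 * x).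
  by rewrite rank_oneC mulrA.
rewrite column_form.unlock; clear h.
generalize (resolvent (sample_matrix A t) z).
generalize (resolvent (sample_matrix A (remove t l)) z) => G1 G2.
by rewrite !E.
Qed.

(** The normalized trace of M G = 1 + z G, with M expanded over the columns. *)
Lemma ntrace_column_form t :
  1 + z * ntrace t = n%:R^-1 * \sum_l (t l)%:C * column_form t l.
Proof.
have := mulM_resolvent (sample_matrix_herm t) z_neq0.
move=> /(congr1 mxtrace); rewrite mxtraceD mxtraceZ mxtrace_scalar => E.
have -> : 1 + z * ntrace t = n%:R^-1 * (1 *+ n + z * \tr (resolvent (sample_matrix A t) z)).
  by rewrite mulrDr mulVf// ntrace.unlock mulrCA.
congr (_ * _); rewrite -E sample_matrixE mulmx_suml linear_sum /=.
apply: eq_bigr => l _; rewrite -sample_matrixE /rank_one -scalemxAl linearZ /=.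
rewrite rank_oneC -mulrA column_form.unlock; congr (_ * (_ * _)).
by rewrite sesq.unlock -mulmxA mxtrace_mulC -mulmxA trace_mx11.
Qed.

Lemma ntrace_remove t l : normc (ntrace t - ntrace (remove t l)) <= (n%:R * Imz z)^-1.
Proof.
rewrite ntrace.unlock -mulrBr normcM normcV -(rmorph_nat (real_complex R)) normc_real normr_nat.
rewrite invfM ler_pM2l ?invr_gt0// normcBC [sample_matrix A t](sample_matrix_remove _ l).
exact: tr_rank_one (sample_matrix_herm _) z0.
Qed.

(** The rank inequality: the atoms are switched off one at a time, each at the
    cost of a rank one perturbation. *)
Lemma ntrace_restrict t t' : (forall l, t' l != t l -> t' l = 0) ->
  normc (ntrace t - ntrace t')
  <= (\sum_l (t' l != t l)%:R) / (n%:R * Imz z).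
Proof.
move=> tt'.
pose mix i l := if (l < i)%N then t' l else t l.
have step i : (i <= m)%N -> normc (ntrace t - ntrace (mix i))
    <= (\sum_(l < m | (l < i)%N) (t' l != t l)%:R) / (n%:R * Imz z).
  elim: i => [_|i IH im].
    have -> : mix 0%N = t by apply/funext.
    by rewrite subrr normc_real normr0 mulr_ge0 ?invr_ge0 ?mulr_ge0 ?sumr_ge0// ltW.
  have {IH} := IH (ltnW im).
  pose li := Ordinal im.
  have -> : \sum_(l < m | (l < i.+1)%N) (t' l != t l)%:R
          = (t' li != t li)%:R + \sum_(l < m | (l < i)%N) (t' l != t l)%:R :> R.
    rewrite (bigD1 li)//=; congr (_ + _); apply: eq_bigl => l.
    by rewrite -val_eqE /= ltnS andbC ltn_neqAle.
  rewrite [in X in _ -> X]mulrDl => IH.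
  rewrite -(subrKA (ntrace (mix i))) addrC.
  apply: le_trans (normcD _ _) _; apply: lerD => //.
  have [e|e] := eqVneq (t' li) (t li).
    have -> : mix i.+1 = mix i.
      apply/funext => l; rewrite /mix ltnS leq_eqVlt.
      case: eqP => //= li'; have -> : l = li by exact/val_inj.
      by rewrite /= ltnn.
    by rewrite subrr normc_real normr0 mul0r.
  have -> : mix i.+1 = remove (mix i) li.
    apply/funext => l; rewrite /mix /remove ltnS leq_eqVlt -val_eqE /=.
    case: eqP => //= li'; have -> : l = li by exact/val_inj.
    exact: tt'.
  by rewrite mul1r; exact: ntrace_remove.
have := step m (leqnn m).
have -> : mix m = t' by apply/funext => l; rewrite /mix ltn_ord.
by rewrite (eq_bigl predT)// => l; rewrite ltn_ord.
Qed.

End NormalizedTrace.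
End SampleMatrix.

(** * Spectral sums of a Hermitian matrix *)

Section Eigenvalues.
Context {R : realType} {n : nat}.
Local Notation C := R[i].
Local Open Scope sesquilinear_scope.
Implicit Types (M : 'M[C]_n) (d : 'I_n -> R).

Lemma perm_prod_XsubC (r s : seq C) :
  \prod_(z <- r) ('X - z%:P) = \prod_(z <- s) ('X - z%:P) -> perm_eq r s.
Proof.
elim: r s => [|a r IH] s E.
  case: s E => // b s; rewrite big_nil big_cons => /(congr1 (fun p => root p b)).
  by rewrite rootM root_XsubC eqxx (negbTE (root1 b)).
have a_s : a \in s.
  by rewrite -root_prod_XsubC -E big_cons rootM root_XsubC eqxx.
rewrite perm_sym; apply: perm_trans (perm_to_rem a_s) _.
rewrite perm_cons perm_sym; apply: IH; move: E.
rewrite (perm_big _ (perm_to_rem a_s)) /= !big_cons => /mulfI; apply.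
by rewrite polyXsubC_eq0.
Qed.

Lemma char_poly_conj (U N : 'M[C]_n) : U \in unitmx ->
  char_poly (invmx U *m N *m U) = char_poly N.
Proof.
move=> Uu; rewrite /char_poly /char_poly_mx !map_mxM /=.
set V := map_mx polyC U; set W := map_mx polyC (invmx U).
have WV : W *m V = 1%:M by rewrite -map_mxM mulVmx//= map_mx1.
have -> : 'X%:M - W *m map_mx polyC N *m V = W *m ('X%:M - map_mx polyC N) *m V.
  by rewrite mulmxBr mulmxBl mul_mx_scalar -scalemxAl WV scalemx1.
rewrite !det_mulmx mulrAC -det_mulmx WV det1 mul1r//.
Qed.

Definition mxpow M k : 'M[C]_n := iter k (mulmx M) 1%:M.

(** The spectral theorem; the diagonal lists the roots of the characteristic
    polynomial, which are unique up to permutation. *)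
Lemma eigenvalues_diag M : M ^t* = M -> exists U d,
  [/\ U \in unitmx, M = invmx U *m diag_mx (\row_i (d i)%:C) *m U
    & perm_eq (eigenvalues M) (codom d)].
Proof.
move=> hM.
have herm : M \is hermsymmx.
  by apply/is_hermitianmxP; rewrite expr0 scale1r hM.
have [U [sp [Uu Mdiag sreal]]] : exists U (sp : 'rV[C]_n),
    [/\ U \in unitmx, M = invmx U *m diag_mx sp *m U & sp \is a realmx].
  exists (spectralmx M), (spectral_diag M); split.
  - exact: spectral_unit.
  - exact/orthomx_spectralP/hermitian_normalmx.
  - exact: hermitian_spectral_diag_real.
pose d i := Rez (sp 0 i).
have spE : sp = \row_i (d i)%:C.
  apply/rowP => i; rewrite mxE /d RRe_real//.
  by have /mxOverP := sreal; apply.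
exists U, d; rewrite -spE; split=> [//|//|].
have cp : char_poly M = \prod_(i < n) ('X - (d i)%:C%:P).
  rewrite Mdiag char_poly_conj// char_poly_trig; last exact: diag_mx_is_trig.
  by apply: eq_bigr => i _; rewrite mxE eqxx mulr1n spE mxE.
rewrite /eigenvalues; case: (closed_field_poly_normal _) => /= r.
rewrite (monicP (char_poly_monic M)) scale1r cp.
have -> : \prod_(i < n) ('X - (d i)%:C%:P)
   = \prod_(z <- [seq x%:C | x <- codom d]) ('X - z%:P).
  by rewrite big_map big_image /=.
move=> /perm_prod_XsubC /(perm_map Rez); rewrite perm_sym => /perm_trans; apply.
by rewrite -map_comp map_id_in.
Qed.

(** Traces of powers give the measurability of the spectrum, traces of
    resolvents its Stieltjes transform. *)
Lemma eigenvalues_sum M : M ^t* = M -> exists d,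
  [/\ size (eigenvalues M) = n,
      forall phi : R -> R, \sum_(x <- eigenvalues M) phi x = \sum_i phi (d i),
      forall k, \tr (mxpow M k) = (\sum_i d i ^+ k)%:C
    & forall z, Imz z != 0 ->
        \tr (resolvent M z) = \sum_i ((d i)%:C - z)^-1].
Proof.
move=> hM; have [U [d [Uu Mdiag Ed]]] := eigenvalues_diag hM.
set D := diag_mx _ in Mdiag.
exists d; split.
- by rewrite (perm_size Ed) size_codom card_ord.
- by move=> phi; rewrite (perm_big _ Ed) /= big_image.
- move=> k.
  have -> : mxpow M k = invmx U *m diag_mx (\row_i ((d i) ^+ k)%:C) *m U.
    elim: k => [|k IH].
      rewrite /= (_ : diag_mx _ = 1%:M) ?mulmx1 ?mulVmx//.
      by apply/matrixP => i j; rewrite !mxE expr0.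
    rewrite /= -/(mxpow M k) IH [M in LHS]Mdiag -!mulmxA mulKVmx//.
    congr (_ *m _); rewrite mulmxA; congr (_ *m _).
    rewrite mulmx_diag; congr diag_mx; apply/rowP => i.
    by rewrite !mxE exprS rmorphM.
  rewrite mxtrace_mulC mulmxA mulmxV// mul1mx mxtrace_diag rmorph_sum.
  by apply: eq_bigr => i _; rewrite mxE.
- move=> z z0.
  have dz i : (d i)%:C - z != 0.
    by apply: Im_neq0; rewrite Im_add Im_opp /= sub0r oppr_eq0.
  have -> : resolvent M z = invmx U *m diag_mx (\row_i ((d i)%:C - z)^-1) *m U.
    have := resolvent_unit hM z0 => u.
    rewrite resolvent.unlock; apply: (row_free_inj (n := n)) (_ : row_free (M - z%:M)) _ _ _.
      by rewrite row_free_unit.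
    rewrite mulVmx//.
    have -> : M - z%:M = invmx U *m diag_mx (\row_i ((d i)%:C - z)) *m U.
      have -> : diag_mx (\row_i ((d i)%:C - z)) = D - z%:M.
        by apply/matrixP => i j; rewrite !mxE -mulrnBl.
      rewrite mulmxBr mulmxBl -Mdiag mul_mx_scalar -scalemxAl mulVmx//.
      by rewrite scalemx1.
    rewrite -!mulmxA mulKVmx// [_ *m (_ *m U)]mulmxA mulmx_diag.
    rewrite (_ : diag_mx _ = 1%:M) ?mul1mx ?mulVmx//.
    by apply/matrixP => i j; rewrite !mxE mulVf.
  rewrite mxtrace_mulC mulmxA mulmxV// mul1mx mxtrace_diag.
  by apply: eq_bigr => i _; rewrite mxE.
Qed.

End Eigenvalues.

(** * Measurability of matrix-valued functions *)

Section ComplexMeasurable.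
Context {R : realType} {d : measure_display} {T : measurableType d}.
Local Notation C := R[i].
Implicit Types f g : T -> C.

Definition cmeasurable f :=
  measurable_fun setT (fun w => Rez (f w) : R) /\
  measurable_fun setT (fun w => Imz (f w) : R).

Lemma cmeasurable_cst (z : C) : cmeasurable (fun=> z).
Proof. by split; exact: measurable_cst. Qed.

Lemma cmeasurable_real (h : T -> R) :
  measurable_fun setT h -> cmeasurable (fun w => (h w)%:C).
Proof. by move=> mh; split => //=; exact: measurable_cst. Qed.

Lemma cmeasurableD f g :
  cmeasurable f -> cmeasurable g -> cmeasurable (fun w => f w + g w).
Proof.
move=> [f1 f2] [g1 g2]; split.
  by under eq_fun do rewrite Re_add; exact: measurable_funD.
by under eq_fun do rewrite Im_add; exact: measurable_funD.
Qed.

Lemma cmeasurableN f : cmeasurable f -> cmeasurable (fun w => - f w).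
Proof.
move=> [f1 f2]; split.
  by under eq_fun do rewrite Re_opp; exact: measurable_funN.
by under eq_fun do rewrite Im_opp; exact: measurable_funN.
Qed.

Lemma cmeasurableB f g :
  cmeasurable f -> cmeasurable g -> cmeasurable (fun w => f w - g w).
Proof. by move=> mf mg; apply: cmeasurableD => //; exact: cmeasurableN. Qed.

Lemma cmeasurableM f g :
  cmeasurable f -> cmeasurable g -> cmeasurable (fun w => f w * g w).
Proof.
move=> [f1 f2] [g1 g2]; split.
  by under eq_fun do rewrite Re_mul; apply: measurable_funB; exact: measurable_funM.
by under eq_fun do rewrite Im_mul; apply: measurable_funD; exact: measurable_funM.
Qed.

Lemma cmeasurableJ f : cmeasurable f -> cmeasurable (fun w => (f w)^*%R).
Proof.
move=> [f1 f2]; split.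
  by under eq_fun do rewrite cRe_conj.
by under eq_fun do rewrite cIm_conj; exact: measurable_funN.
Qed.

Lemma measurable_normc2 f :
  cmeasurable f -> measurable_fun setT (fun w => normc (f w) ^+ 2).
Proof.
move=> [f1 f2]; under eq_fun do rewrite normc_sqrE.
by apply: measurable_funD; exact: measurable_funX.
Qed.

Lemma cmeasurableV f : cmeasurable f -> cmeasurable (fun w => (f w)^-1).
Proof.
move=> mf; have [f1 f2] := mf.
have mi : measurable_fun setT (fun w => (normc (f w) ^+ 2)^-1).
  under eq_fun do rewrite -powR_inv1 ?sqr_ge0//.
  by apply: (measurableT_comp (measurable_powR _)); exact: measurable_normc2.
split.
  by under eq_fun do rewrite Re_inv; exact: measurable_funM.
under eq_fun do rewrite Im_inv; apply: measurable_funM => //.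
exact: measurable_funN.
Qed.

Lemma cmeasurable_sum (I : Type) (r : seq I) (p : pred I) (F : I -> T -> C) :
  (forall i, p i -> cmeasurable (F i)) ->
  cmeasurable (fun w => \sum_(i <- r | p i) F i w).
Proof.
move=> mF; elim: r => [|a r IH].
  by under eq_fun do rewrite big_nil; exact: cmeasurable_cst.
under eq_fun do rewrite big_cons.
by case: (boolP (p a)) => // pa; apply: cmeasurableD => //; exact: mF.
Qed.

Lemma cmeasurable_prod (I : Type) (r : seq I) (p : pred I) (F : I -> T -> C) :
  (forall i, p i -> cmeasurable (F i)) ->
  cmeasurable (fun w => \prod_(i <- r | p i) F i w).
Proof.
move=> mF; elim: r => [|a r IH].
  by under eq_fun do rewrite big_nil; exact: cmeasurable_cst.
under eq_fun do rewrite big_cons.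
by case: (boolP (p a)) => // pa; apply: cmeasurableM => //; exact: mF.
Qed.

Definition mxmeasurable {p q} (F : T -> 'M[C]_(p, q)) :=
  forall i j, cmeasurable (fun w => F w i j).

Lemma mxmeasurable_mul p q r (F : T -> 'M[C]_(p, q)) (G : T -> 'M[C]_(q, r)) :
  mxmeasurable F -> mxmeasurable G -> mxmeasurable (fun w => F w *m G w).
Proof.
move=> mF mG i j; under eq_fun do rewrite mxE.
by apply: cmeasurable_sum => k _; exact: cmeasurableM.
Qed.

Lemma cmeasurable_det p (F : T -> 'M[C]_p) :
  mxmeasurable F -> cmeasurable (fun w => \det (F w)).
Proof.
move=> mF; apply: cmeasurable_sum => s _; apply: cmeasurableM.
  exact: cmeasurable_cst.
by apply: cmeasurable_prod => i _; exact: mF.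
Qed.

Lemma mxmeasurable_inv p (F : T -> 'M[C]_p) : (forall w, F w \in unitmx) ->
  mxmeasurable F -> mxmeasurable (fun w => invmx (F w)).
Proof.
move=> uF mF i j.
have -> : (fun w => invmx (F w) i j) = fun w => (\det (F w))^-1 * cofactor (F w) j i.
  by apply/funext => w; rewrite /invmx uF !mxE.
apply: cmeasurableM; first exact/cmeasurableV/cmeasurable_det.
apply: cmeasurableM; first exact: cmeasurable_cst.
apply: cmeasurable_det => k l.
by under eq_fun do rewrite !mxE; exact: mF.
Qed.

Lemma mxmeasurable_resolvent p (F : T -> 'M[C]_p) (z : C) : Imz z != 0 ->
  (forall w, ((F w) ^t* )%sesqui = F w) ->
  mxmeasurable F -> mxmeasurable (fun w => resolvent (F w) z).
Proof.
move=> z0 hF mF; under eq_fun do rewrite resolvent.unlock.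
apply: mxmeasurable_inv => [w|i j]; first exact: resolvent_unit.
under eq_fun do rewrite !mxE.
by apply: cmeasurableB => //; exact: cmeasurable_cst.
Qed.

Lemma mxmeasurable_pow p (F : T -> 'M[C]_p) k :
  mxmeasurable F -> mxmeasurable (fun w => mxpow (F w) k).
Proof.
move=> mF; elim: k => [|k IH]; first by move=> i j; exact: cmeasurable_cst.
exact: mxmeasurable_mul.
Qed.

Lemma cmeasurable_tr p (F : T -> 'M[C]_p) :
  mxmeasurable F -> cmeasurable (fun w => \tr (F w)).
Proof. by move=> mF; exact: cmeasurable_sum. Qed.

Lemma cmeasurable_sesq p (u v : T -> 'cV[C]_p) :
  mxmeasurable u -> mxmeasurable v -> cmeasurable (fun w => sesq (u w) (v w)).
Proof.
move=> mu mv; under eq_fun do rewrite sesqE.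
by apply: cmeasurable_sum => j _; apply: cmeasurableM => //; exact: cmeasurableJ.
Qed.

End ComplexMeasurable.

(** * Measurability of spectral sums *)

Section SpectralSums.
Context {R : realType} {d : measure_display} {T : measurableType d}.
Variable e : T -> seq R.
Hypothesis me : forall k, measurable_fun setT (fun w => \sum_(x <- e w) x ^+ k).
Implicit Types phi psi : R -> R.

(** The ordered eigenvalues are not polynomials in the entries of a matrix, but
    their power sums are. The test functions phi with a measurable sum contain
    the powers and are closed under linear combinations and pointwise limits,
    which successively yields the exponentials, x |-> exp (- exp (p (x - b))),
    the indicator of x < b, and every continuous function. *)
Definition sum_measurable phi := measurable_fun setT (fun w => \sum_(x <- e w) phi x).

Lemma sum_measurableD phi psi : sum_measurable phi -> sum_measurable psi ->
  sum_measurable (fun x => phi x + psi x).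
Proof.
rewrite /sum_measurable => m1 m2.
by under eq_fun do rewrite big_split /=; exact: measurable_funD.
Qed.

Lemma sum_measurableZ (c : R) phi : sum_measurable phi -> sum_measurable (fun x => c * phi x).
Proof.
rewrite /sum_measurable => m1.
by under eq_fun do rewrite -mulr_sumr; exact: measurable_funM.
Qed.

Lemma sum_measurable_sum (I : Type) (r : seq I) (F : I -> R -> R) :
  (forall i, sum_measurable (F i)) -> sum_measurable (fun x => \sum_(i <- r) F i x).
Proof.
move=> mF; rewrite /sum_measurable; under eq_fun do rewrite exchange_big /=.
by apply: measurable_sum => i; exact: mF.
Qed.

Lemma sum_measurable_cvg (F : nat -> R -> R) phi : (forall i, sum_measurable (F i)) ->
  (forall x, F i x @[i --> \oo] --> phi x) -> sum_measurable phi.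
Proof.
move=> mF cF; apply: (measurable_fun_cvg (h := fun i w => \sum_(x <- e w) F i x)) => //.
move=> w _; elim: (e w) => [|x s IH].
  under eq_fun do rewrite big_nil; rewrite big_nil; exact: cvg_cst.
under eq_fun do rewrite big_cons; rewrite big_cons.
by apply: cvgD.
Qed.

Lemma sum_measurable_exp (a : R) : sum_measurable (fun x => expR (a * x)).
Proof.
apply: (sum_measurable_cvg (F := fun n x => series (exp_coeff (a * x)) n)).
  move=> n; apply: sum_measurable_sum => i.
  have -> : (fun x => exp_coeff (a * x) i) = fun x => a ^+ i / i`!%:R * x ^+ i.
    by apply/funext => x; rewrite /exp_coeff /= exprMn mulrAC.
  exact/sum_measurableZ/me.
by move=> x; exact: is_cvg_series_exp_coeff.
Qed.

Lemma sum_measurable_expexp (p b : R) :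
  sum_measurable (fun x => expR (- expR (p * (x - b)))).
Proof.
apply: (sum_measurable_cvg
  (F := fun n x => series (exp_coeff (- expR (p * (x - b)))) n)); last first.
  by move=> x; exact: is_cvg_series_exp_coeff.
move=> n; apply: sum_measurable_sum => i.
have -> : (fun x => exp_coeff (- expR (p * (x - b))) i)
   = fun x => ((-1) ^+ i * expR (- (i%:R * p * b)) / i`!%:R) * expR (i%:R * p * x).
  apply/funext => x; rewrite /exp_coeff /= [(- expR _) ^+ _]exprNn -expRM_natl.
  rewrite (_ : _ * (p * (x - b)) = - (i%:R * p * b) + i%:R * p * x); last by ring.
  rewrite expRD; ring.
exact/sum_measurableZ/sum_measurable_exp.
Qed.

Lemma cvg_expexp (b x : R) :
  expR (- expR (n%:R * (x - b))) @[n --> \oo]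
  --> if x < b then 1 else if x == b then expR (-1) else 0.
Proof.
have cvg0 (c : R) : c < 0 -> expR (n%:R * c) @[n --> \oo] --> 0.
  move=> c0; under eq_cvg do rewrite expRM_natl.
  by apply: cvg_expr; rewrite ger0_norm ?expR_ge0// expR_lt1.
case: ltgtP => xb.
- rewrite -[X in _ --> X]expR0 -oppr0.
  apply: continuous_cvg; first exact: continuous_expR.
  by apply: cvgN; apply: cvg0; rewrite subr_lt0.
- apply: (@squeeze_cvgr _ _ _ _ (cst 0) (fun n => expR (n%:R * (b - x)))).
  + apply: nearW => n; rewrite expR_ge0 /= -(opprB x b) mulrN !expRN.
    rewrite lef_pV2 ?posrE ?expR_gt0//; apply: le_trans (expR_ge1Dx _).
    by rewrite lerDr.
  + exact: cvg_cst.
  + by apply: cvg0; rewrite subr_lt0.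
- rewrite xb subrr; under eq_cvg do rewrite mulr0 expR0; exact: cvg_cst.
Qed.

Lemma sum_measurable_lt (b : R) : sum_measurable (fun x => (x < b)%R%:R).
Proof.
pose F (b' x : R) : R := if x < b' then 1 else if x == b' then expR (-1) else 0.
have mF b' : sum_measurable (F b').
  apply: (sum_measurable_cvg (fun n => sum_measurable_expexp n%:R b')) => x.
  exact: cvg_expexp.
apply: (sum_measurable_cvg (fun k => mF (b - k.+1%:R^-1))) => x.
apply: cvg_near_cst; case: (ltP x b) => xb; last first.
  apply: nearW => k; rewrite /F.
  have kx : b - k.+1%:R^-1 < x by apply: lt_le_trans xb; rewrite ltrBlDr ltrDl.
  by rewrite ltNge (ltW kx) /= gt_eqF.
have bx : 0 < b - x by rewrite subr_gt0.
near=> k; rewrite /F ifT// ltrBrDr -ltrBrDl.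
by near: k; exact: near_infty_natSinv_lt (PosNum bx).
Unshelve. all: by end_near. Qed.

(** Step functions with cells of width 1/(j+1) on [-j-1, j+1[ converge pointwise
    to phi. *)
Lemma sum_measurable_continuous phi : continuous phi -> sum_measurable phi.
Proof.
move=> cphi.
pose a (j i : nat) : R := i%:R / j.+1%:R - j.+1%:R.
pose F j x : R := \sum_(i < 2 * j.+1 ^ 2) phi (a j i)
    * ((x < a j i.+1)%R%:R - (x < a j i)%R%:R).
have mF j : sum_measurable (F j).
  apply: sum_measurable_sum => i; apply: sum_measurableZ.
  rewrite (_ : (fun x => _) =
    fun x => (x < a j i.+1)%R%:R + (-1) * (x < a j i)%R%:R); last first.
    by apply/funext => x; rewrite mulN1r.
  apply: sum_measurableD; first exact: sum_measurable_lt.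
  exact/sum_measurableZ/sum_measurable_lt.
apply: (sum_measurable_cvg mF) => x; apply/cvgrPdist_lt => eps eps0.
have /cvgrPdist_lt /(_ _ eps0) := cphi x.
rewrite near_nbhs => /nbhs_ballP [del /= del0 Hdel].
near=> j.
have jx : `|x| < j.+1%:R.
  apply: (@lt_trans _ _ j%:R); last by rewrite ltr_nat.
  by near: j; exact: nbhs_infty_gtr.
have jdel : j.+1%:R^-1 < del by near: j; exact: near_infty_natSinv_lt (PosNum del0).
have j0 : 0 < j.+1%:R :> R by [].
(* the unique cell [a j i, a j i.+1[ that contains x *)
pose i0 := Num.truncn ((x + j.+1%:R) * j.+1%:R).
have xj0 : 0 <= (x + j.+1%:R) * j.+1%:R.
  by rewrite mulr_ge0//; move: jx; rewrite ltr_norml => /andP[]; lra.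
have /andP[i0x xi0] := truncn_itv xj0; rewrite -/i0 in i0x xi0.
have ai0 : a j i0 <= x by rewrite /a lerBlDr ler_pdivrMr.
have ai1 : x < a j i0.+1 by rewrite /a ltrBrDr ltr_pdivlMr.
have mono i k : (i <= k)%N -> a j i <= a j k.
  by move=> ik; rewrite /a lerD2r ler_pM2r ?invr_gt0// ler_nat.
have i0lt : (i0 < 2 * j.+1 ^ 2)%N.
  rewrite -(ltr_nat R); apply: le_lt_trans i0x _.
  rewrite natrM natrX expr2 mulrA ltr_pM2r// mulrC.
  by move: jx; rewrite ltr_norml => /andP[_]; lra.
have -> : F j x = phi (a j i0).
  rewrite /F (bigD1 (Ordinal i0lt))//= ai1 ltNge ai0 subr0 mulr1.
  rewrite big1 ?addr0// => i; rewrite -val_eqE /= => ii0.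
  case: (ltngtP i i0) ii0 => // ii0 _.
  - rewrite !ltNge !(le_trans _ ai0) ?mono// ?subrr ?mulr0//.
    exact: ltnW.
  - rewrite !(lt_le_trans ai1) ?mono// ?subrr ?mulr0//.
    by rewrite (leq_trans ii0).
apply: Hdel; rewrite /ball /= ger0_norm ?subr_ge0//.
apply: lt_trans jdel; rewrite ltrBlDr -ltrBlDl ltrBlDr.
have E : a j i0.+1 = a j i0 + j.+1%:R^-1.
  by rewrite /a -[i0.+1%:R]natr1 mulrDl mul1r addrAC.
by rewrite -E.
Unshelve. all: by end_near. Qed.

End SpectralSums.

(** * Expectations of products of independent variables *)

Section Independence.
Context {R : realType} {d d1 : measure_display}.
Context {T : measurableType d} {E : measurableType d1}.
Variable P : probability T R.
Variables (G : set (set T)) (U : T -> E).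
Hypothesis mU : measurable_fun setT U.
Hypothesis mG : G `<=` measurable.
Hypothesis setIG : setI_closed G.
Hypothesis GT : G setT.
Hypothesis indep : forall B S, measurable B -> G S ->
  P (U @^-1` B `&` S) = (P (U @^-1` B) * P S)%E.
Local Notation TG := (g_sigma_algebraType G).

Lemma sub_sigmaG (S : set T) : measurable (S : set TG) -> measurable S.
Proof. by apply: smallest_sub => //; exact: sigma_algebra_measurable. Qed.

Lemma measurable_fun_sigmaG d2 (E' : measurableType d2) (f : TG -> E') :
  measurable_fun setT f -> measurable_fun setT (f : T -> E').
Proof. by move=> mf _ B mB; apply: sub_sigmaG; exact: mf. Qed.

Let mid : measurable_fun setT (id : T -> TG).
Proof. by move=> _ B mB; rewrite setTI; exact: sub_sigmaG. Qed.

(** The two sides agree on the pi-system G, hence on the sigma-algebra it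
    generates. *)
Lemma indep_sigmaG B (S : set TG) : measurable B -> measurable S ->
  P (U @^-1` B `&` S) = (P (U @^-1` B) * P S)%E.
Proof.
move=> mB mS.
have mUB : measurable (U @^-1` B) by rewrite -[X in measurable X]setTI; exact: mU.
pose r : {nonneg R} := NngNum (fine_ge0 (measure_ge0 P (U @^-1` B))).
have rE : (r%:num%:E = P (U @^-1` B))%E by rewrite fineK// fin_num_measure.
rewrite setIC -rE.
suff : mrestr P mUB (S : set T) = mscale r P (S : set T) by [].
apply: (g_sigma_algebra_measure_unique G mG (fun=> setT) (fun=> GT)) => //.
- by apply/seteqP; split => // w _; exists 0%N.
- move=> A GA; change (P (A `&` U @^-1` B) = (r%:num%:E * P A)%E).
  by rewrite setIC indep// rE.
- move=> _; change (P (setT `&` U @^-1` B) < +oo)%E.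
  by rewrite setTI -rE ltry.
Qed.

Let pairUV (w : T) : E * TG := (U w, w).

Let mpair : measurable_fun setT pairUV.
Proof. exact: measurable_fun_pair. Qed.

Let joint : {mfun T >-> (E * TG)%type} :=
  HB.pack pairUV (@isMeasurableFun.Build _ _ _ _ pairUV mpair).
Let mfU : {mfun T >-> E} := HB.pack U (@isMeasurableFun.Build _ _ _ _ U mU).
Let mfG : {mfun T >-> TG} :=
  HB.pack (id : T -> TG) (@isMeasurableFun.Build _ _ _ _ (id : T -> TG) mid).

Let jointE (A : set (E * TG)) : measurable A ->
  (distribution P mfU \x distribution P mfG)%E A = distribution P joint A.
Proof.
by apply: product_measure_unique => B S mB mS /=; exact: indep_sigmaG.
Qed.

Local Open Scope ereal_scope.

(** The joint law of U and of the identity on the sigma-algebra generated by G is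
    a product measure, so that Tonelli's theorem applies. *)
Lemma ge0_integral_indepM (f : E -> R) (Y : TG -> R) :
  measurable_fun setT f -> measurable_fun setT Y ->
  (forall x, 0 <= f x)%R -> (forall w, 0 <= Y w)%R ->
  \int[P]_w (f (U w) * Y w)%:E = \int[P]_w (f (U w))%:E * \int[P]_w (Y w)%:E.
Proof.
move=> mf mY f0 Y0.
pose F (p : E * TG) : \bar R := (f p.1 * Y p.2)%:E.
have mF : measurable_fun setT F.
  apply/measurable_EFinP; apply: measurable_funM.
    exact: measurableT_comp measurable_fst.
  exact: measurableT_comp measurable_snd.
have F0 p : 0 <= F p by rewrite lee_fin mulr_ge0.
transitivity (\int[distribution P joint]_p F p).
  by rewrite ge0_integral_distribution.
transitivity (\int[(distribution P mfU \x distribution P mfG)%E]_p F p).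
  by apply: eq_measure_integral => A mA _; exact/esym/jointE.
rewrite fubini_tonelli1// /fubini_F /F /=.
under eq_integral do under eq_integral do rewrite EFinM.
have mY' : measurable_fun setT (fun w : TG => (Y w)%:E) by exact/measurable_EFinP.
have mf' : measurable_fun setT (fun x : E => (f x)%:E) by exact/measurable_EFinP.
have -> : \int[P]_w (Y w)%:E = \int[distribution P mfG]_y (Y y)%:E.
  by rewrite ge0_integral_distribution.
have -> : \int[P]_w (f (U w))%:E = \int[distribution P mfU]_x (f x)%:E.
  by rewrite ge0_integral_distribution.
under eq_integral => x _.
  rewrite ge0_integralZl_EFin//; last by move=> y _; rewrite lee_fin.
  over.
by rewrite ge0_integralZr// ?integral_ge0// => *; rewrite lee_fin.
Qed.

Lemma integral_indepM0 (f : E -> R) (Y : TG -> R) :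
  measurable_fun setT f -> measurable_fun setT Y ->
  P.-integrable setT (fun w => (f (U w))%:E) ->
  P.-integrable setT (fun w => (Y w)%:E) ->
  \int[P]_w (f (U w))%:E = 0 ->
  P.-integrable setT (fun w => (f (U w) * Y w)%:E) /\
  \int[P]_w (f (U w) * Y w)%:E = 0.
Proof.
move=> mf mY If IY f0.
have IfY : P.-integrable setT (fun w => (f (U w) * Y w)%:E).
  apply/integrableP; split.
    apply/measurable_EFinP; apply: measurable_funM; first exact: measurableT_comp.
    exact: measurable_fun_sigmaG.
  rewrite (eq_integral (fun w => (`|f (U w)| * `|Y w|)%:E)) => [|w _]; last first.
    by rewrite /= normrM.
  rewrite (ge0_integral_indepM (f := fun x => `|f x|%R) (Y := fun w => `|Y w|%R))//.
  - apply: lte_mul_pinfty; first exact: integral_ge0.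
      by have /integrable_fin_num := integrable_abse If; exact.
    by have /integrableP[_] := IY.
  - exact: measurableT_comp.
  - exact: measurableT_comp.
split => //.
pose F (p : E * TG) : \bar R := (f p.1 * Y p.2)%:E.
have mF : measurable_fun setT F.
  apply/measurable_EFinP; apply: measurable_funM.
    exact: measurableT_comp measurable_fst.
  exact: measurableT_comp measurable_snd.
have IF : (distribution P joint).-integrable setT F.
  by apply: integrable_pushforward.
have IF' : (distribution P mfU \x distribution P mfG)%E.-integrable setT F.
  apply/integrableP; split => //.
  have /integrableP[_] := IF; congr (_ < _).
  by apply: eq_measure_integral => A mA _; exact/esym/jointE.
transitivity (\int[distribution P joint]_p F p).
  by rewrite integral_distribution.
transitivity (\int[(distribution P mfU \x distribution P mfG)%E]_p F p).
  by apply: eq_measure_integral => A mA _; exact/esym/jointE.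
rewrite -integral21_prod_meas1//= /fubini_G /F /=.
rewrite (eq_integral (fun=> 0)) ?integral0// => y _.
under eq_integral do rewrite mulrC EFinM.
rewrite integralZl//; last first.
  by apply: integrable_pushforward => //; exact/measurable_EFinP.
rewrite (_ : integral _ _ _ = 0) ?mule0// -f0.
by rewrite integral_distribution//; exact/measurable_EFinP.
Qed.

End Independence.

(** * Second moments and orthogonal sums *)

Section SecondMoment.
Context {R : realType} {d : measure_display} {T : measurableType d}.
Variable P : probability T R.
Local Notation C := R[i].
Implicit Types f g : T -> C.
Local Open Scope ereal_scope.

Definition moment2 f : \bar R := \int[P]_w (normc (f w) ^+ 2)%:E.

Lemma moment2_ge0 f : 0 <= moment2 f.
Proof. by apply: integral_ge0 => w _; rewrite lee_fin sqr_ge0. Qed.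

Lemma moment2_integrable f : cmeasurable f -> moment2 f < +oo ->
  P.-integrable setT (fun w => (normc (f w) ^+ 2)%:E).
Proof.
move=> mf f2; apply/integrableP; split.
  exact/measurable_EFinP/measurable_normc2.
rewrite (eq_integral (fun w => (normc (f w) ^+ 2)%:E))// => w _.
by rewrite /= ger0_norm// sqr_ge0.
Qed.

Lemma moment2_integrable_part f (h : T -> R) : cmeasurable f ->
  measurable_fun setT h -> (forall w, (`|h w| <= normc (f w))%R) ->
  moment2 f < +oo -> P.-integrable setT (fun w => (h w)%:E).
Proof.
move=> mf mh hf f2.
have If : P.-integrable setT (fun w => (1 + normc (f w) ^+ 2)%:E).
  under eq_fun do rewrite EFinD; apply: integrableD => //.
    exact: finite_measure_integrable_cst.
  exact: moment2_integrable.
apply: le_integrable If => //; first exact/measurable_EFinP.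
move=> w _; rewrite /= lee_fin (le_trans (hf w))//.
apply: le_trans (ler_norm _); have := sqr_ge0 (normc (f w) - 1)%R; nra.
Qed.

Lemma moment2D f g : cmeasurable f -> cmeasurable g ->
  moment2 (fun w => f w + g w)%R <= 2%:E * (moment2 f + moment2 g).
Proof.
move=> mf mg; have n2 (h : T -> C) (mh : cmeasurable h) :
    measurable_fun setT (fun w => (normc (h w) ^+ 2)%:E).
  exact/measurable_EFinP/measurable_normc2.
have p2 (h : T -> C) w : setT w -> 0 <= (normc (h w) ^+ 2)%:E.
  by move=> _; rewrite lee_fin sqr_ge0.
rewrite /moment2 -ge0_integralD//; [|exact: p2|exact: n2|exact: p2|exact: n2].
rewrite -ge0_integralZl_EFin//; last 2 first.
- by move=> w _; rewrite adde_ge0// lee_fin sqr_ge0.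
- by apply: emeasurable_funD; exact: n2.
apply: ge0_le_integral => //.
- exact: p2.
- exact/n2/cmeasurableD.
- by apply: measurable_funeM; apply: emeasurable_funD; exact: n2.
- move=> w _; rewrite -EFinD -EFinM lee_fin.
  have := normcD (f w) (g w); have := normc_ge0 (f w + g w)%R.
  have := normc_ge0 (f w); have := normc_ge0 (g w).
  set x := normc _; set y := normc _; set z := normc _ => x0 y0 z0 zxy.
  apply: (@le_trans _ _ ((y + x) ^+ 2)%R).
    by rewrite ler_sqr ?nnegrE ?addr_ge0.
  by have := sqr_ge0 (y - x)%R; nra.
Qed.

End SecondMoment.

Section OrthogonalStep.
Context {R : realType} {d d1 : measure_display}.
Context {T : measurableType d} {E : measurableType d1}.
Variable P : probability T R.
Variables (G : set (set T)) (U : T -> E).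
Hypothesis mU : measurable_fun setT U.
Hypothesis mG : G `<=` measurable.
Hypothesis setIG : setI_closed G.
Hypothesis GT : G setT.
Hypothesis indep : forall B S, measurable B -> G S ->
  P (U @^-1` B `&` S) = (P (U @^-1` B) * P S)%E.
Local Notation TG := (g_sigma_algebraType G).
Local Notation C := R[i].
Local Open Scope ereal_scope.

Lemma cmeasurable_sigmaG (f : TG -> C) :
  cmeasurable f -> cmeasurable (f : T -> C).
Proof. by move=> [f1 f2]; split; exact: (measurable_fun_sigmaG mG). Qed.

(** Pythagoras: a centred variable that is independent of S and Y makes
    xi * Y orthogonal to S. *)
Lemma moment2_orthogonal (g : E -> C) (S Y : TG -> C) :
  cmeasurable g -> cmeasurable S -> cmeasurable Y ->
  \int[P]_w (Rez (g (U w)))%:E = 0 -> \int[P]_w (Imz (g (U w)))%:E = 0 ->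
  moment2 P (fun w => g (U w)) < +oo -> moment2 P S < +oo -> moment2 P Y < +oo ->
  moment2 P (fun w => S w + g (U w) * Y w)%R
  = moment2 P S + moment2 P (fun w => g (U w)) * moment2 P Y.
Proof.
move=> mg mS mY g1 g2 Ig IS IY.
have mgU : cmeasurable (fun w => g (U w)).
  by case: mg => mg1 mg2; split; [exact: (measurableT_comp mg1 mU)|exact: (measurableT_comp mg2 mU)].
have mST := cmeasurable_sigmaG mS; have mYT := cmeasurable_sigmaG mY.
have IS' := moment2_integrable mST IS.
have IY' := moment2_integrable mYT IY.
have Ig' := moment2_integrable mgU Ig.
have bound (h : T -> R) (k : T -> R) : measurable_fun setT h ->
    (forall w, (`|h w| <= k w)%R) -> P.-integrable setT (fun w => (k w)%:E) ->
    P.-integrable setT (fun w => (h w)%:E).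
  move=> mh hk; apply: le_integrable => //; first exact/measurable_EFinP.
  by move=> w _; rewrite /= lee_fin (le_trans (hk w))// ler_norm.
have IRe : P.-integrable setT (fun w => (Rez (g (U w)))%:E).
  by apply: moment2_integrable_part Ig => // [|w]; [case: mgU|exact: abs_Re_le].
have IIm : P.-integrable setT (fun w => (Imz (g (U w)))%:E).
  by apply: moment2_integrable_part Ig => // [|w]; [case: mgU|exact: abs_Im_le].
pose V (w : T) : C := ((S w)^* * Y w + (S w)^* * Y w)%R.
have mV : cmeasurable (V : TG -> C).
  by apply: cmeasurableD; apply: cmeasurableM => //; exact: cmeasurableJ.
have mVT := cmeasurable_sigmaG mV.
have IV1 : P.-integrable setT (fun w => (normc (S w) ^+ 2 + normc (Y w) ^+ 2)%:E).
  by under eq_fun do rewrite EFinD; exact: integrableD.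
have leV w (x : R) : (`|x| <= normc (V w) -> `|x| <= normc (S w) ^+ 2 + normc (Y w) ^+ 2)%R.
  move=> xV; apply: (le_trans xV); rewrite /V -mulr2n -mulr_natl normcM normcM normc_conj.
  rewrite -(rmorph_nat (real_complex R)) normc_real normr_nat.
  by have := sqr_ge0 (normc (S w) - normc (Y w))%R; nra.
have IReV : P.-integrable setT (fun w => (Rez (V w))%:E).
  by apply: bound IV1 => [|w]; [case: mVT|exact/leV/abs_Re_le].
have IImV : P.-integrable setT (fun w => (- Imz (V w))%:E).
  apply: bound IV1 => [|w]; first by case: mVT => _; exact: measurable_funN.
  by rewrite normrN; exact/leV/abs_Im_le.
have mg' : cmeasurable g by [].
have [mg1 mg2] := mg.
have [mV1 mV2] := mV.
have [IC C0] := integral_indepM0 mU mG setIG GT indep (f := fun x => Rez (g x))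
  (Y := fun w => Rez (V w)) mg1 mV1 IRe IReV g1.
have [ID D0] := integral_indepM0 mU mG setIG GT indep (f := fun x => Imz (g x))
  (Y := fun w => (- Imz (V w))%R) mg2 (measurable_funN mV2) IIm IImV g2.
have B0 := ge0_integral_indepM mU mG setIG GT indep (f := fun x => (normc (g x) ^+ 2)%R)
  (Y := fun w => (normc (Y w) ^+ 2)%R) (measurable_normc2 mg) (measurable_normc2 mY)
  (fun=> sqr_ge0 _) (fun=> sqr_ge0 _).
have IB : P.-integrable setT (fun w => (normc (g (U w)) ^+ 2 * normc (Y w) ^+ 2)%:E).
  apply/integrableP; split.
    apply/measurable_EFinP; apply: measurable_funM; exact: measurable_normc2.
  rewrite (eq_integral (fun w => (normc (g (U w)) ^+ 2 * normc (Y w) ^+ 2)%:E)).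
    rewrite B0; apply: lte_mul_pinfty => //; first exact: moment2_ge0.
    by rewrite ge0_fin_numE// moment2_ge0.
  by move=> w _; rewrite /= ger0_norm// mulr_ge0// sqr_ge0.
transitivity (\int[P]_w (((normc (S w) ^+ 2)%:E + (normc (g (U w)) ^+ 2 * normc (Y w) ^+ 2)%:E)
   + ((Rez (g (U w)) * Rez (V w))%:E + (Imz (g (U w)) * - Imz (V w))%:E))).
  apply: eq_integral => w _; rewrite -!EFinD; congr (_%:E).
  rewrite /V !normc_sqrE !Re_add !Im_add !Re_mul !Im_mul cRe_conj cIm_conj; ring.
rewrite integralD//; [|exact: integrableD|exact: integrableD].
rewrite integralD// [X in _ + X]integralD// C0 D0 adde0 adde0.
by congr (_ + _).
Qed.

End OrthogonalStep.

(** * Quadratic forms in independent variables *)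

Section QuadraticForm.
Context {R : realType} {d d1 : measure_display}.
Context {T : measurableType d} {E : measurableType d1}.
Variables (P : probability T R) (n : nat).
Variables (G : 'I_n -> set (set T)) (U : 'I_n -> T -> E).
Hypothesis mU : forall j, measurable_fun setT (U j).
Hypothesis mG : forall j, G j `<=` measurable.
Hypothesis setIG : forall j, setI_closed (G j).
Hypothesis GT : forall j, G j setT.
Hypothesis indep : forall j B S, measurable B -> G j S ->
  P (U j @^-1` B `&` S) = (P (U j @^-1` B) * P S)%E.
Local Notation TG j := (g_sigma_algebraType (G j)).
Hypothesis mUG : forall i j, i != j -> measurable_fun setT (U i : TG j -> E).
Local Notation C := R[i].
Local Open Scope ereal_scope.

Let mgUG (g : E -> C) i j : cmeasurable g -> i != j ->
  cmeasurable ((fun w => g (U i w)) : TG j -> C).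
Proof.
move=> [g1 g2] ij; split.
  exact: (measurableT_comp g1 (mUG ij)).
exact: (measurableT_comp g2 (mUG ij)).
Qed.

Definition centered (g : E -> C) := forall j,
  \int[P]_w (Rez (g (U j w)))%:E = 0 /\ \int[P]_w (Imz (g (U j w)))%:E = 0.

(** The summands are martingale differences for the order of 'I_n. *)
Lemma moment2_orthogonal_sum (g : E -> C) (K : R) (Y : 'I_n -> T -> C) :
  (0 <= K)%R -> cmeasurable g -> centered g ->
  (forall j, moment2 P (fun w => g (U j w)) <= K%:E) ->
  (forall i j : 'I_n, (i <= j)%N -> cmeasurable (Y i : TG j -> C)) ->
  (forall j, moment2 P (Y j) < +oo) ->
  moment2 P (fun w => \sum_j g (U j w) * Y j w)%R <= K%:E * \sum_j moment2 P (Y j).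
Proof.
move=> K0 mg g0 gK mY IY.
pose S (p : nat) w := (\sum_(j < n | (j < p)%N) g (U j w) * Y j w)%R.
have step p : (p <= n)%N ->
    moment2 P (S p) <= K%:E * \sum_(j < n | (j < p)%N) moment2 P (Y j).
  elim: p => [_|p IH pn].
    rewrite [leLHS](_ : _ = 0); last first.
      rewrite /moment2 /S; apply: integral0_eq => w _.
      by rewrite big1// normc_real normr0 expr0n.
    by rewrite mule_ge0// ?sume_ge0// => j _; exact: moment2_ge0.
  pose jp := Ordinal pn.
  have split_jp (V : nmodType) (F : 'I_n -> V) :
      (\sum_(j < n | (j < p.+1)%N) F j = F jp + \sum_(j < n | (j < p)%N) F j)%R.
    rewrite (bigD1 jp)//=; congr (_ + _)%R; apply: eq_bigl => j.
    by rewrite -val_eqE /= ltnS andbC ltn_neqAle.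
  have {IH} := IH (ltnW pn) => IH.
  have mS : cmeasurable (S p : TG jp -> C).
    apply: cmeasurable_sum => j jp'; apply: cmeasurableM.
      by apply: mgUG => //; rewrite -val_eqE /= ltn_eqF.
    by apply: mY; exact: ltnW.
  have IS : moment2 P (S p) < +oo.
    apply: (le_lt_trans IH); apply: lte_mul_pinfty => //.
    by apply: lte_sum_pinfty.
  rewrite (_ : S p.+1 = fun w => (S p w + g (U jp w) * Y jp w)%R); last first.
    by apply/funext => w; rewrite /S split_jp addrC.
  have [g1 g2] := g0 jp.
  rewrite (moment2_orthogonal (@mU jp) (@mG jp) (@setIG jp) (@GT jp) (@indep jp) mg mS
    (mY jp jp (leqnn _)) g1 g2 _ IS (IY jp)); last first.
    by apply: (le_lt_trans (gK jp)); rewrite ltry.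
  rewrite split_jp (ge0_muleDr _ (moment2_ge0 P (Y jp))); last first.
    by rewrite sume_ge0// => j _; exact: moment2_ge0.
  rewrite addeC; apply: leeD => //.
  by apply: lee_wpmul2r => //; exact: moment2_ge0.
have := step n (leqnn n).
rewrite (_ : S n = (fun w => \sum_j g (U j w) * Y j w)%R); last first.
  by apply/funext => w; apply: eq_bigl => j; rewrite ltn_ord.
by rewrite (eq_bigl predT)// => j; rewrite ltn_ord.
Qed.

Lemma sum_triangles (V : nmodType) (F : 'I_n -> 'I_n -> V) :
  (\sum_j \sum_k F j k = \sum_j F j j
     + (\sum_(j < n) \sum_(k < n | (k < j)%N) F j k
        + \sum_(k < n) \sum_(j < n | (j < k)%N) F j k))%R.
Proof.
rewrite [X in (_ = _ + (_ + X))%R](exchange_big_dep predT)//=.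
rewrite -!big_split /=; apply: eq_bigr => j _.
rewrite (bigD1 j)//=; congr (_ + _)%R.
rewrite (bigID (fun k : 'I_n => (k < j)%N)) /=; congr (_ + _)%R.
  by apply: eq_bigl => k; rewrite -val_eqE /= andbC; case: ltngtP.
by apply: eq_bigl => k; rewrite -val_eqE /= -leqNgt; case: ltngtP.
Qed.

(** Splitting the form along the diagonal leaves three sums of martingale
    differences: sum_j H_jj (|a_j|^2 - 1), sum_j a_j^* (sum_(k<j) H_jk a_k) and
    its mirror image. *)
Lemma moment2_quadratic_form (a : E -> C) (K B : R) (H : T -> 'M[C]_n) :
  cmeasurable a -> centered a ->
  (forall j, moment2 P (fun w => a (U j w)) <= 1) ->
  centered (fun x => (normc (a x) ^+ 2)%:C - 1)%R ->
  (0 <= K)%R ->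
  (forall j, moment2 P (fun w => (normc (a (U j w)) ^+ 2)%:C - 1)%R <= K%:E) ->
  (forall j, mxmeasurable (H : TG j -> 'M[C]_n)) -> mxmeasurable H ->
  (forall w, \sum_j \sum_k normc (H w j k) ^+ 2 <= B)%R ->
  moment2 P (fun w => sesq (\col_j a (U j w)) (H w *m \col_j a (U j w)) - \tr (H w))%R
  <= (2 * (K + 4) * B)%:E.
Proof.
move=> ma a0 a1 b0 K0 bK mHG mH HB.
have mHsq j k : measurable_fun setT (fun w => (normc (H w j k) ^+ 2)%:E).
  exact/measurable_EFinP/measurable_normc2/mH.
have p2 (z : C) : 0 <= (normc z ^+ 2)%:E by rewrite lee_fin sqr_ge0.
have sumH : \sum_j \sum_k moment2 P (fun w => H w j k) <= B%:E.
  rewrite /moment2; under eq_bigr => j _.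
    rewrite -ge0_integral_sum//; over.
  rewrite -ge0_integral_sum//; last 2 first.
  - by move=> j; exact: emeasurable_sum.
  - by move=> j w _; rewrite sume_ge0.
  apply: (@le_trans _ _ (\int[P]_w (cst B%:E) w)); last first.
    by rewrite integral_cst//= probability_setT mule1.
  apply: ge0_le_integral => //.
  - by move=> w _; rewrite sume_ge0// => j _; rewrite sume_ge0.
  - by apply: emeasurable_sum => j; exact: emeasurable_sum.
  - move=> w _; rewrite /cst; under eq_bigr do rewrite sumEFin.
    by rewrite sumEFin lee_fin.
have IH j k : moment2 P (fun w => H w j k) < +oo.
  apply: (@le_lt_trans _ _ B%:E); last exact: ltry.
  apply: le_trans sumH; rewrite (bigD1 j)//= (bigD1 k)//=.
  rewrite -addeA leeDl// adde_ge0// sume_ge0// => i _; rewrite ?sume_ge0// => *;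
    exact: moment2_ge0.
pose aU j w := a (U j w).
have maU j : cmeasurable (aU j).
  by case: ma => a1' a2'; split; [exact: (measurableT_comp a1' (mU j))|exact: (measurableT_comp a2' (mU j))].
pose W (j : 'I_n) w := (\sum_(k < n | (k < j)%N) aU k w * H w j k)%R.
pose W' (k : 'I_n) w := (\sum_(j < n | (j < k)%N) (aU j w)^* * H w j k)%R.
pose g' x := ((a x)^*)%R.
have mg' : cmeasurable g' by exact: cmeasurableJ.
have g'0 : centered g'.
  move=> j; have [r0 i0] := a0 j; split.
    by rewrite -r0; apply: eq_integral => w _; rewrite /g' cRe_conj.
  under eq_integral do rewrite /g' cIm_conj EFinN -mulN1e.
  rewrite integralZl ?i0 ?mule0//.
  apply: moment2_integrable_part (maU j) _ _ _; first by have [] := maU j.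
    by move=> w; exact: abs_Im_le.
  by apply: le_lt_trans (a1 j) _; rewrite ltry.
have g'1 j : moment2 P (fun w => g' (U j w)) <= 1.
  by rewrite /moment2; under eq_integral do rewrite /g' normc_conj; exact: a1.
have boundW (g : E -> C) (Y : 'I_n -> T -> C) (p : pred 'I_n) :
    cmeasurable g -> centered g -> (forall j, moment2 P (fun w => g (U j w)) <= 1) ->
    (forall k j, cmeasurable (Y k : TG j -> C)) -> (forall k, moment2 P (Y k) < +oo) ->
    moment2 P (fun w => \sum_(k | p k) g (U k w) * Y k w)%R <= \sum_k moment2 P (Y k).
  move=> mg g0 g1 mY IY.
  pose Y' k w := if p k then Y k w else 0%R.
  rewrite (_ : (fun w => _) = fun w => (\sum_k g (U k w) * Y' k w)%R); last first.
    apply/funext => w; rewrite big_mkcond; apply: eq_bigr => k _ /=.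
    by rewrite /Y'; case: ifP => // _; rewrite mulr0.
  have mY' k j : cmeasurable (Y' k : TG j -> C).
    by rewrite /Y'; case: (p k) => //; exact: cmeasurable_cst.
  have leY' k : moment2 P (Y' k) <= moment2 P (Y k).
    rewrite /Y'; case: (p k) => //.
    rewrite [leLHS](_ : _ = 0) ?moment2_ge0//.
    by apply: integral0_eq => w _; rewrite normc_real normr0 expr0n.
  apply: (@le_trans _ _ (1%:E * \sum_k moment2 P (Y' k))).
    apply: moment2_orthogonal_sum => // k.
    exact: le_lt_trans (leY' k) (IY k).
  by rewrite mul1e; apply: lee_sum.
have sqE w : (sesq (\col_j a (U j w)) (H w *m \col_j a (U j w)) - \tr (H w)
   = \sum_j ((normc (aU j w) ^+ 2)%:C - 1) * H w j j
     + (\sum_j (aU j w)^* * W j w + \sum_k aU k w * W' k w))%R.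
  rewrite sesqE (eq_bigr (fun j => \sum_k (aU j w)^* * (H w j k * aU k w)))%R; last first.
    by move=> j _; rewrite !mxE mulr_sumr; apply: eq_bigr => k _; rewrite !mxE.
  rewrite sum_triangles addrAC; congr (_ + (_ + _))%R.
  - rewrite /mxtrace -sumrB; apply: eq_bigr => j _.
    by rewrite mulrBl mul1r -mulcJ; congr (_ - _)%R; rewrite mulrA mulrAC.
  - apply: eq_bigr => j _; rewrite mulr_sumr; apply: eq_bigr => k _.
    by rewrite [(H w j k * _)%R]mulrC.
  - apply: eq_bigr => k _; rewrite mulr_sumr; apply: eq_bigr => j _.
    by rewrite mulrA mulrC.
under eq_fun do rewrite sqE.
have mW (i j : 'I_n) : (i <= j)%N -> cmeasurable (W i : TG j -> C).
  move=> ij; apply: cmeasurable_sum => k ki; apply: cmeasurableM; last exact: mHG.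
  by apply: mgUG => //; rewrite -val_eqE /= ltn_eqF// (leq_trans ki).
have mW' (i j : 'I_n) : (i <= j)%N -> cmeasurable (W' i : TG j -> C).
  move=> ij; apply: cmeasurable_sum => k ki; apply: cmeasurableM; last exact: mHG.
  by apply: (mgUG mg'); rewrite -val_eqE /= ltn_eqF// (leq_trans ki).
have leW j : moment2 P (W j) <= \sum_k moment2 P (fun w => H w j k).
  by apply: boundW => // k i; exact: mHG.
have leW' k : moment2 P (W' k) <= \sum_j moment2 P (fun w => H w j k).
  by apply: (boundW g') => // i j; exact: mHG.
have Isum (F : 'I_n -> \bar R) : (forall k, F k < +oo) -> \sum_k F k < +oo.
  by move=> FK; exact: lte_sum_pinfty.
have IW j : moment2 P (W j) < +oo by apply: le_lt_trans (leW j) _; exact: Isum.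
have IW' j : moment2 P (W' j) < +oo by apply: le_lt_trans (leW' j) _; exact: Isum.
have LoB : moment2 P (fun w => \sum_j (aU j w)^* * W j w)%R <= B%:E.
  apply: (@le_trans _ _ (1%:E * \sum_j moment2 P (W j))).
    exact: (moment2_orthogonal_sum (g := g')).
  by rewrite mul1e; apply: le_trans sumH; apply: lee_sum => j _.
have UpB : moment2 P (fun w => \sum_k aU k w * W' k w)%R <= B%:E.
  apply: (@le_trans _ _ (1%:E * \sum_j moment2 P (W' j))).
    exact: (moment2_orthogonal_sum (g := a)).
  rewrite mul1e; apply: le_trans sumH; rewrite exchange_big /=.
  by apply: lee_sum => j _.
have DiB : moment2 P (fun w => \sum_j ((normc (aU j w) ^+ 2)%:C - 1) * H w j j)%R
    <= (K * B)%:E.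
  apply: (@le_trans _ _ (K%:E * \sum_j moment2 P (fun w => H w j j))).
    apply: (moment2_orthogonal_sum (g := fun x => (normc (a x) ^+ 2)%:C - 1)%R) => //.
    - apply: cmeasurableB; last exact: cmeasurable_cst.
      exact/cmeasurable_real/measurable_normc2.
    - by move=> i j _; exact: mHG.
  rewrite EFinM; apply: lee_wpmul2l; rewrite ?lee_fin//; apply: le_trans sumH.
  apply: lee_sum => j _; rewrite (bigD1 j)//= leeDl// sume_ge0// => *.
  exact: moment2_ge0.
have mWT j : cmeasurable (W j) by exact: (cmeasurable_sigmaG (@mG j) (mW j j (leqnn _))).
have mWT' j : cmeasurable (W' j) by exact: (cmeasurable_sigmaG (@mG j) (mW' j j (leqnn _))).
apply: (le_trans (moment2D _ _ _)).
- apply: cmeasurable_sum => j _; apply: cmeasurableM => //.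
  apply: cmeasurableB; last exact: cmeasurable_cst.
  exact/cmeasurable_real/measurable_normc2.
- apply: cmeasurableD; apply: cmeasurable_sum => j _; apply: cmeasurableM => //.
  exact: cmeasurableJ.
rewrite -mulrA EFinM; apply: lee_wpmul2l => //.
rewrite mulrDl EFinD; apply: leeD => //.
apply: (le_trans (moment2D _ _ _)).
- by apply: cmeasurable_sum => j _; apply: cmeasurableM => //; exact: cmeasurableJ.
- by apply: cmeasurable_sum => j _; apply: cmeasurableM.
have -> : ((4 * B)%:E = 2%:E * (B%:E + B%:E)) by rewrite -EFinD -EFinM; congr (_%:E); ring.
by apply: lee_wpmul2l => //; exact: leeD.
Qed.

End QuadraticForm.

(** * The sigma-algebra of all entries but one *)

Section OtherEntries.
Context {R : realType} {d d1 d2 : measure_display}.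
Context {T : measurableType d} {E : measurableType d1} {F : measurableType d2}.
Variables (P : probability T R) (I : finType) (J : Type).
Variables (X : I -> T -> E) (Y : J -> T -> F).
Hypothesis mX : forall i, measurable_fun setT (X i).
Hypothesis mY : forall j, measurable_fun setT (Y j).
Hypothesis indX : independent_family P X.
Hypothesis indYX : independent_families P Y X.
Variable i0 : I.

(** A pi-system that generates the sigma-algebra of Y and of the X i, i != i0. *)
Definition others : set (set T) := [set S | exists B V,
  [/\ forall i, measurable (B i), family_sigma_algebra Y V &
      S = (\bigcap_(i in [set i | i != i0]) (X i @^-1` B i)) `&` V]].

Let sigmaY_measurable V : family_sigma_algebra Y V -> measurable V.
Proof.
apply: smallest_sub; first exact: sigma_algebra_measurable.
by move=> _ [j _ [B mB <-]]; exact: mY.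
Qed.

Let sigmaX_bigcap (D : set I) (B : I -> set E) : (forall i, measurable (B i)) ->
  family_sigma_algebra X (\bigcap_(i in D) (X i @^-1` B i)).
Proof.
move=> mB.
pose G := \bigcup_i preimage_set_system setT (X i) measurable.
have -> : family_sigma_algebra X = measurable :> set (set (g_sigma_algebraType G)) by [].
apply: fin_bigcap_measurable; first exact: finite_finset.
move=> i _; apply: sub_sigma_algebra; exists i => //; exists (B i) => //.
by rewrite setTI.
Qed.

Lemma others_measurable : others `<=` measurable.
Proof.
move=> _ [B [V [mB mV ->]]]; apply: measurableI; last exact: sigmaY_measurable.
apply: fin_bigcap_measurable; first exact: finite_finset.
by move=> i _; rewrite -[X in measurable X]setTI; exact: mX.
Qed.

Let G_Y := \bigcup_j preimage_set_system setT (Y j) measurable.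

Lemma others_setI : setI_closed others.
Proof.
move=> _ _ [B1 [V1 [mB1 mV1 ->]]] [B2 [V2 [mB2 mV2 ->]]].
exists (fun i => B1 i `&` B2 i), (V1 `&` V2); split.
- by move=> i; exact: measurableI.
- exact: (@measurableI _ (g_sigma_algebraType G_Y)).
- by rewrite setIACA -bigcapI.
Qed.

Lemma others_setT : others setT.
Proof.
exists (fun=> setT), setT; split => //.
- exact: (@measurableT _ (g_sigma_algebraType G_Y)).
- by rewrite setIT; apply/seteqP; split.
Qed.

Lemma others_indep B S : measurable B -> others S ->
  P (X i0 @^-1` B `&` S) = (P (X i0 @^-1` B) * P S)%E.
Proof.
move=> mB [B' [V [mB' mV ->]]].
pose D i := if i == i0 then B else B' i.
have mD i : measurable (D i) by rewrite /D; case: eqP.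
have capE : X i0 @^-1` B `&` \bigcap_(i in [set i | i != i0]) (X i @^-1` B' i)
    = \bigcap_(i in [set` [set: I]%SET]) (X i @^-1` D i).
  apply/seteqP; split => w.
    move=> [w0 w1] i _; rewrite /D /=; case: eqP => [->//|/eqP ii0].
    exact: w1.
  move=> w1; split; first by have := w1 i0; rewrite /D /= eqxx; apply; rewrite inE.
  by move=> i /= ii0; have := w1 i; rewrite /D /= (negbTE ii0); apply; rewrite inE.
have capE' : \bigcap_(i in [set i | i != i0]) (X i @^-1` B' i)
    = \bigcap_(i in [set` (~: [set i0])%SET]) (X i @^-1` D i).
  apply/seteqP; split => w w1 i /=.
    by rewrite !inE => ii0; rewrite /D (negbTE ii0); exact: w1.
  by move=> ii0; have := w1 i; rewrite /D /= (negbTE ii0) !inE; exact.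
have sX (K : set I) := sigmaX_bigcap K mD.
rewrite setIA capE setIC (indYX mV (sX _)) capE' [in RHS]setIC (indYX mV (sX _)).
rewrite muleCA; congr (_ * _)%E.
rewrite !(indX _ mD) (bigD1 i0) ?inE//=; congr (_ * _)%E.
  by rewrite /D eqxx.
by apply: eq_bigl => i; rewrite !inE.
Qed.

Local Notation TG := (g_sigma_algebraType others).

Lemma others_measurable_X i : i != i0 -> measurable_fun setT (X i : TG -> E).
Proof.
move=> ii0 _ B mB; rewrite setTI; apply: sub_sigma_algebra.
exists (fun k => if k == i then B else setT), setT; split.
- by move=> k; case: eqP.
- exact: (@measurableT _ (g_sigma_algebraType G_Y)).
- rewrite setIT; apply/seteqP; split => w.
    by move=> wB k _ /=; case: eqP => // ->.
  by move=> /(_ i ii0); rewrite /= eqxx.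
Qed.

Lemma others_measurable_Y j : measurable_fun setT (Y j : TG -> F).
Proof.
move=> _ B mB; rewrite setTI; apply: sub_sigma_algebra.
exists (fun=> setT), (Y j @^-1` B); split => //.
- apply: sub_sigma_algebra; exists j => //; exists B => //; exact: setTI.
- by apply/seteqP; split => w //; case.
Qed.

End OtherEntries.

(** * Integrals against counting measures *)

Section Counting.
Context {R : realType}.
Implicit Types (s : seq R) (phi : R -> R).
Local Notation borelR := (measurableTypeR R).

Let nat_inv_num s : (NngNum (@inv_nat_ge0 R (size s)))%:num = (size s)%:R^-1.
Proof. by []. Qed.

Lemma ge0_integral_counting s phi : measurable_fun (setT : set borelR) phi ->
  (forall x, 0 <= phi x) ->
  (\int[normalized_counting s]_x (phi x)%:E)%E
  = ((size s)%:R^-1 * \sum_(x <- s) phi x)%:E.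
Proof.
move=> mphi phi0.
have mphiE : measurable_fun (setT : set borelR) (fun x => (phi x)%:E).
  exact/measurable_EFinP.
rewrite /normalized_counting ge0_integral_mscale//; last first.
  by move=> x _; rewrite lee_fin.
rewrite ge0_integral_measure_sum//; last by move=> x _; rewrite lee_fin.
rewrite nat_inv_num EFinM; congr (_ * _)%E.
rewrite (big_nth 0) big_mkord -sumEFin; apply: eq_bigr => i _.
by rewrite integral_dirac// diracT mul1e.
Qed.

Lemma Rintegral_counting s phi : measurable_fun (setT : set borelR) phi ->
  \int[normalized_counting s]_x phi x = (size s)%:R^-1 * \sum_(x <- s) phi x.
Proof.
move=> mphi; rewrite /Rintegral integralE.
have mpos := measurable_funrpos mphi; have mneg := measurable_funrneg mphi.
have -> : (fun x : borelR => (phi x)%:E)^\+%E = EFin \o phi^\+ by exact: funerpos.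
have -> : (fun x : borelR => (phi x)%:E)^\-%E = EFin \o phi^\- by exact: funerneg.
rewrite /=.
rewrite (ge0_integral_counting _ mpos) ?(ge0_integral_counting _ mneg)//=.
rewrite -mulrBr -sumrB; congr (_ * _); apply: eq_bigr => x _.
by rewrite /funrpos /funrneg /Num.max; case: ifPn; case: ifPn; lra.
Qed.

Lemma normalized_counting_setT s : s != [::] ->
  normalized_counting s (setT : set borelR) = 1%E.
Proof.
move=> s0; have := @ge0_integral_counting s (fun=> 1) (@measurable_cst _ _ _ _ _ _) (fun=> ler01).
rewrite integral_cst//= mul1e => ->.
rewrite big_const_seq count_predT iter_addr_0 -mulr_natl mulr1 mulVf//.
by rewrite pnatr_eq0 size_eq0.
Qed.

Lemma measurable_counting {d} {T : measurableType d} {m} (t : 'I_m -> T -> R) phi :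
  (forall l, measurable_fun setT (t l)) ->
  measurable_fun setT (phi : borelR -> R) ->
  measurable_fun setT (fun w => \int[normalized_counting (codom (t ^~ w))]_x phi x).
Proof.
move=> mt mphi; under eq_fun do rewrite Rintegral_counting// size_codom card_ord big_image /=.
apply: measurable_funM => //; apply: measurable_sum => l.
exact: (measurableT_comp mphi (mt l)).
Qed.

End Counting.

(** * Concentration of the quadratic forms of the columns *)

Lemma mxmeasurable_sample_matrix {R : realType} {d} {T : measurableType d} {m n}
    (A : T -> 'M[R[i]]_(n, m)) (t : T -> 'I_m -> R) :
  (forall l, (forall w, t w l = 0) \/
     (measurable_fun setT (t ^~ l) /\ forall j, cmeasurable (fun w => A w j l))) ->
  mxmeasurable (fun w => sample_matrix (A w) (t w)).
Proof.
move=> tA j k; under eq_fun do rewrite sample_matrixE summxE.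
apply: cmeasurable_sum => l _; rewrite /rank_one.
under eq_fun do rewrite !mxE big_ord1 !mxE.
have [t0|[mt mA]] := tA l.
  by under eq_fun do rewrite t0 !mul0r; exact: cmeasurable_cst.
apply: cmeasurableM.
  by apply: cmeasurable_real; exact: measurable_funM.
by apply: cmeasurableM => //; exact: cmeasurableJ.
Qed.

Section ColumnForms.
Context {R : realType} {d : measure_display} {T : measurableType d}.
Variables (P : probability T R) (m n : nat) (A : T -> 'M[R[i]]_(n, m)).
Variables (t : 'I_m -> T -> R) (a4 : R).
Local Notation C := R[i].
Local Notation borelR := (measurableTypeR R).
Local Notation E := (borelR * borelR)%type.
Hypothesis A_iid : iid_family P (entry_pair A).
Hypothesis A_mean : forall j k, complex_expectation P (fun w => A w j k) = 0.
Hypothesis A_var : forall j k, ('E_P[fun w => (normc (A w j k) ^+ 2)%R] = 1)%E.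
Hypothesis A_fourth : forall j k,
  ('E_P[fun w => (normc (A w j k) ^+ 4)%R] <= a4%:E)%E.
Hypothesis n0 : (0 < n)%N.
Hypothesis mt : forall l, measurable_fun setT (t l).
Hypothesis tA : independent_families P (fun l => t l : T -> borelR) (entry_pair A).

Let mX jk : measurable_fun setT (entry_pair A jk).
Proof. by case: A_iid. Qed.

Definition pair_complex (p : E) : C := p.1 +i* p.2.

Let pairE w j l : pair_complex (entry_pair A (j, l) w) = A w j l.
Proof. by rewrite /pair_complex /=; case: (A w j l). Qed.

Let mpair : cmeasurable pair_complex.
Proof. by split; [exact: measurable_fst|exact: measurable_snd]. Qed.

Let mA j l : cmeasurable (fun w => A w j l).
Proof.
have mj := mX (j, l); split.
  exact: (measurableT_comp measurable_fst mj).
exact: (measurableT_comp measurable_snd mj).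
Qed.

Lemma mxmeasurable_A : mxmeasurable A.
Proof. by move=> j l; exact: mA. Qed.

Local Notation TG jl := (g_sigma_algebraType
  (others (entry_pair A) (fun l => t l : T -> borelR) jl)).

Lemma a4_ge0 (j : 'I_n) (l : 'I_m) : 0 <= a4.
Proof.
rewrite -lee_fin; apply: le_trans (A_fourth j l); rewrite unlock.
by apply: integral_ge0 => w _; rewrite lee_fin exprn_ge0// normc_ge0.
Qed.

Lemma moment2_entry j l : moment2 P (fun w => A w j l) = 1%E.
Proof. by rewrite -(A_var j l) unlock. Qed.

Let centered_entry l : centered P (fun j => entry_pair A (j, l)) pair_complex.
Proof.
move=> j; have [/eqP Re0 /eqP Im0] : Rez (complex_expectation P (fun w => A w j l)) == 0
    /\ Imz (complex_expectation P (fun w => A w j l)) == 0.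
  by rewrite A_mean /= !eqxx.
have [mA1 mA2] := mA j l.
have fin1 : (moment2 P (fun w => A w j l) < +oo)%E by rewrite moment2_entry ltry.
have i1 := moment2_integrable_part (mA j l) mA1 (fun w => abs_Re_le _) fin1.
have i2 := moment2_integrable_part (mA j l) mA2 (fun w => abs_Im_le _) fin1.
move: Re0 Im0; rewrite /complex_expectation /= unlock => Re0 Im0; split.
- by rewrite -[LHS]fineK ?Re0//; exact: integrable_fin_num.
- by rewrite -[LHS]fineK ?Im0//; exact: integrable_fin_num.
Qed.

Let msq j l : measurable_fun setT (fun w => normc (A w j l) ^+ 2).
Proof. exact: measurable_normc2. Qed.

Let centered_sqr l : centered P (fun j => entry_pair A (j, l))
  (fun p => (normc (pair_complex p) ^+ 2)%:C - 1).
Proof.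
move=> j; split; last first.
  by apply: integral0_eq => w _; rewrite Im_add Im_opp /= subr0.
under eq_integral do rewrite pairE Re_add Re_opp [Rez _%:C]/= [Rez 1]/= EFinB.
rewrite integralB//.
- by rewrite -/(moment2 P (fun w => A w j l)) moment2_entry integral_cst//= probability_setT mule1 subee.
- by apply: moment2_integrable => //; rewrite moment2_entry ltry.
- exact: finite_measure_integrable_cst.
Qed.

Let moment2_sqr l j :
  (moment2 P (fun w => (normc (pair_complex (entry_pair A (j, l) w)) ^+ 2)%:C - 1)%R
  <= (a4 + 1)%:E)%E.
Proof.
apply: (@le_trans _ _ (\int[P]_w ((normc (A w j l) ^+ 4)%:E + 1))%E).
  apply: ge0_le_integral => //.
  - by move=> w _; rewrite lee_fin sqr_ge0.
  - under eq_fun do rewrite pairE.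
    apply/measurable_EFinP/measurable_normc2/cmeasurableB; last exact: cmeasurable_cst.
    exact: cmeasurable_real.
  - apply: emeasurable_funD => //; apply/measurable_EFinP.
    under eq_fun do rewrite (exprM _ 2 2); exact: measurable_funX.
  - move=> w _; rewrite -EFinD lee_fin pairE -[1 in X in normc X](rmorph1 (real_complex R)).
    rewrite -rmorphB normc_real real_normK ?num_real// (exprM _ 2 2).
    by have := sqr_ge0 (normc (A w j l)); nra.
rewrite ge0_integralD//.
- rewrite integral_cst//= probability_setT mule1 EFinD leeD2r//.
  by have := A_fourth j l; rewrite unlock.
- by move=> w _; rewrite lee_fin exprn_ge0// normc_ge0.
- apply/measurable_EFinP; under eq_fun do rewrite (exprM _ 2 2).
  exact: measurable_funX.
Qed.

(** Entry (j, l) is independent of the sigma-algebra of all other entries and of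
    the weights, with respect to which H is measurable for every j. *)
Lemma moment2_column_form (l : 'I_m) (H : T -> 'M[C]_n) (B : R) :
  (forall j, mxmeasurable (H : TG (j, l) -> 'M[C]_n)) -> mxmeasurable H ->
  (forall w, \sum_j \sum_k normc (H w j k) ^+ 2 <= B) ->
  (moment2 P (fun w => sesq (col l (A w)) (H w *m col l (A w)) - \tr (H w))%R
  <= (2 * (a4 + 5) * B)%:E)%E.
Proof.
move=> mHG mH HB.
have colE w : col l (A w) = \col_j pair_complex (entry_pair A (j, l) w).
  by apply/matrixP => j k; rewrite !mxE pairE.
under eq_fun do rewrite colE.
have [mt' _ _] := A_iid.
have a40 : 0 <= a4 by exact: a4_ge0 (Ordinal n0) l.
rewrite (_ : 2 * (a4 + 5) = 2 * ((a4 + 1) + 4)); last by ring.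
have [_ indX _] := A_iid.
apply: (moment2_quadratic_form
  (G := fun j => others (entry_pair A) (fun l => t l : T -> borelR) (j, l))) => //.
- by move=> j; exact: others_measurable.
- by move=> j; exact: others_setI.
- by move=> j; exact: others_setT.
- by move=> j B' S mB' GS; apply: (others_indep _ _ _ GS).
- by move=> i j ij; apply: others_measurable_X; apply: contraNneq ij => -[->].
- by move=> j; under eq_fun do rewrite pairE; rewrite moment2_entry.
- by rewrite addr_ge0.
Qed.

Lemma moment2Z (c : C) (f : T -> C) : cmeasurable f ->
  moment2 P (fun w => c * f w) = ((normc c ^+ 2)%:E * moment2 P f)%E.
Proof.
move=> mf; rewrite /moment2 -ge0_integralZl_EFin//.
- by apply: eq_integral => w _; rewrite -EFinM normcM exprMn.
- by move=> w _; rewrite lee_fin sqr_ge0.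
- exact/measurable_EFinP/measurable_normc2.
- exact: sqr_ge0.
Qed.

Let nR0 : 0 < n%:R :> R. Proof. by rewrite ltr0n. Qed.

Let normc_nV : normc (n%:R^-1 : C) ^+ 2 = n%:R^-2.
Proof.
by rewrite normcV -(rmorph_nat (real_complex R)) normc_real normr_nat exprVn.
Qed.

Let col_measurable l : mxmeasurable (fun w => col l (A w)).
Proof. by move=> j k; under eq_fun do rewrite mxE; exact: mA. Qed.

Lemma moment2_normalized_form l (H : T -> 'M[C]_n) (B : R) :
  (forall j, mxmeasurable (H : TG (j, l) -> 'M[C]_n)) -> mxmeasurable H ->
  (forall w, \sum_j \sum_k normc (H w j k) ^+ 2 <= n%:R * B) ->
  (moment2 P (fun w => n%:R^-1 * (sesq (col l (A w)) (H w *m col l (A w)) - \tr (H w)))%R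
  <= (2 * (a4 + 5) * B / n%:R)%:E)%E.
Proof.
move=> mHG mH HB; rewrite moment2Z; last first.
  apply: cmeasurableB; last exact: cmeasurable_tr.
  apply: cmeasurable_sesq; first exact: col_measurable.
  by apply: mxmeasurable_mul => //; exact: col_measurable.
rewrite normc_nV.
have -> : 2 * (a4 + 5) * B / n%:R = n%:R^-2 * (2 * (a4 + 5) * (n%:R * B)).
  by field; rewrite gt_eqF.
rewrite [leRHS]EFinM; apply: lee_wpmul2l; first by rewrite lee_fin invr_ge0 exprn_ge0// ltW.
exact: moment2_column_form.
Qed.

Variables (z : C) (h : R -> R).
Hypothesis z0 : 0 < Imz z.
Hypothesis mh : measurable_fun setT h.
Let z_neq0 : Imz z != 0. Proof. by rewrite gt_eqF. Qed.

Let tau w l : R := h (t l w).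

Definition form_defect l w : C :=
  column_form (A w) z (remove (tau w) l) l - ntrace (A w) z (remove (tau w) l).

Definition norm_defect l w : R := sqnorm (col l (A w)) / n%:R - 1.

Let tau_measurable l : measurable_fun setT (tau ^~ l).
Proof. exact: (measurableT_comp mh (mt l)). Qed.

Let form_defectE l w : form_defect l w = n%:R^-1 *
  (sesq (col l (A w)) (resolvent (sample_matrix (A w) (remove (tau w) l)) z *m col l (A w))
   - \tr (resolvent (sample_matrix (A w) (remove (tau w) l)) z)).
Proof. by rewrite /form_defect ntrace.unlock column_form.unlock mulrBr. Qed.

(** Without column l, the resolvent is a function of the weights and of the
    entries of the other columns. *)
Lemma moment2_form_defect l :
  (moment2 P (form_defect l) <= (2 * (a4 + 5) * (Imz z)^-2 / n%:R)%:E)%E.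
Proof.
rewrite (funext (form_defectE l)).
pose H w := resolvent (sample_matrix (A w) (remove (tau w) l)) z.
apply: (moment2_normalized_form (H := H)).
- move=> j; apply: (mxmeasurable_resolvent z_neq0) => [w|]; first exact: sample_matrix_herm.
  apply: mxmeasurable_sample_matrix => l'; rewrite /remove.
  have [ll|ll] := eqVneq l' l; [by left|right; split].
    have mtl : measurable_fun setT ((t l' : T -> borelR) : TG (j, l) -> borelR).
    exact: others_measurable_Y.
  exact: (measurableT_comp mh mtl).
  move=> i; have mi : measurable_fun setT (entry_pair A (i, l') : TG (j, l) -> E).
    by apply: others_measurable_X; apply: contraNneq ll => -[_ ->].
  split; first exact: (measurableT_comp measurable_fst mi).
  exact: (measurableT_comp measurable_snd mi).
- apply: (mxmeasurable_resolvent z_neq0) => [w|]; first exact: sample_matrix_herm.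
  apply: mxmeasurable_sample_matrix => l'; rewrite /remove.
  by have [ll|ll] := eqVneq l' l; [left|right].
- by move=> w; exact: sum_sqr_resolvent_le (sample_matrix_herm _ _) z0.
Qed.

(** The case of the identity matrix in place of the resolvent. *)
Lemma moment2_norm_defect l :
  (moment2 P (fun w => (norm_defect l w)%:C) <= (2 * (a4 + 5) * 1 / n%:R)%:E)%E.
Proof.
rewrite (_ : (fun w => _) = fun w =>
    n%:R^-1 * (sesq (col l (A w)) (1%:M *m col l (A w)) - \tr (1%:M : 'M[C]_n))).
  apply: (moment2_normalized_form (H := fun=> 1%:M)).
  - by move=> j i k; exact: cmeasurable_cst.
  - by move=> i k; exact: cmeasurable_cst.
  - move=> w; rewrite mulr1 -[n in n%:R]card_ord -sumr_const; apply: ler_sum => j _.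
    rewrite (bigD1 j)//= big1 => [|k kj].
      by rewrite mxE eqxx mulr1n normc_real normr1 expr1n addr0.
    by rewrite mxE eq_sym (negbTE kj) mulr0n normc_real normr0 expr0n.
apply/funext => w; rewrite mul1mx sesq_sqnorm mxtrace1 mulrBr mulVf ?pnatr_eq0 -?lt0n//.
by rewrite /norm_defect rmorphB rmorph1 rmorphM fmorphV rmorph_nat mulrC.
Qed.

(** The two sources of error in the self-consistent equation: the fluctuation of
    the column forms around the normalized trace, and that of the squared norms
    of the columns around their mean. *)
Definition defect w : R :=
  n%:R^-1 * \sum_l (normc (form_defect l w) ^+ 2 + norm_defect l w ^+ 2).

Let form_defect_measurable l : cmeasurable (form_defect l).
Proof.
rewrite (funext (form_defectE l)).
have mG : mxmeasurable (fun w => resolvent (sample_matrix (A w) (remove (tau w) l)) z).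
  apply: (mxmeasurable_resolvent z_neq0) => [w|]; first exact: sample_matrix_herm.
  apply: mxmeasurable_sample_matrix => l'; rewrite /remove.
  by have [ll|ll] := eqVneq l' l; [left|right].
apply: cmeasurableM; first exact: cmeasurable_cst.
apply: cmeasurableB; last exact: cmeasurable_tr.
apply: cmeasurable_sesq; first exact: col_measurable.
by apply: mxmeasurable_mul => //; exact: col_measurable.
Qed.

Let norm_defect_measurable l : measurable_fun setT (norm_defect l).
Proof.
apply: measurable_funB => //; apply: measurable_funM => //.
apply: measurable_sum => j.
by apply: measurable_normc2; under eq_fun do rewrite mxE; exact: mA.
Qed.

Lemma measurable_defect : measurable_fun setT defect.
Proof.
apply: measurable_funM => //; apply: measurable_sum => l.
apply: measurable_funD; first exact: measurable_normc2.
exact: measurable_funX.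
Qed.

Lemma defect_ge0 w : 0 <= defect w.
Proof.
by apply: mulr_ge0 => //; apply: sumr_ge0 => l _; rewrite addr_ge0// sqr_ge0.
Qed.

Lemma integral_defect_le :
  (\int[P]_w (defect w)%:E
   <= (m%:R / n%:R * (2 * (a4 + 5) * ((Imz z)^-2 + 1) / n%:R))%:E)%E.
Proof.
have mF l : measurable_fun setT (fun w => (normc (form_defect l w) ^+ 2)%:E).
  exact/measurable_EFinP/measurable_normc2.
have mN l : measurable_fun setT (fun w => (norm_defect l w ^+ 2)%:E).
  exact/measurable_EFinP/measurable_funX.
rewrite (eq_integral (fun w => (n%:R^-1)%:E *
    \sum_l ((normc (form_defect l w) ^+ 2)%:E + (norm_defect l w ^+ 2)%:E)))%E; last first.
  by move=> w _; rewrite /defect EFinM -sumEFin.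
rewrite ge0_integralZl_EFin//; last 2 first.
- by move=> w _; apply: sume_ge0 => l _; rewrite adde_ge0// lee_fin sqr_ge0.
- by apply: emeasurable_sum => l; exact: emeasurable_funD.
have -> : m%:R / n%:R * (2 * (a4 + 5) * ((Imz z)^-2 + 1) / n%:R)
    = n%:R^-1 * \sum_(l < m) (2 * (a4 + 5) * (Imz z)^-2 / n%:R + 2 * (a4 + 5) * 1 / n%:R).
  rewrite sumr_const card_ord -mulr_natl; ring.
rewrite EFinM; apply: lee_wpmul2l; first by rewrite lee_fin invr_ge0 ltW.
rewrite ge0_integral_sum//; last 2 first.
- by move=> l; exact: emeasurable_funD.
- by move=> l w _; rewrite adde_ge0// lee_fin sqr_ge0.
rewrite -sumEFin; apply: lee_sum => l _.
rewrite ge0_integralD//; last 2 first.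
- by move=> w _; rewrite lee_fin sqr_ge0.
- by move=> w _; rewrite lee_fin sqr_ge0.
rewrite EFinD; apply: leeD; first exact: moment2_form_defect.
have := moment2_norm_defect l; congr (_ <= _)%E.
by apply: eq_integral => w _; rewrite normc_real real_normK ?num_real.
Qed.

End ColumnForms.

(** * The self-consistent equation up to the defect *)

Section Moebius.
Context {R : realType}.
Local Notation C := R[i].
Implicit Types (t : R) (s q : C).

(** The contribution of the atom t to 1 + z s, by the rank one formula. *)
Definition moebius t s : C := t%:C * s / (1 + t%:C * s).

Lemma Im_le_denom t s : `|t| * `|Imz s| <= normc (1 + t%:C * s).
Proof.
apply: le_trans (abs_Im_le _).
by rewrite Im_add Im_mul /= mul0r addr0 add0r normrM.
Qed.

(** Multiplying 1 + t s by the conjugate of s makes the coefficient of t real, and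
    the imaginary part that remains is - Im s. *)
Lemma Im_le_denomM t s : `|Imz s| <= normc s * normc (1 + t%:C * s).
Proof.
rewrite -(normc_conj s) -normcM; apply: le_trans (abs_Im_le _).
rewrite mulrDr mulr1 mulrCA mulcJ Im_add cIm_conj Im_mul /= mulr0 mul0r !addr0.
by rewrite normrN.
Qed.

Lemma moebius_denom_neq0 t s : Imz s != 0 -> 1 + t%:C * s != 0.
Proof.
move=> s0; apply/eqP => d0; have := Im_le_denomM t s.
by rewrite d0 normc_real normr0 mulr0 normr_le0 (negbTE s0).
Qed.

Lemma normc_moebius_le t s : Imz s != 0 -> normc (moebius t s) <= normc s / `|Imz s|.
Proof.
move=> s0; have d0 := moebius_denom_neq0 t s0.
rewrite normcM normcV normcM normc_real ler_pdivrMr ?normc_gt0//.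
rewrite mulrAC ler_pdivlMr ?normr_gt0// mulrAC mulrC.
by rewrite ler_wpM2l ?normc_ge0// Im_le_denom.
Qed.

Lemma moebius_sub t s q : Imz s != 0 -> Imz q != 0 ->
  moebius t q - moebius t s
  = t%:C * (q - s) / ((1 + t%:C * q) * (1 + t%:C * s)).
Proof.
move=> s0 q0; have d0 := moebius_denom_neq0 t s0; have d1 := moebius_denom_neq0 t q0.
by rewrite /moebius; field; rewrite d0 d1.
Qed.

(** Lipschitz in s away from the real axis, uniformly in t: one factor of the
    denominator absorbs t. *)
Lemma moebius_lipschitz (e e' B : R) t s q : 0 < e -> 0 < e' ->
  e <= Imz s -> e' <= Imz q -> normc s <= B ->
  normc (moebius t q - moebius t s) <= B / (e * e') * normc (q - s).
Proof.
move=> e0 e'0 es eq sB.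
have s0 : 0 < Imz s by apply: lt_le_trans es.
have q0 : 0 < Imz q by apply: lt_le_trans eq.
have s0' : Imz s != 0 by rewrite gt_eqF.
have q0' : Imz q != 0 by rewrite gt_eqF.
rewrite moebius_sub// normcM normcV !normcM normc_real.
have D1 := Im_le_denom t q; have D2 := Im_le_denomM t s.
have d1 : 0 < normc (1 + t%:C * q) by rewrite normc_gt0 moebius_denom_neq0.
have d2 : 0 < normc (1 + t%:C * s) by rewrite normc_gt0 moebius_denom_neq0.
rewrite (gtr0_norm s0) in D2; rewrite (gtr0_norm q0) in D1.
rewrite mulrAC ler_wpM2r ?normc_ge0//.
rewrite ler_pdivrMr ?mulr_gt0//.
have h1 : `|t| * e' <= normc (1 + t%:C * q).
  by apply: le_trans D1; rewrite ler_wpM2l.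
have h2 : e <= B * normc (1 + t%:C * s).
  by apply: (le_trans es); apply: (le_trans D2); rewrite ler_wpM2r// ltW.
have -> : B / (e * e') * (normc (1 + t%:C * q) * normc (1 + t%:C * s))
    = (e * e')^-1 * (normc (1 + t%:C * q) * (B * normc (1 + t%:C * s))) by ring.
rewrite mulrC ler_pdivlMr ?mulr_gt0//.
have -> : `|t| * (e * e') = (`|t| * e') * e by ring.
by apply: ler_pM => //; [rewrite mulr_ge0// ltW|exact: ltW].
Qed.

Definition comparison_const (e B K : R) : R := B / (e * (e / 2)) + (K + B / e) * (2 / e) + K.

(** Either q is close to s and hence away from the real axis, or the distance
    |q - s| pays for the two values separately. *)
Lemma moebius_compare (e B K x : R) t s q : 0 < e -> 0 <= K -> 0 <= x ->
  e <= Imz s -> normc s <= B -> normc (moebius t q) <= K * (1 + x) ->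
  normc (moebius t q - moebius t s) <= comparison_const e B K * (normc (q - s) + x).
Proof.
move=> e0 K0 x0 es sB qK.
have B0 : 0 <= B by apply: le_trans sB; exact: normc_ge0.
have s0 : 0 < Imz s by apply: lt_le_trans es.
have sq0 := normc_ge0 (q - s).
have [near|far] := leP (normc (q - s)) (e / 2).
  have eq : e / 2 <= Imz q.
    have := le_trans (ler_norm _) (abs_Im_le (s - q)).
    rewrite Im_add Im_opp normcBC; lra.
  have e20 : 0 < e / 2 by rewrite divr_gt0.
  have := moebius_lipschitz t e0 e20 es eq sB.
  move=> /le_trans; apply; rewrite /comparison_const.
  have k1 : 0 <= B / (e * (e / 2)) by rewrite divr_ge0// mulr_ge0// ?divr_ge0// ltW.
  have k2 : 0 <= (K + B / e) * (2 / e).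
    by rewrite mulr_ge0 ?addr_ge0 ?divr_ge0// ltW.
  move: k1 k2; set k1 := _ / _; set k2 := _ * _; nra.
apply: le_trans (normcB _ _) _.
have sh : normc (moebius t s) <= B / e.
  apply: le_trans (normc_moebius_le _ _) _; first by rewrite gt_eqF.
  by rewrite (gtr0_norm s0) ler_pM ?normc_ge0 ?invr_ge0 ?(ltW s0)// lef_pV2.
have far' : 1 <= 2 / e * normc (q - s).
  by rewrite mulrAC ler_pdivlMr// mul1r; lra.
have k1 : 0 <= B / (e * (e / 2)) by rewrite divr_ge0// mulr_ge0// ?divr_ge0// ltW.
have k3 : 0 <= K + B / e by rewrite addr_ge0// divr_ge0// ltW.
have k2 : 0 <= 2 / e by rewrite divr_ge0// ltW.
rewrite /comparison_const; move: qK sh far' k1 k2 k3 sq0.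
set k1 := _ / (e * _); set k2 := 2 / e; set Be := B / e; set y := normc (q - s).
move=> qK sh far' k1_0 k2_0 k3_0 y0.
have : (K + Be) * 1 <= (K + Be) * (k2 * y) by rewrite ler_wpM2l.
have := mulr_ge0 (mulr_ge0 k3_0 k2_0) x0; have := mulr_ge0 k1_0 y0.
have := mulr_ge0 k1_0 x0; have := mulr_ge0 K0 y0; have := mulr_ge0 K0 x0.
nra.
Qed.

End Moebius.

Section SelfConsistent.
Context {R : realType} {m n : nat}.
Local Notation C := R[i].
Variables (A : 'M[C]_(n, m)) (z : C) (t tau : 'I_m -> R) (L : R).
Hypothesis z0 : 0 < Imz z.
Hypothesis n0 : (0 < n)%N.
Hypothesis L0 : 0 <= L.
Hypothesis tauL : forall l, `|tau l| <= L.
Hypothesis tau_t : forall l, tau l != t l -> tau l = 0.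

Let nR0 : 0 < n%:R :> R. Proof. by rewrite ltr0n. Qed.
Let nV0 : 0 <= n%:R^-1 :> R. Proof. by rewrite invr_ge0 ltW. Qed.
Let eta := Imz z.
Local Notation s := (ntrace A z t).
Local Notation s' := (ntrace A z tau).
Local Notation q l := (column_form A z (remove tau l) l).

Let D l : C := q l - ntrace A z (remove tau l).
Let x l : R := sqnorm (col l A) / n%:R - 1.
Definition total_defect : R := n%:R^-1 * \sum_l (normc (D l) ^+ 2 + x l ^+ 2).
Definition removed : R := n%:R^-1 * \sum_l (tau l != t l)%:R.
Local Notation V := total_defect.
Local Notation ratio := (m%:R / n%:R : R).

Let meanD (c : R) (F : 'I_m -> R) :
  n%:R^-1 * \sum_l (c + F l) = c * ratio + n%:R^-1 * \sum_l F l.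
Proof.
by rewrite big_split /= sumr_const card_ord -mulr_natl; ring.
Qed.

Let normc_mean (F : 'I_m -> C) (b : 'I_m -> R) : (forall l, normc (F l) <= b l) ->
  normc (n%:R^-1 * \sum_l F l) <= n%:R^-1 * \sum_l b l.
Proof.
move=> Fb; rewrite normcM normcV -(rmorph_nat (real_complex R)) normc_real normr_nat.
by rewrite ler_wpM2l//; apply: le_trans (normc_sum _ _ _) _; apply: ler_sum.
Qed.

Lemma removed_ge0 : 0 <= removed.
Proof. by apply: mulr_ge0 => //; apply: sumr_ge0. Qed.

Lemma ntrace_removed : normc (s - s') <= removed / eta.
Proof.
apply: le_trans (ntrace_restrict A z0 n0 tau_t) _.
by rewrite /removed invfM mulrA [_ * n%:R^-1]mulrC.
Qed.

Let column_bound l : normc ((tau l)%:C * column_form A z tau l) <= L / eta * (1 + `|x l|).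
Proof.
rewrite normcM normc_real -mulrA; apply: ler_pM => //; first exact: normc_ge0.
apply: le_trans (normc_column_form_le A z0 n0 tau l) _.
rewrite mulrC ler_pM2l ?invr_gt0// /x.
have := ler_norm (sqnorm (col l A) / n%:R - 1); lra.
Qed.

(** The right hand side is small high up on the imaginary axis, where no lower
    bound on Im s is known yet; this is what makes the spectra tight. *)
Lemma ntrace_rough :
  normc (1 + z * s) <= L / eta * (2 * ratio + V) + normc z * (removed / eta).
Proof.
have -> : 1 + z * s = (1 + z * s') + z * (s - s') by ring.
apply: le_trans (normcD _ _) _; apply: lerD; last first.
  by rewrite normcM ler_wpM2l ?normc_ge0// ntrace_removed.
rewrite (ntrace_column_form A z0 n0).
apply: le_trans (normc_mean column_bound) _.
rewrite -mulr_sumr mulrCA; apply: ler_wpM2l; first by rewrite divr_ge0// ltW.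
have -> : 2 * ratio + V
    = n%:R^-1 * \sum_l (2 + (normc (D l) ^+ 2 + x l ^+ 2)).
  by rewrite meanD.
apply: ler_wpM2l => //.
apply: ler_sum => l _; have := sqr_ge0 (normc (D l)).
rewrite -(real_normK (num_real (x l))).
have := sqr_ge0 (`|x l| - 1); nra.
Qed.

Let moebius_column l :
  (tau l)%:C * column_form A z tau l = moebius (tau l) (q l).
Proof. by have [_] := column_form_remove A z0 tau l. Qed.

(** The four errors come from replacing the weights t by tau in the normalized
    trace, the column forms by the normalized trace s' of tau, then s' by s and
    finally tau by t in the sum. Only the second one depends on the bound L of
    the weights tau, and it is the one that carries the factors that vanish with
    the defect and with 1/n; kappa balances the defect against its square root. *)
Lemma ntrace_self_consistent (delta kappa : R) : 0 < delta -> 0 < kappa ->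
  delta <= Imz s -> removed / eta <= delta / 2 ->
  normc (1 + z * s - n%:R^-1 * \sum_l moebius (t l) s)
  <= normc z * (removed / eta)
     + comparison_const (delta / 2) eta^-1 (L / eta)
       * (2 * kappa * ratio + V / kappa + ratio / (n%:R * eta))
     + ratio * (eta^-1 / (delta * (delta / 2)) * (removed / eta))
     + removed * (eta^-1 / delta).
Proof.
move=> d0 k0 ds small.
have ss' := ntrace_removed.
have d20 : 0 < delta / 2 by rewrite divr_gt0.
have ds' : delta / 2 <= Imz s'.
  have := le_trans (ler_norm _) (abs_Im_le (s - s')).
  by rewrite Im_add Im_opp; move: ds small ss'; lra.
have sB : normc s <= eta^-1 := normc_ntrace_le A z0 n0 t.
have sB' : normc s' <= eta^-1 := normc_ntrace_le A z0 n0 tau.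
have Im_s : Imz s != 0 by rewrite gt_eqF// (lt_le_trans d0).
have Ck0 : 0 <= comparison_const (delta / 2) eta^-1 (L / eta).
  have e0 : 0 <= eta^-1 by rewrite invr_ge0 ltW.
  by rewrite /comparison_const !addr_ge0 ?mulr_ge0 ?addr_ge0 ?mulr_ge0 ?invr_ge0 ?mulr_ge0// ?divr_ge0 ?invr_ge0// ltW.
have -> : 1 + z * s - n%:R^-1 * \sum_l moebius (t l) s
  = z * (s - s')
    + n%:R^-1 * \sum_l (moebius (tau l) (q l) - moebius (tau l) s')
    + n%:R^-1 * \sum_l (moebius (tau l) s' - moebius (tau l) s)
    + n%:R^-1 * \sum_l (moebius (tau l) s - moebius (t l) s).
  have := ntrace_column_form A z0 n0 tau; under eq_bigr do rewrite moebius_column.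
  rewrite !sumrB !mulrBr => <-; ring.
apply: le_trans (normcD _ _) _; apply: lerD.
apply: le_trans (normcD _ _) _; apply: lerD.
apply: le_trans (normcD _ _) _; apply: lerD.
- by rewrite normcM ler_wpM2l ?normc_ge0.
- apply: le_trans (normc_mean (b := fun l =>
    comparison_const (delta / 2) eta^-1 (L / eta) *
    (normc (q l - s') + `|x l|)) _) _.
    move=> l; apply: moebius_compare => //; first by rewrite divr_ge0// ltW.
    by rewrite -moebius_column.
  rewrite -mulr_sumr mulrCA; apply: ler_wpM2l => //.
  have -> : 2 * kappa * ratio + V / kappa + ratio / (n%:R * eta)
     = n%:R^-1 * \sum_l ((2 * kappa + (n%:R * eta)^-1)
        + (normc (D l) ^+ 2 + x l ^+ 2) / kappa).
    by rewrite meanD -mulr_suml /total_defect; ring.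
  apply: ler_wpM2l => //; apply: ler_sum => l _.
  have young (y : R) : `|y| <= kappa + y ^+ 2 / kappa.
    rewrite -(real_normK (num_real y)).
    have -> : kappa + `|y| ^+ 2 / kappa = `|y| + ((`|y| - kappa) ^+ 2 + kappa * `|y|) / kappa.
      by field; rewrite gt_eqF.
    rewrite lerDl; apply: divr_ge0; last exact: ltW.
    by apply: addr_ge0; [exact: sqr_ge0|apply: mulr_ge0 => //; exact: ltW].
  have h1 : normc (q l - s') <= normc (D l) + (n%:R * eta)^-1.
    have -> : q l - s' = D l - (s' - ntrace A z (remove tau l)).
      by rewrite /D opprB addrA subrK.
    apply: le_trans (normcB _ _) _; rewrite lerD2l.
    exact: ntrace_remove.
  have h2 := young (x l).
  have := young (normc (D l)); rewrite (ger0_norm (normc_ge0 _)) => h3.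
  by rewrite mulrDl; lra.
- have e0 : 0 <= eta^-1 by rewrite invr_ge0 ltW.
  have k1 : 0 <= eta^-1 / (delta * (delta / 2)).
    by apply: divr_ge0 => //; apply: mulr_ge0; exact: ltW.
  apply: le_trans (normc_mean (b := fun l =>
    eta^-1 / (delta * (delta / 2)) * (removed / eta)) _) _.
    move=> l; apply: le_trans (moebius_lipschitz _ d0 d20 ds ds' sB) _.
    by rewrite normcBC; apply: ler_wpM2l.
  by rewrite sumr_const card_ord -[_ *+ m]mulr_natl [leLHS]mulrA [n%:R^-1 * m%:R]mulrC.
- have Im_s0 : 0 < Imz s by exact: lt_le_trans d0 ds.
  have -> : removed * (eta^-1 / delta)
      = n%:R^-1 * \sum_l ((tau l != t l)%:R * (eta^-1 / delta)).
    by rewrite /removed -mulrA mulr_suml.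
  apply: normc_mean => l.
  have [->|e] := eqVneq (tau l) (t l).
    by rewrite subrr normc_real normr0 mul0r.
  rewrite (tau_t e) /moebius mul0r mul0r sub0r normc_opp mul1r.
  apply: le_trans (normc_moebius_le _ Im_s) _.
  rewrite gtr0_norm//; apply: ler_pM => //; first exact: normc_ge0.
    by rewrite invr_ge0 ltW.
  by rewrite lef_pV2.
Qed.

End SelfConsistent.

(** * Weak limits along ultrafilters *)

Section UnitMass.
Context {R : realType}.
Local Notation borelR := (measurableTypeR R).
Implicit Types (f g phi : R -> R).

Definition bounded_measurable f :=
  measurable_fun (setT : set borelR) (f : borelR -> R) /\ exists B, forall x, `|f x| <= B.

Lemma bounded_measurable_cst (a : R) : bounded_measurable (fun=> a).
Proof. by split; [exact: measurable_cst|exists `|a|]. Qed.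

Lemma bounded_measurableD f g : bounded_measurable f -> bounded_measurable g ->
  bounded_measurable (fun x => f x + g x).
Proof.
move=> [mf [B fB]] [mg [B' gB]]; split; first exact: measurable_funD.
by exists (B + B') => x; apply: le_trans (ler_normD _ _) _; exact: lerD.
Qed.

Lemma bounded_measurableM f g : bounded_measurable f -> bounded_measurable g ->
  bounded_measurable (fun x => f x * g x).
Proof.
move=> [mf [B fB]] [mg [B' gB]]; split; first exact: measurable_funM.
by exists (B * B') => x; rewrite normrM ler_pM.
Qed.

Lemma bounded_measurableZ (a : R) f : bounded_measurable f ->
  bounded_measurable (fun x => a * f x).
Proof. by move=> mf; apply: bounded_measurableM => //; exact: bounded_measurable_cst. Qed.

Lemma bounded_measurableB f g : bounded_measurable f -> bounded_measurable g ->
  bounded_measurable (fun x => f x - g x).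
Proof.
move=> mf mg; apply: (bounded_measurableD mf).
by under eq_fun do rewrite -mulN1r; exact: bounded_measurableZ.
Qed.

Lemma continuous_bounded_measurable f (B : R) : continuous f -> (forall x, `|f x| <= B) ->
  bounded_measurable f.
Proof. by move=> cf fB; split; [exact: continuous_measurable_fun|exists B]. Qed.

Lemma bounded_funP f : bounded_fun f -> exists B, forall x, `|f x| <= B.
Proof.
move=> [M [_ bM]]; exists (`|M| + 1) => x; apply: (bM (`|M| + 1)) => //.
by apply: (le_lt_trans (ler_norm M)); rewrite ltrDl.
Qed.

Variable nu : {measure set borelR -> \bar R}.
Hypothesis nu1 : nu setT = 1%E.

Lemma bounded_integrable f (D : set borelR) : measurable D -> bounded_measurable f ->
  nu.-integrable D (EFin \o f).
Proof.
move=> mD [mf [B fB]]; apply: (@integrableS _ _ _ nu setT) => //.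
apply: measurable_bounded_integrable => //; first by rewrite nu1 ltry.
by exists B; split; [exact: num_real|move=> b /ltW Bb x _; exact: le_trans (fB x) Bb].
Qed.

Lemma integral_cst1 (r : R) : \int[nu]_x r = r.
Proof. by rewrite Rintegral_cst// nu1 mulr1. Qed.

Lemma integralD1 f g : bounded_measurable f -> bounded_measurable g ->
  \int[nu]_x (f x + g x) = \int[nu]_x f x + \int[nu]_x g x.
Proof. by move=> mf mg; apply: RintegralD => //; exact: bounded_integrable. Qed.

Lemma integralB1 f g : bounded_measurable f -> bounded_measurable g ->
  \int[nu]_x (f x - g x) = \int[nu]_x f x - \int[nu]_x g x.
Proof. by move=> mf mg; apply: RintegralB => //; exact: bounded_integrable. Qed.

Lemma integralZ1 (a : R) f : bounded_measurable f ->
  \int[nu]_x (a * f x) = a * \int[nu]_x f x.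
Proof. by move=> mf; apply: RintegralZl => //; exact: bounded_integrable. Qed.

Lemma le_integral1 f g : bounded_measurable f -> bounded_measurable g ->
  (forall x, f x <= g x) -> \int[nu]_x f x <= \int[nu]_x g x.
Proof. by move=> mf mg fg; apply: le_Rintegral => //; exact: bounded_integrable. Qed.

Lemma normr_integral1 f (b : R) : bounded_measurable f -> (forall x, `|f x| <= b) ->
  `|\int[nu]_x f x| <= b.
Proof.
move=> mf fb; rewrite ler_norml; apply/andP; split.
  rewrite -(integral_cst1 (- b)); apply: le_integral1 => //.
    exact: bounded_measurable_cst.
  by move=> x; have := fb x; rewrite ler_norml => /andP[].
rewrite -[leRHS]integral_cst1; apply: le_integral1 => //.
  exact: bounded_measurable_cst.
by move=> x; apply: le_trans (ler_norm _) _.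
Qed.

Lemma normr_integral1_on f (b : R) (D : set borelR) : measurable D ->
  bounded_measurable f -> (forall x, D x -> `|f x| <= b) ->
  `|\int[nu]_(x in D) f x| <= b * fine (nu D).
Proof.
move=> mD mf fb; have fint := bounded_integrable mD mf.
have bint (a : R) : nu.-integrable D (EFin \o (fun=> a)).
  by apply: bounded_integrable => //; exact: bounded_measurable_cst.
rewrite ler_norml -mulNr -!Rintegral_cst//; apply/andP; split; apply: le_Rintegral => //.
  by move=> x /fb; rewrite ler_norml => /andP[].
by move=> x /fb; apply: le_trans; exact: ler_norm.
Qed.

Definition dist_fun (x : R) : R := fine (nu `]-oo, x]%classic).

Let nu_fin (D : set borelR) : measurable D -> (nu D \is a fin_num).
Proof.
move=> mD; rewrite ge0_fin_numE//; apply: (@le_lt_trans _ _ (nu setT)).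
  by apply: le_measure; rewrite ?inE.
by rewrite nu1 ltry.
Qed.

Lemma dist_fun_nd : {homo dist_fun : x y / x <= y}.
Proof.
move=> x y xy; apply: fine_le; rewrite ?nu_fin//.
by apply: le_measure; rewrite ?inE//; exact: subset_itvl.
Qed.

Lemma dist_fun_ge0 x : 0 <= dist_fun x. Proof. exact: fine_ge0. Qed.

Lemma dist_fun_le1 x : dist_fun x <= 1.
Proof.
rewrite -lee_fin fineK ?nu_fin//; apply: (@le_trans _ _ (nu setT)); last by rewrite nu1.
by apply: le_measure; rewrite ?inE.
Qed.

Lemma measure_oc x y : x <= y -> fine (nu `]x, y]%classic) = dist_fun y - dist_fun x.
Proof.
move=> xy; have -> : `]x, y]%classic = `]-oo, y]%classic `\` `]-oo, x]%classic.
  by rewrite -[RHS]setCK setCD setCitvl setUC -[LHS]setCK setCitv.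
rewrite measureD//; last by rewrite ltey_eq nu_fin.
rewrite setIidr; last exact: subset_itvl.
by rewrite fineB ?nu_fin.
Qed.

Lemma measure_compl (D : set borelR) : measurable D -> fine (nu (~` D)) = 1 - fine (nu D).
Proof.
move=> mD; have : nu setT = (nu D + nu (~` D))%E.
  by rewrite -measureU ?setUCr ?setICr//; exact: measurableC.
rewrite nu1 => /(congr1 fine); rewrite fineD ?nu_fin//; last exact: measurableC.
by move=> /= ->; rewrite addrC addrA addNr add0r.
Qed.

(** On each cell phi is within e of its value at the right end, and the mass of
    the cell is the increment of the distribution function. *)
Lemma riemann_sum phi (x : nat -> R) (e : R) K : bounded_measurable phi ->
  {homo x : i j / (i <= j)%N >-> i <= j} ->
  (forall i, (i < K)%N -> forall y, x i < y <= x i.+1 -> `|phi y - phi (x i.+1)| <= e) ->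
  `|\int[nu]_(y in `]x 0%N, x K]%classic) phi y
    - \sum_(i < K) phi (x i.+1) * (dist_fun (x i.+1) - dist_fun (x i))|
  <= e * (dist_fun (x K) - dist_fun (x 0%N)).
Proof.
move=> mphi ndx; elim: K => [|K IH] osc.
  by rewrite big_ord0 set_itvoc0 Rintegral_set0 !subrr normr0 mulr0.
have xK : x K <= x K.+1 by exact: ndx.
have x0K : x 0%N <= x K by exact: ndx.
have -> : `]x 0%N, x K.+1]%classic = `]x 0%N, x K]%classic `|` `]x K, x K.+1]%classic.
  by rewrite -itv_bndbnd_setU// bnd_simp.
rewrite Rintegral_setU//; last 2 first.
- by apply: bounded_integrable => //; exact: measurableU.
- rewrite disj_set2E; apply/eqP; rewrite -subset0 => y [] /=.
  by rewrite !in_itv /= => /andP[_ yK] /andP[Ky _]; have := lt_le_trans Ky yK; rewrite ltxx.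
rewrite big_ord_recr /= opprD addrACA.
apply: le_trans (ler_normD _ _) _.
have -> : e * (dist_fun (x K.+1) - dist_fun (x 0%N))
   = e * (dist_fun (x K) - dist_fun (x 0%N)) + e * (dist_fun (x K.+1) - dist_fun (x K)) by ring.
apply: lerD; first by apply: IH => i iK; apply: osc; exact: ltnW.
rewrite -measure_oc// -[phi (x K.+1) * _]Rintegral_cst//.
have mc := bounded_measurable_cst (phi (x K.+1)).
rewrite -RintegralB//; [|exact: bounded_integrable..].
apply: normr_integral1_on => //; first exact: bounded_measurableB.
by move=> y /=; rewrite in_itv /=; exact: osc.
Qed.

Lemma riemann_sum_full phi (x : nat -> R) (e B : R) K : bounded_measurable phi ->
  (forall y, `|phi y| <= B) -> 0 <= e ->
  {homo x : i j / (i <= j)%N >-> i <= j} ->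
  (forall i, (i < K)%N -> forall y, x i < y <= x i.+1 -> `|phi y - phi (x i.+1)| <= e) ->
  `|\int[nu]_y phi y
    - \sum_(i < K) phi (x i.+1) * (dist_fun (x i.+1) - dist_fun (x i))|
  <= e + B * (1 - (dist_fun (x K) - dist_fun (x 0%N))).
Proof.
move=> mphi phiB e0 ndx osc; have := riemann_sum mphi ndx osc.
set S := \sum_(i < K) _; have x0K : x 0%N <= x K by exact: ndx.
rewrite -measure_oc//; set D : set borelR := `]x 0%N, x K]%classic.
have mD : measurable D by exact: measurable_itv.
have mDC : measurable (~` D) by exact: measurableC.
rewrite -measure_compl//.
have -> : \int[nu]_y phi y = \int[nu]_(y in D) phi y + \int[nu]_(y in ~` D) phi y.
  rewrite -Rintegral_setU// ?setUCr//; first exact: bounded_integrable.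
  by rewrite disj_set2E setICr.
move=> h1; have h2 := @normr_integral1_on phi B _ mDC mphi (fun y _ => phiB y).
rewrite addrAC; apply: le_trans (ler_normD _ _) _; apply: lerD => //.
apply: (le_trans h1); rewrite ler_piMr//.
rewrite -lee_fin fineK ?nu_fin// -nu1.
by apply: le_measure; rewrite ?inE.
Qed.

End UnitMass.

Lemma limit_le {R : realType} {I : Type} (U : set_system I) {UU : ProperFilter U}
    (f g : I -> R) (a b : R) : f i @[i --> U] --> a ->
  g i @[i --> U] --> b -> (\forall i \near U, f i <= g i) -> a <= b.
Proof.
move=> fa gb; under eq_near do rewrite -subr_ge0; rewrite -subr_ge0.
by apply: cvgr_to_ge; exact: cvgB.
Qed.

Section UltraLimits.
Context {R : realType} {I : Type} (U : set_system I) {UU : UltraFilter U}.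

(** The image of an ultrafilter converges in the compact interval [-B, B]. *)
Lemma ultra_cvg_bounded (f : I -> R) (B : R) : (\forall i \near U, `|f i| <= B) ->
  cvg (f i @[i --> U]).
Proof.
move=> fB; have UP : ProperFilter U := @ultra_proper _ _ UU.
have FP : ProperFilter (f i @[i --> U]) by exact: fmap_proper_filter.
have [G [GU sUG]] := ultraFilterLemma FP.
have := @segment_compact R (- B) B; rewrite compact_ultra => /(_ G GU).
have GB : G `[- B, B]%classic.
  by apply: sUG; apply: filterS fB => i; rewrite ler_norml /= in_itv.
move=> /(_ GB) [p [_ Gp]]; apply/cvg_ex; exists p => V Vp.
have [//|UVC] := in_ultra_setVsetC (f @^-1` V) UU.
have GVC : G (~` V) by exact: sUG.
have : G set0 by rewrite -(setICr V); apply: filterI => //; exact: Gp.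
by move=> /filter_not_empty.
Qed.

End UltraLimits.

Section GridSums.
Context {R : realType}.

(** Summation by parts: moving the increments of F to those of G costs the two
    boundary terms and the oscillation of p against the jumps G - F, which the
    interlacing F i <= G i <= F i.+1 makes summable. *)
Lemma abel_bound (p F G : nat -> R) (e B : R) K : 0 <= e ->
  (forall i, `|p i| <= B) -> (forall i, F i <= G i) ->
  (forall i, (i < K)%N -> G i <= F i.+1) ->
  (forall i, (i < K)%N -> `|p i - p i.+1| <= e) ->
  `|\sum_(i < K) p i.+1 * (G i.+1 - G i) - \sum_(i < K) p i.+1 * (F i.+1 - F i)|
  <= B * (G K - F K) + B * (G 0%N - F 0%N) + e * (F K - F 0%N).
Proof.
move=> e0 pB FG GF pe.
have -> : \sum_(i < K) p i.+1 * (G i.+1 - G i) - \sum_(i < K) p i.+1 * (F i.+1 - F i)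
  = p K * (G K - F K) - p 0%N * (G 0%N - F 0%N) + \sum_(i < K) (p i - p i.+1) * (G i - F i).
  elim: K {GF pe} => [|K IH]; first by rewrite !big_ord0 !subrr addr0.
  rewrite !big_ord_recr /= opprD addrACA IH; ring.
have -> : e * (F K - F 0%N) = \sum_(i < K) e * (F i.+1 - F i).
  elim: K {GF pe} => [|K IH]; first by rewrite !big_ord0 subrr mulr0.
  rewrite !big_ord_recr /= -IH; ring.
apply: le_trans (ler_normD _ _) _; apply: lerD.
  apply: le_trans (ler_normB _ _) _; rewrite !normrM.
  by apply: lerD; apply: ler_pM => //; rewrite ger0_norm// subr_ge0.
apply: le_trans (ler_norm_sum _ _ _) _; apply: ler_sum => i _.
have iK := ltn_ord i; have := FG i; have := GF i iK => GFi FGi.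
by rewrite normrM; apply: ler_pM => //; [exact: pe|rewrite ger0_norm; lra].
Qed.

(** Uniform continuity on a compact interval, by its near-covering property. *)
Lemma uniform_grid (phi : R -> R) (a w e : R) : continuous phi -> 0 < w -> 0 < e ->
  exists K : nat, forall x y : R, a <= x <= a + w -> `|y - x| <= w / K.+1%:R ->
    `|phi y - phi x| <= e.
Proof.
move=> cphi w0 e0; have := @segment_compact R a (a + w).
rewrite compact_near_coveringP => /(_ nat \oo (fun (K : nat) (x : R) => forall y,
  `|y - x| <= w / K.+1%:R -> `|phi y - phi x| <= e) _) cover.
have [|K _ KP] := cover; last first.
  exists K => x y xa yx; apply: (KP K) => //=.
move=> x _; have e20 : 0 < e / 2 by rewrite divr_gt0.
have /cvgrPdist_le /(_ _ e20) := cphi x.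
move=> /nbhs_ballP [r /= r0 rP].
have r20 : 0 < r / 2 by rewrite divr_gt0.
exists (ball x (r / 2), [set K | w / K.+1%:R < r / 2]) => /=.
  split; first exact: nbhsx_ballx.
  have : w * K.+1%:R^-1 @[K --> \oo] --> w * 0.
    by apply: cvgMr; exact: cvg_harmonic.
  rewrite mulr0 => /cvgrPdist_lt /(_ _ r20); apply: filterS => K /=.
  rewrite sub0r normrN; apply: le_lt_trans; exact: ler_norm.
move=> [x' K] /= [xx' wK] y yx'.
have h1 : `|phi x - phi x'| <= e / 2.
  by apply: rP; apply: lt_le_trans xx' _; rewrite ler_pdivrMr//; lra.
have h2 : `|phi x - phi y| <= e / 2.
  apply: rP; rewrite /ball /=; have -> : x - y = (x - x') - (y - x') by ring.
  apply: le_lt_trans (ler_normB _ _) _; move: xx' wK yx'; rewrite /ball /=.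
  by move: (w / _) => wk; lra.
have -> : phi y - phi x' = (phi x - phi x') - (phi x - phi y) by ring.
by apply: le_trans (ler_normB _ _) _; lra.
Qed.

End GridSums.

Section Helly.
Context {R : realType} {I : Type} (U : set_system I) {UU : UltraFilter U}.
Local Notation borelR := (measurableTypeR R).
Let UP : ProperFilter U := @ultra_proper _ _ UU.
Variable nu : I -> {measure set borelR -> \bar R}.
Hypothesis nu1 : \forall i \near U, nu i setT = 1%E.
Hypothesis tight : forall e : R, 0 < e -> exists2 L : R, 0 < L &
  \forall i \near U, 1 - (dist_fun (nu i) L - dist_fun (nu i) (- L)) <= e.

Let F (x : R) : R := lim (dist_fun (nu i) x @[i --> U]).

Let F_cvg x : dist_fun (nu i) x @[i --> U] --> F x.
Proof.
apply: (@ultra_cvg_bounded _ _ U UU _ 1); apply: filterS nu1 => i i1.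
by rewrite ger0_norm ?dist_fun_ge0 ?dist_fun_le1.
Qed.

Let F_ge0 x : 0 <= F x.
Proof.
apply: (cvgr_to_ge (@F_cvg x)); by apply: nearW => i; exact: dist_fun_ge0.
Qed.

Let F_le1 x : F x <= 1.
Proof.
apply: (cvgr_to_le (@F_cvg x)); by apply: filterS nu1 => i i1; exact: dist_fun_le1.
Qed.

Let F_nd x y : x <= y -> F x <= F y.
Proof.
move=> xy; apply: (limit_le (@F_cvg x) (@F_cvg y)).
by apply: filterS nu1 => i i1; exact: dist_fun_nd.
Qed.

Let F_tight e : 0 < e -> exists2 L : R, 0 < L & 1 - (F L - F (- L)) <= e.
Proof.
move=> e0; have [L L0 LP] := tight e0; exists L => //.
by apply: (cvgr_to_le _ LP); apply: cvgB; [exact: cvg_cst|apply: cvgB].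
Qed.

(* the right-continuous regularization of F; F x <= G x <= F y for x < y *)
Let G (x : R) : R := inf [set F y | y in [set y | x < y]].

Let G_has x : has_inf [set F y | y in [set y | x < y]].
Proof.
split; first by exists (F (x + 1)), (x + 1) => //=; rewrite ltrDl.
by exists 0 => z [y _ <-]; exact: F_ge0.
Qed.

Let G_le x y : x < y -> G x <= F y.
Proof. by move=> xy; apply: ge_inf; [have [] := G_has x|exists y]. Qed.

Let F_le_G x : F x <= G x.
Proof.
apply: lb_le_inf; first by have [] := G_has x.
by move=> _ [y xy <-]; apply: F_nd; exact: ltW.
Qed.

Let G_nd : nondecreasing G.
Proof.
move=> x y xy; have [->//|nxy] := eqVneq x y.
by apply: le_trans (F_le_G y); apply: G_le; rewrite lt_neqAle nxy.
Qed.

Let G_rc : right_continuous G.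
Proof.
move=> x; apply/cvgrPdist_le => e e0.
have [_ [y xy <-] yP] := inf_adherent e0 (G_has x).
near=> z; have xz : x < z by near: z; exact: nbhs_right_gt.
have zy : z < y by near: z; exact: nbhs_right_lt.
rewrite distrC ger0_norm ?subr_ge0; last by apply: G_nd; exact: ltW.
by rewrite lerBlDl; apply: le_trans (G_le zy) _; exact: ltW.
Unshelve. all: by end_near. Qed.

Let G_Ny : G @ -oo --> (0 : R).
Proof.
apply/cvgrPdist_le => e e0; have [L L0 LP] := F_tight e0.
near=> x; have xL : x < - L by near: x; apply: nbhs_ninfty_lt; exact: num_real.
rewrite sub0r normrN ger0_norm; last by apply: le_trans (F_le_G _); exact: F_ge0.
by apply: le_trans (G_le xL) _; have := F_le1 L; lra.
Unshelve. all: by end_near. Qed.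

Let G_y : G @ +oo --> (1 : R).
Proof.
apply/cvgrPdist_le => e e0; have [L L0 LP] := F_tight e0.
near=> x; have xL : L <= x by near: x; apply: nbhs_pinfty_ge; exact: num_real.
have : G x <= F (x + 1) by apply: G_le; rewrite ltrDl.
have := F_le1 (x + 1); have := le_trans (F_nd xL) (F_le_G x).
have := F_ge0 (- L) => h1 h2 h3 h4; rewrite ger0_norm; lra.
Unshelve. all: by end_near. Qed.

Let Gc : cumulativeBounded (0 : R) (1 : R) :=
  HB.pack_for (cumulativeBounded (0 : R) (1 : R)) G
    (isCumulative.Build R _ R G G_nd G_rc)
    (isCumulativeBounded.Build R 0 1 G G_Ny G_y).

Let mu : probability borelR R := lebesgue_stieltjes_measure Gc.

Let mu1 : mu setT = 1%E. Proof. exact: probability_setT. Qed.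

Let dist_mu x : dist_fun mu x = G x.
Proof. by have /(congr1 fine) /= := cdf_lebesgue_stieltjes_id Gc x. Qed.

(** Helly's selection theorem together with the Helly-Bray theorem. Along an
    ultrafilter all distribution functions converge to some F, whose regularization
    G is the distribution function of mu. The integrals are compared with Riemann
    sums over one fine grid; F and G may differ at the grid points, but the jumps
    G - F are summed by [abel_bound]. *)
Lemma helly : exists mu : probability borelR R, forall phi : R -> R,
  continuous phi -> bounded_fun phi ->
  \int[nu i]_x phi x @[i --> U] --> \int[mu]_x phi x.
Proof.
exists mu => phi cphi /bounded_funP [B phiB].
have B0 : 0 <= B by apply: le_trans (phiB 0).
have mphi := continuous_bounded_measurable cphi phiB.
apply/cvgrPdist_le => e0 e0_gt0.
(* the four comparisons below cost e + B e, 2 B e + e, e and e + B e *)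
pose e := e0 / (4 * B + 4).
have d0 : 0 < 4 * B + 4 by lra.
have e_gt0 : 0 < e by rewrite divr_gt0.
have e_ge0 := ltW e_gt0.
have [L L0 tightL] := tight e_gt0.
have FL : 1 - (F L - F (- L)) <= e.
  by apply: (cvgr_to_le _ tightL); apply: cvgB; [exact: cvg_cst|apply: cvgB].
pose a := - (L + 1); pose w := 2 * (L + 1).
have w0 : 0 < w by rewrite /w; lra.
have [K0 gridK] := uniform_grid a cphi w0 e_gt0.
pose K := K0.+1; pose x i : R := a + i%:R * (w / K%:R).
have step0 : 0 < w / K%:R by rewrite divr_gt0.
have x_nd : {homo x : i j / (i <= j)%N >-> i <= j}.
  by move=> i j ij; rewrite lerD2l ler_pM2r// ler_nat.
have xS i : x i.+1 = x i + w / K%:R.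
  by rewrite /x -natr1; ring.
have xK : x K = L + 1 by rewrite /x mulrC mulfVK ?pnatr_eq0// /a /w; ring.
have x0 : x 0%N = - (L + 1) by rewrite /x mul0r addr0.
have osc i : (i < K)%N -> forall y, x i <= y <= x i.+1 -> `|phi y - phi (x i.+1)| <= e.
  move=> iK y /andP[xy yx]; apply: gridK; last first.
    by rewrite ler_norml xS in yx xy *; rewrite -/K; lra.
  have := x_nd 0%N i.+1 isT; have := x_nd i.+1 K iK.
  by rewrite xK x0 /a /w; lra.
have osc' i : (i < K)%N -> forall y, x i < y <= x i.+1 -> `|phi y - phi (x i.+1)| <= e.
  by move=> iK y /andP[xy yx]; apply: osc; rewrite ?(ltW xy).
pose S (D : R -> R) := \sum_(i < K) phi (x i.+1) * (D (x i.+1) - D (x i)).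
have Smu : `|\int[mu]_y phi y - S G| <= e + B * e.
  have := riemann_sum_full mu1 mphi phiB e_ge0 x_nd osc'.
  rewrite !dist_mu => h; have -> : S G = \sum_(i < K)
     phi (x i.+1) * (dist_fun mu (x i.+1) - dist_fun mu (x i)).
    by apply: eq_bigr => i _; rewrite !dist_mu.
  apply: (le_trans h); rewrite lerD2l ler_wpM2l// xK x0.
  have h1 : G (- (L + 1)) <= F (- L) by apply: G_le; lra.
  have h2 : F L <= G (L + 1) by apply: le_trans (F_le_G _); apply: F_nd; lra.
  by lra.
have SFG : `|S G - S F| <= B * e + B * e + e.
  have xlt i : x i < x i.+1 by rewrite xS ltrDl.
  apply: le_trans (@abel_bound _ (fun i => phi (x i)) (fun i => F (x i))
    (fun i => G (x i)) e B K e_ge0 (fun i => phiB _) (fun i => F_le_G _)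
    (fun i _ => G_le (xlt i)) _) _.
    by move=> i iK; apply: osc => //; rewrite lexx ltW.
  rewrite xK x0.
  have h1 : G (- (L + 1)) <= F (- L) by apply: G_le; lra.
  have h2 : F L <= F (L + 1) by apply: F_nd; lra.
  have h3 : G (L + 1) <= 1 by apply: le_trans (F_le1 (L + 2)); apply: G_le; lra.
  have h4 := F_ge0 (- (L + 1)); have h5 := F_ge0 (- L); have h6 := F_le1 (L + 1).
  have h7 := F_le1 L.
  apply: lerD; first by apply: lerD; rewrite ler_wpM2l//; lra.
  by rewrite ler_piMr//; lra.
have SF : S (dist_fun (nu i)) @[i --> U] --> S F.
  rewrite /S; apply: cvg_big; first exact: add_continuous.
  move=> j _.
  by apply: cvgMr; apply: cvgB; exact: F_cvg.
have /cvgrPdist_le /(_ _ e_gt0) SFe := SF.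
near=> i.
have i1 : nu i setT = 1%E by near: i.
have iF : `|S F - S (dist_fun (nu i))| <= e by near: i.
have iL : 1 - (dist_fun (nu i) L - dist_fun (nu i) (- L)) <= e by near: i.
have Snu : `|\int[nu i]_y phi y - S (dist_fun (nu i))| <= e + B * e.
  apply: le_trans (riemann_sum_full i1 mphi phiB e_ge0 x_nd osc') _.
  rewrite lerD2l ler_wpM2l// xK x0.
  have h1 : dist_fun (nu i) (- (L + 1)) <= dist_fun (nu i) (- L).
    by apply: dist_fun_nd => //; lra.
  have h2 : dist_fun (nu i) L <= dist_fun (nu i) (L + 1).
    by apply: dist_fun_nd => //; lra.
  by lra.
have e0E : e0 = 4 * e + 4 * (B * e).
  by rewrite /e; field; rewrite gt_eqF//; lra.
have -> : \int[mu]_y phi y - \int[nu i]_y phi y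
  = (\int[mu]_y phi y - S G) + (S G - S F) + (S F - S (dist_fun (nu i)))
    - (\int[nu i]_y phi y - S (dist_fun (nu i))) by ring.
apply: le_trans (ler_normB _ _) _.
have := ler_normD (\int[mu]_y phi y - S G + (S G - S F)) (S F - S (dist_fun (nu i))).
have := ler_normD (\int[mu]_y phi y - S G) (S G - S F).
by lra.
Unshelve. all: by end_near. Qed.

End Helly.

(** * Stieltjes transforms *)

Section ComplexIntegrals.
Context {R : realType}.
Local Notation borelR := (measurableTypeR R).
Local Notation C := R[i].
Implicit Types (g h : R -> C) (z : C).

Definition ccontinuous g := continuous (fun x => Rez (g x)) /\ continuous (fun x => Imz (g x)).

Definition cbounded g :=
  bounded_measurable (fun x => Rez (g x)) /\ bounded_measurable (fun x => Imz (g x)).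

Lemma ccontinuous_cst z : ccontinuous (fun=> z).
Proof. by split => x; exact: cvg_cst. Qed.

Lemma ccontinuous_real : ccontinuous (fun x => x%:C).
Proof. by split => x; [exact: cvg_id|exact: cvg_cst]. Qed.

Lemma ccontinuousD g h : ccontinuous g -> ccontinuous h -> ccontinuous (fun x => g x + h x).
Proof.
move=> [g1 g2] [h1 h2]; split => x.
  by under eq_fun do rewrite Re_add; apply: cvgD; [exact: g1|exact: h1].
by under eq_fun do rewrite Im_add; apply: cvgD; [exact: g2|exact: h2].
Qed.

Lemma ccontinuousM g h : ccontinuous g -> ccontinuous h -> ccontinuous (fun x => g x * h x).
Proof.
move=> [g1 g2] [h1 h2]; split => x.
  under eq_fun do rewrite Re_mul; apply: cvgB; apply: cvgM;
    by [exact: g1|exact: g2|exact: h1|exact: h2].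
under eq_fun do rewrite Im_mul; apply: cvgD; apply: cvgM;
  by [exact: g1|exact: g2|exact: h1|exact: h2].
Qed.

Lemma ccontinuousV g : ccontinuous g -> (forall x, g x != 0) -> ccontinuous (fun x => (g x)^-1).
Proof.
move=> [g1 g2] g0.
have n0 x : normc (g x) ^+ 2 != 0 by rewrite expf_neq0// normc_eq0.
have cn : continuous (fun x => normc (g x) ^+ 2).
  move=> x; under eq_fun do rewrite normc_sqrE !expr2.
  by apply: cvgD; apply: cvgM; by [exact: g1|exact: g2].
split => x.
  by under eq_fun do rewrite Re_inv; apply: cvgM; [exact: g1|apply: cvgV => //; exact: cn].
under eq_fun do rewrite Im_inv; apply: cvgM; [apply: cvgN; exact: g2|apply: cvgV => //; exact: cn].
Qed.

Lemma ccontinuous_cbounded g (b : R) : ccontinuous g -> (forall x, normc (g x) <= b) -> cbounded g.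
Proof.
move=> [g1 g2] gb; split; apply: (@continuous_bounded_measurable _ _ b) => // x.
  exact: le_trans (abs_Re_le _) _.
exact: le_trans (abs_Im_le _) _.
Qed.

Lemma cboundedD g h : cbounded g -> cbounded h -> cbounded (fun x => g x + h x).
Proof.
move=> [g1 g2] [h1 h2]; split.
  by under eq_fun do rewrite Re_add; exact: bounded_measurableD.
by under eq_fun do rewrite Im_add; exact: bounded_measurableD.
Qed.

Lemma cboundedM g h : cbounded g -> cbounded h -> cbounded (fun x => g x * h x).
Proof.
move=> [g1 g2] [h1 h2]; split.
  by under eq_fun do rewrite Re_mul; apply: bounded_measurableB; exact: bounded_measurableM.
by under eq_fun do rewrite Im_mul; apply: bounded_measurableD; exact: bounded_measurableM.
Qed.

Lemma cbounded_cst z : cbounded (fun=> z).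
Proof. by split; exact: bounded_measurable_cst. Qed.

Variable nu : {measure set borelR -> \bar R}.
Hypothesis nu1 : nu setT = 1%E.

Lemma complex_integralD g h : cbounded g -> cbounded h ->
  complex_integral nu (fun x => g x + h x) = complex_integral nu g + complex_integral nu h.
Proof.
move=> [g1 g2] [h1 h2]; apply: complexP => /=; rewrite ?Re_add ?Im_add /= -integralD1//.
  by under eq_fun do rewrite Re_add.
by under eq_fun do rewrite Im_add.
Qed.

Lemma complex_integralZ z g : cbounded g ->
  complex_integral nu (fun x => z * g x) = z * complex_integral nu g.
Proof.
move=> [g1 g2]; apply: complexP => /=; rewrite ?Re_mul ?Im_mul /= -?integralZ1//.
  rewrite -integralB1//; [|exact: bounded_measurableZ..].
  by under eq_fun do rewrite Re_mul.
rewrite -integralD1//; [|exact: bounded_measurableZ..].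
by under eq_fun do rewrite Im_mul.
Qed.

Lemma complex_integralB g h : cbounded g -> cbounded h ->
  complex_integral nu (fun x => g x - h x) = complex_integral nu g - complex_integral nu h.
Proof.
move=> mg mh; have mNh : cbounded (fun x => -1 * h x).
  by apply: cboundedM => //; exact: cbounded_cst.
under eq_fun do rewrite -mulN1r.
by rewrite complex_integralD// complex_integralZ// mulN1r.
Qed.

Lemma complex_integralJ g :
  bounded_measurable (fun x => Imz (g x)) ->
  complex_integral nu (fun x => (g x)^*%R) = (complex_integral nu g)^*%R.
Proof.
move=> mg; apply: complexP => /=; rewrite ?cRe_conj ?cIm_conj /=.
  by under eq_fun do rewrite cRe_conj.
under eq_fun do rewrite cIm_conj -mulN1r.
by rewrite integralZ1// mulN1r.
Qed.

(** Rotating the integral to the positive axis keeps the constant sharp. *)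
Lemma normc_complex_integral_le g (b : R -> R) : cbounded g -> bounded_measurable b ->
  (forall x, normc (g x) <= b x) -> normc (complex_integral nu g) <= \int[nu]_x b x.
Proof.
move=> gm mb gb; have [g1 g2] := gm; set q := complex_integral nu g.
have b0 : 0 <= \int[nu]_x b x.
  by apply: Rintegral_ge0 => x _; exact: le_trans (normc_ge0 _) (gb x).
have [q0|q0] := leP (normc q) 0; first exact: le_trans b0.
rewrite -(ler_pM2l q0) -expr2.
have -> : normc q ^+ 2 = Rez (complex_integral nu (fun x => q^*%R * g x)).
  by rewrite complex_integralZ// mulcJ.
rewrite -integralZ1//; apply: le_integral1 => //.
- by have [] := cboundedM (cbounded_cst q^*%R) gm.
- exact: bounded_measurableZ.
- move=> x; apply: le_trans (ler_norm _) (le_trans (abs_Re_le _) _).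
  by rewrite normcM normc_conj ler_pM2l.
Qed.

Lemma normc_complex_integral_le_cst g (b : R) : cbounded g ->
  (forall x, normc (g x) <= b) -> normc (complex_integral nu g) <= b.
Proof.
move=> gm gb; rewrite -[leRHS](integral_cst1 nu1).
by apply: normc_complex_integral_le => //; exact: bounded_measurable_cst.
Qed.

End ComplexIntegrals.

Section UnitMassIntegrals.
Context {R : realType}.
Local Notation borelR := (measurableTypeR R).
Variable nu : {measure set borelR -> \bar R}.
Hypothesis nu1 : nu setT = 1%E.

Lemma integral_gt0 (f : R -> R) : bounded_measurable f -> (forall x, 0 < f x) ->
  0 < \int[nu]_x f x.
Proof.
move=> mf f0; rewrite lt_neqAle Rintegral_ge0 => [|x _]; last exact: ltW.
rewrite andbT; apply/eqP => I0.
have fint := bounded_integrable nu1 measurableT mf.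
have [mf' _] := integrableP _ _ _ fint.
have := (ae_eq_integral_abs nu measurableT mf').1; case.
  have -> : (\int[nu]_x `|(EFin \o f) x| = \int[nu]_x (f x)%:E)%E.
    by apply: eq_integral => x _ /=; rewrite gtr0_norm.
  have h := integrable_fin_num measurableT fint.
  by rewrite -(fineK h) -[X in X%:E]I0.
move=> N [mN N0 subN]; have NT : N = setT.
  apply/seteqP; split => // x _; apply: subN => /= /(_ I) [fx].
  by have := f0 x; rewrite fx ltxx.
by have := oner_neq0 R; rewrite -eqe -nu1 -[X in nu X]NT N0 eqxx.
Qed.

Lemma integral_cvg (f_ : nat -> R -> R) (f : R -> R) (B : R) :
  (forall k, measurable_fun (setT : set borelR) (f_ k : borelR -> R)) ->
  (forall k x, `|f_ k x| <= B) -> (forall x, f_ k x @[k --> \oo] --> f x) ->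
  bounded_measurable f -> \int[nu]_x f_ k x @[k --> \oo] --> \int[nu]_x f x.
Proof.
move=> mf fB cf mf_lim.
have ae_cvg : {ae nu, forall x, setT x -> (f_ k x)%:E @[k --> \oo] --> (f x)%:E}.
  by apply: aeW => x _; apply: cvg_EFin; [exact: nearW|exact: cf].
have ae_le : {ae nu, forall x k, setT x -> (`|(f_ k x)%:E| <= B%:E)%E}.
  by apply: aeW => x k _; rewrite lee_fin.
have [_ _] := dominated_convergence measurableT
  (fun k => (measurable_EFinP _ _).2 (mf k)) ((measurable_EFinP _ _).2 mf_lim.1) ae_cvg
  (bounded_integrable nu1 measurableT (bounded_measurable_cst B)) ae_le.
have fint k : nu.-integrable setT (EFin \o f_ k).
  by apply: bounded_integrable => //; split => //; exists B.
have int := bounded_integrable nu1 measurableT mf_lim.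
move=> h; apply: fine_cvg; rewrite /Rintegral fineK//; exact: integrable_fin_num.
Qed.

End UnitMassIntegrals.

Section Stieltjes.
Context {R : realType}.
Local Notation borelR := (measurableTypeR R).
Local Notation C := R[i].
Implicit Types (x : R) (z : C).

Definition cauchy z x : C := (x%:C - z)^-1.

Lemma Im_real_sub x z : Imz (x%:C - z) = - Imz z.
Proof. by rewrite Im_add Im_opp /= add0r. Qed.

Lemma real_sub_neq0 x z : Imz z != 0 -> x%:C - z != 0.
Proof. by move=> z0; apply: Im_neq0; rewrite Im_real_sub oppr_eq0. Qed.

Lemma Im_le_real_sub x z : `|Imz z| <= normc (x%:C - z).
Proof. by apply: le_trans (abs_Im_le _); rewrite Im_real_sub normrN. Qed.

Lemma normc_cauchy_le x z : Imz z != 0 -> normc (cauchy z x) <= `|Imz z|^-1.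
Proof.
move=> z0; rewrite normcV lef_pV2 ?posrE ?normc_gt0 ?real_sub_neq0 ?normr_gt0//.
exact: Im_le_real_sub.
Qed.

Lemma ccontinuous_cauchy z : Imz z != 0 -> ccontinuous (cauchy z).
Proof.
move=> z0; apply: ccontinuousV => [|x]; last exact: real_sub_neq0.
by apply: ccontinuousD; [exact: ccontinuous_real|exact: ccontinuous_cst].
Qed.

Lemma cbounded_cauchy z : Imz z != 0 -> cbounded (cauchy z).
Proof.
move=> z0; apply: (ccontinuous_cbounded (ccontinuous_cauchy z0)) => x.
exact: normc_cauchy_le.
Qed.

Lemma Im_cauchy z x : Imz (cauchy z x) = Imz z / normc (x%:C - z) ^+ 2.
Proof. by rewrite Im_inv Im_real_sub opprK. Qed.

Lemma normc_imaginary (y x : R) : normc (x%:C - 0 +i* y) ^+ 2 = x ^+ 2 + y ^+ 2.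
Proof. by rewrite normc_sqrE /= subr0 sub0r sqrrN. Qed.

Variable nu : {measure set borelR -> \bar R}.
Hypothesis nu1 : nu setT = 1%E.

Lemma normc_stieltjes_le z : Imz z != 0 -> normc (stieltjes nu z) <= `|Imz z|^-1.
Proof.
move=> z0; apply: normc_complex_integral_le_cst => //; first exact: cbounded_cauchy.
by move=> x; exact: normc_cauchy_le.
Qed.

Lemma Im_stieltjes_gt0 z : Imz z != 0 -> 0 < Imz (stieltjes nu z) * Imz z.
Proof.
move=> z0; rewrite /stieltjes /= mulrC -integralZ1//; last first.
  by have [] := cbounded_cauchy z0.
apply: integral_gt0 => // [|x].
  by apply: bounded_measurableZ; have [] := cbounded_cauchy z0.
have : 0 < normc (x%:C - z) by rewrite normc_gt0 real_sub_neq0.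
rewrite Im_cauchy mulrA -expr2 => n0; apply: divr_gt0; last exact: exprn_gt0.
by rewrite exprn_even_gt0.
Qed.

Lemma stieltjes_conj z : Imz z != 0 -> stieltjes nu z^*%R = (stieltjes nu z)^*%R.
Proof.
move=> z0; rewrite /stieltjes -complex_integralJ//; last first.
  by have [] := cbounded_cauchy z0.
congr complex_integral; apply/funext => x.
rewrite /cauchy fmorphV rmorphB; congr ((_ - _)^-1).
by apply: complexP; rewrite ?cRe_conj ?cIm_conj /= ?oppr0.
Qed.

(** The far mass of the measure is controlled by the transform high up on the
    imaginary axis, since 1 - y Im f(iy) is the integral of x^2/(x^2+y^2). *)
Lemma stieltjes_tight (y : R) : 0 < y ->
  1 - (dist_fun nu y - dist_fun nu (- y)) <= 2 * (1 - y * Imz (stieltjes nu (0 +i* y))).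
Proof.
move=> y0; have z0 : Imz (0 +i* y : C) != 0 by rewrite gt_eqF.
set D : set borelR := `]- y, y]%classic; have mD : measurable D by exact: measurable_itv.
have mDC := measurableC mD.
have [_ mIm] := cbounded_cauchy z0.
have mg : bounded_measurable (fun x => 1 - y * Imz (cauchy (0 +i* y) x)).
  by apply: bounded_measurableB; [exact: bounded_measurable_cst|exact: bounded_measurableZ].
rewrite -measure_oc//; last by rewrite ge0_cp// ltW.
have -> : Imz (stieltjes nu (0 +i* y)) = \int[nu]_x Imz (cauchy (0 +i* y) x) by [].
rewrite -measure_compl// -integralZ1//.
rewrite -[X in X - _](integral_cst1 nu1) -integralB1//; last 2 first.
- exact: bounded_measurable_cst.
- exact: bounded_measurableZ.
rewrite -integralZ1//.
have mI : bounded_measurable (\1_(~` D)).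
  by split; [exact: measurable_indic|exists 1 => x; rewrite indicE ger0_norm ?ler0n// lern1 leq_b1].
have -> : fine (nu (~` D)) = \int[nu]_x \1_(~` D) x.
  by rewrite /Rintegral integral_indic// setIT.
apply: le_integral1 => //; first exact: bounded_measurableZ.
move=> x; rewrite Im_cauchy normc_imaginary /= mulrA -expr2.
have d0 : 0 < x ^+ 2 + y ^+ 2 by rewrite ltr_wpDl ?sqr_ge0 ?exprn_gt0.
have -> : 1 - y ^+ 2 / (x ^+ 2 + y ^+ 2) = x ^+ 2 / (x ^+ 2 + y ^+ 2).
  by field; rewrite gt_eqF.
rewrite indicE; case: (boolP (x \in ~` D)) => [|_]; last first.
  by rewrite mulr_ge0// divr_ge0 ?sqr_ge0// ltW.
rewrite inE /D /= in_itv /= => /negP xD; rewrite mulrA ler_pdivlMr// mul1r.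
suff : y ^+ 2 <= x ^+ 2 by lra.
rewrite -(real_normK (num_real x)) lerXn2r ?nnegrE ?(ltW y0)//.
move: xD; rewrite negb_and -leNgt -ltNge ler_normr => /orP[]; lra.
Qed.

End Stieltjes.

Section StieltjesClass.
Context {R : realType}.
Local Notation borelR := (measurableTypeR R).
Local Notation C := R[i].

Variable mu : probability borelR R.
Let mu1 : mu setT = 1%E. Proof. exact: probability_setT. Qed.

(** The remainder in the integrand is h (x - z)^-2 (x - z - h)^-1, and the
    distance of z + h to the real line is at least half that of z. *)
Lemma stieltjes_difference (z h : C) : Imz z != 0 -> normc h <= `|Imz z| / 2 -> h != 0 ->
  normc (h^-1 * (stieltjes mu (h + z) - stieltjes mu z)
         - complex_integral mu (fun x => cauchy z x * cauchy z x))
  <= normc h * (2 / `|Imz z| ^+ 3).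
Proof.
move=> z0 hz h0; have b0 : 0 < `|Imz z| by rewrite normr_gt0.
have hz0 : `|Imz z| / 2 <= `|Imz (h + z)|.
  rewrite Im_add; have := abs_Im_le h; have := ler_normB (Imz h + Imz z) (Imz h).
  rewrite addrAC subrr add0r; lra.
have hzn : Imz (h + z) != 0 by rewrite -normr_gt0; lra.
have m1 := cbounded_cauchy z0; have m2 := cbounded_cauchy hzn.
have mB : cbounded (fun x => cauchy (h + z) x - cauchy z x).
  by apply: cboundedD => //; under eq_fun do rewrite -mulN1r;
     apply: cboundedM => //; exact: cbounded_cst.
rewrite /stieltjes -complex_integralB// -complex_integralZ// -complex_integralB//; last 2 first.
- by apply: cboundedM => //; exact: cbounded_cst.
- exact: cboundedM.
have key x : h^-1 * (cauchy (h + z) x - cauchy z x) - cauchy z x * cauchy z x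
   = h * (cauchy z x * cauchy z x * cauchy (h + z) x).
  have d1 := real_sub_neq0 x z0; have d2 := real_sub_neq0 x hzn.
  rewrite /cauchy; move: d1 d2; set X := x%:C => d1 d2.
  by field; rewrite h0 d1 d2.
apply: normc_complex_integral_le_cst => // [|x].
  under eq_fun do rewrite key; apply: cboundedM; first exact: cbounded_cst.
  by apply: cboundedM => //; exact: cboundedM.
rewrite key !normcM ler_wpM2l ?normc_ge0//.
have n1 := normc_cauchy_le x z0; have n2 := normc_cauchy_le x hzn.
have n3 : `|Imz (h + z)|^-1 <= 2 / `|Imz z|.
  rewrite -invf_div lef_pV2 ?posrE ?divr_gt0//; lra.
have -> : 2 / `|Imz z| ^+ 3 = `|Imz z|^-1 * `|Imz z|^-1 * (2 / `|Imz z|).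
  by field; rewrite gt_eqF.
apply: ler_pM; rewrite ?mulr_ge0 ?normc_ge0//; last exact: le_trans n3.
by apply: ler_pM; rewrite ?normc_ge0.
Qed.

Lemma stieltjes_analytic : analytic_off_real (stieltjes mu).
Proof.
move=> z z0; apply/cvg_ex.
exists (complex_integral mu (fun x => cauchy z x * cauchy z x)).
apply/cvgrPdist_le => e e0.
have b0 : 0 < `|Imz z| by rewrite normr_gt0.
pose r := Rez e; have eE : e = r%:C.
  by rewrite /r; case: (e) e0 => a b; rewrite ltcE /= => /andP[/eqP-> _].
have r0 : 0 < r by move: e0; rewrite eE ltcR.
pose k := 2 / `|Imz z| ^+ 3; have k0 : 0 < k by rewrite divr_gt0 ?exprn_gt0.
pose dl := Num.min (`|Imz z| / 2) (r / k).
have dl0 : 0 < dl by rewrite lt_min; apply/andP; split; exact: divr_gt0.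
apply/nbhs_ballP; exists dl%:C => /=; first by rewrite ltcR.
move=> h /= hd h0.
have hd' : normc h < dl.
  by move: hd; rewrite /ball /= sub0r normrN /Num.norm /= ltcR.
have [h1 h2] : normc h <= `|Imz z| / 2 /\ normc h <= r / k.
  by move: (ltW hd'); rewrite le_min => /andP[].
have := stieltjes_difference z0 h1 h0.
rewrite -/k distrC => h3; rewrite eE /Num.norm /= lecR.
apply: le_trans (le_trans h3 _); last by rewrite -ler_pdivlMr.
by rewrite [h *: (1 : C^o)]mulr1.
Qed.

Lemma stieltjes_imaginary_cvg :
  k.+1%:R * Imz (stieltjes mu (0 +i* k.+1%:R)) @[k --> \oo] --> (1 : R).
Proof.
have im k : Imz (0 +i* (k.+1%:R) : C) != 0 by rewrite pnatr_eq0.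
rewrite -[X in _ --> X](integral_cst1 mu1).
under eq_fun => k do rewrite /= -(integralZ1 mu1 _ (cbounded_cauchy (im k)).2).
apply: (@integral_cvg _ _ mu1 _ _ 1) => [k|k x|x|].
- by have [] := bounded_measurableZ k.+1%:R (cbounded_cauchy (im k)).2.
- rewrite normrM normr_nat; apply: le_trans (ler_wpM2l _ (abs_Im_le _)) _ => //.
  apply: le_trans (ler_wpM2l _ (normc_cauchy_le x (im k))) _ => //.
  by rewrite /= normr_nat mulfV// pnatr_eq0.
- have e k : k.+1%:R * Imz (cauchy (0 +i* k.+1%:R) x)
     = (1 + (x * k.+1%:R^-1) * (x * k.+1%:R^-1))^-1.
    rewrite Im_cauchy normc_imaginary /=; have k0 : k.+1%:R != 0 :> R by rewrite pnatr_eq0.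
    have d0 : 0 < x ^+ 2 + k.+1%:R ^+ 2 by rewrite ltr_wpDl ?sqr_ge0// exprn_gt0.
    have -> : 1 + x * k.+1%:R^-1 * (x * k.+1%:R^-1) = (x ^+ 2 + k.+1%:R ^+ 2) / k.+1%:R ^+ 2.
      by field.
    by rewrite invf_div mulrA.
  have c0 : x * k.+1%:R^-1 @[k --> \oo] --> (0 : R).
    by rewrite -[X in _ --> X](mulr0 x); apply: cvgMr; exact: cvg_harmonic.
  have c1 : 1 + x * k.+1%:R^-1 * (x * k.+1%:R^-1) @[k --> \oo] --> (1 : R).
    rewrite -[X in _ --> X]addr0 -[X in _ + X](mulr0 0).
    by apply: cvgD; [exact: cvg_cst|exact: cvgM].
  by rewrite (funext e) -[X in _ --> X]invr1; apply: cvgV => //; exact: oner_neq0.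
- exact: bounded_measurable_cst.
Qed.

(** The upper bound is |f(z)| <= 1 / |Im z|; it is attained in the limit because
    y Im f(iy) is the integral of y^2 / (x^2 + y^2). *)
Lemma stieltjes_sup :
  ereal_sup [set (y * normc (stieltjes mu (0 +i* y)))%:E | y in [set y : R | 1 <= y]] = 1%E.
Proof.
apply/eqP; rewrite eq_le; apply/andP; split.
  apply: ge_ereal_sup => _ [y /= y1 <-]; have y0 : 0 < y by lra.
  have z0 : Imz (0 +i* y : C) != 0 by rewrite gt_eqF.
  rewrite lee_fin mulrC -ler_pdivlMr// div1r.
  by have := normc_stieltjes_le mu1 z0; rewrite /= gtr0_norm.
apply/lee_addgt0Pr => e e0.
have /cvgrPdist_le /(_ _ e0) [k _ /(_ _ (leqnn k))] := stieltjes_imaginary_cvg.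
rewrite /= => h; rewrite -leeBlDr//.
apply: (@le_trans _ _ (k.+1%:R * normc (stieltjes mu (0 +i* k.+1%:R)))%:E); last first.
  by apply: ereal_sup_ubound; exists k.+1%:R => //=; rewrite ler1n.
rewrite -EFinB lee_fin.
have h1 : k.+1%:R * Imz (stieltjes mu (0 +i* k.+1%:R))
    <= k.+1%:R * normc (stieltjes mu (0 +i* k.+1%:R)).
  by rewrite ler_wpM2l//; apply: le_trans (abs_Im_le _); exact: ler_norm.
have := le_trans (ler_norm _) h; rewrite /= in h1 *; lra.
Qed.

Lemma stieltjes_solution_class : solution_class (stieltjes mu).
Proof.
split; [exact: stieltjes_analytic|by move=> z; exact: Im_stieltjes_gt0|exact: stieltjes_sup].
Qed.

End StieltjesClass.

(** * The limit equation has at most one solution *)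

Section Uniqueness.
Context {R : realType}.
Local Notation borelR := (measurableTypeR R).
Local Notation C := R[i].
Variable sigma : probability borelR R.
Variable c : R.
Hypothesis c0 : 0 <= c.

Let s1 : sigma setT = 1%E. Proof. exact: probability_setT. Qed.

(** With this kernel the equation for f at z is 1/f + z = c * integral of kernel f. *)
Definition kernel (f : C) (t : R) : C := t%:C / (1 + t%:C * f).

Lemma normc_kernel_le f t : Imz f != 0 -> normc (kernel f t) <= `|Imz f|^-1.
Proof.
move=> f0; have d0 := moebius_denom_neq0 t f0.
rewrite normcM normcV normc_real ler_pdivrMr ?normc_gt0//.
by rewrite mulrC ler_pdivlMr ?normr_gt0// Im_le_denom.
Qed.

Lemma ccontinuous_kernel f : Imz f != 0 -> ccontinuous (kernel f).
Proof.
move=> f0; apply: ccontinuousM; first exact: ccontinuous_real.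
apply: ccontinuousV => [|t]; last exact: moebius_denom_neq0.
apply: ccontinuousD; first exact: ccontinuous_cst.
by apply: ccontinuousM; [exact: ccontinuous_real|exact: ccontinuous_cst].
Qed.

Lemma cbounded_kernel f : Imz f != 0 -> cbounded (kernel f).
Proof.
move=> f0; apply: (ccontinuous_cbounded (ccontinuous_kernel f0)) => t.
exact: normc_kernel_le.
Qed.

Lemma Im_kernel f t : Imz (kernel f t) = - Imz f * normc (kernel f t) ^+ 2.
Proof.
rewrite normcM normc_real normcV Im_mul Im_inv Re_inv /= mul0r addr0.
rewrite Im_add Im_mul /= mul0r addr0 add0r exprMn real_normK ?num_real// exprVn.
by rewrite expr2; ring.
Qed.

Lemma bounded_measurable_sqr f : Imz f != 0 ->
  bounded_measurable (fun t => normc (kernel f t) ^+ 2).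
Proof.
move=> /cbounded_kernel [h1 h2]; under eq_fun do rewrite normc_sqrE !expr2.
by apply: bounded_measurableD; exact: bounded_measurableM.
Qed.

Local Notation energy f := (\int[sigma]_t (normc (kernel f t) ^+ 2)).

Lemma equation_inv z f : Imz f != 0 ->
  f = - (z - c%:C * complex_integral sigma (kernel f))^-1 ->
  f^-1 + z = c%:C * complex_integral sigma (kernel f).
Proof. by move=> f0 {1}->; rewrite invrN invrK; ring. Qed.

(** Taking imaginary parts in the equation: Im z / Im f = 1/|f|^2 - c * energy. *)
Lemma energy_lt z f : 0 < Imz f * Imz z ->
  f^-1 + z = c%:C * complex_integral sigma (kernel f) ->
  c * energy f < (normc f ^+ 2)^-1.
Proof.
move=> fz eq; have f0 : Imz f != 0 by apply/eqP => h; rewrite h mul0r ltxx in fz.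
have := congr1 Imz eq; rewrite Im_add Im_inv Im_mul /= mul0r addr0.
have -> : \int[sigma]_x Imz (kernel f x) = - Imz f * energy f.
  by under eq_fun do rewrite Im_kernel; rewrite integralZ1//; exact: bounded_measurable_sqr.
set E := energy f; set n := normc f ^+ 2 => h.
have h2 : Imz f * Imz z = Imz f ^+ 2 * (n^-1 - c * E).
  have -> : Imz z = (- Imz f / n + Imz z) + Imz f / n by ring.
  by rewrite h; ring.
move: fz; rewrite h2 pmulr_rgt0; first by rewrite subr_gt0.
by rewrite exprn_even_gt0.
Qed.

Lemma kernel_sub f1 f2 t : Imz f1 != 0 -> Imz f2 != 0 ->
  kernel f1 t - kernel f2 t = (f2 - f1) * (kernel f1 t * kernel f2 t).
Proof.
move=> f10 f20; have d1 := moebius_denom_neq0 t f10; have d2 := moebius_denom_neq0 t f20.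
by rewrite /kernel; field; rewrite d1 d2.
Qed.

(** Two solutions f1, f2 at the same z satisfy
    (f2 - f1) * (1 / (f1 f2) - c * integral (kernel f1 * kernel f2)) = 0, and by
    the arithmetic-geometric mean inequality the energy bounds exclude that the
    second factor vanishes. *)
Lemma equation_unique z f1 f2 : 0 < Imz f1 * Imz z -> 0 < Imz f2 * Imz z ->
  f1 = - (z - c%:C * complex_integral sigma (kernel f1))^-1 ->
  f2 = - (z - c%:C * complex_integral sigma (kernel f2))^-1 -> f1 = f2.
Proof.
move=> h1 h2 e1 e2.
have f10 : Imz f1 != 0 by apply/eqP => h; rewrite h mul0r ltxx in h1.
have f20 : Imz f2 != 0 by apply/eqP => h; rewrite h mul0r ltxx in h2.
have {}e1 := equation_inv f10 e1; have {}e2 := equation_inv f20 e2.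
have E1 := energy_lt h1 e1; have E2 := energy_lt h2 e2.
have m1 := cbounded_kernel f10; have m2 := cbounded_kernel f20.
have m12 := cboundedM m1 m2.
apply/eqP; rewrite eq_sym -subr_eq0; apply/negPn/negP => f12.
have n1 := Im_neq0 f10; have n2 := Im_neq0 f20.
pose Q := complex_integral sigma (fun t => kernel f1 t * kernel f2 t).
have QE : (f1 * f2)^-1 = c%:C * Q.
  apply: (mulfI f12).
  have -> : (f2 - f1) / (f1 * f2) = (f1^-1 + z) - (f2^-1 + z).
    by field; rewrite n1 n2.
  rewrite e1 e2 -mulrBr -complex_integralB// mulrCA; congr (_ * _).
  by rewrite -complex_integralZ//; under eq_fun do rewrite kernel_sub//.
have p1 : 0 < normc f1 by rewrite normc_gt0.
have p2 : 0 < normc f2 by rewrite normc_gt0.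
pose a := normc f1 / normc f2.
have a0 : 0 < a by rewrite divr_gt0.
have q1 := bounded_measurable_sqr f10; have q2 := bounded_measurable_sqr f20.
have Qle : normc Q <= a / 2 * energy f1 + a^-1 / 2 * energy f2.
  rewrite -!integralZ1// -integralD1//; [|exact: bounded_measurableZ..].
  apply: normc_complex_integral_le => //.
    by apply: bounded_measurableD; exact: bounded_measurableZ.
  move=> t; rewrite normcM; move: (normc (kernel f1 t)) (normc (kernel f2 t)) => x y.
  have -> : a / 2 * x ^+ 2 + a^-1 / 2 * y ^+ 2 = x * y + (a * x - y) ^+ 2 / (2 * a).
    by field; rewrite gt_eqF.
  by rewrite lerDl divr_ge0 ?sqr_ge0// mulr_ge0// ltW.
have := congr1 (fun x : C => normc x) QE; rewrite normcV !normcM normc_real (ger0_norm c0).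
have a1 : a / 2 * (normc f1 ^+ 2)^-1 = (normc f1 * normc f2)^-1 / 2.
  by rewrite /a; field; rewrite !gt_eqF.
have a2 : a^-1 / 2 * (normc f2 ^+ 2)^-1 = (normc f1 * normc f2)^-1 / 2.
  by rewrite /a; field; rewrite !gt_eqF.
have b1 : a / 2 * (c * energy f1) < (normc f1 * normc f2)^-1 / 2.
  by rewrite -a1 ltr_pM2l// divr_gt0.
have b2 : a^-1 / 2 * (c * energy f2) < (normc f1 * normc f2)^-1 / 2.
  by rewrite -a2 ltr_pM2l// divr_gt0// invr_gt0.
have := ler_wpM2l c0 Qle; rewrite mulrDr.
have r1 : c * (a / 2 * energy f1) = a / 2 * (c * energy f1) by ring.
have r2 : c * (a^-1 / 2 * energy f2) = a^-1 / 2 * (c * energy f2) by ring.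
rewrite r1 r2 => le1 eq1; rewrite -eq1 in le1.
have := le_lt_trans le1 (ltrD b1 b2).
by rewrite -splitr ltxx.
Qed.

End Uniqueness.

(** * A measure is determined by its Stieltjes transform *)

Section Inversion.
Context {R : realType}.
Local Notation borelR := (measurableTypeR R).
Local Notation C := R[i].

(** The mean value theorem, applied to the 1-Lipschitz function 1/(1 + u^2). *)
Lemma atan_taylor (u v : R) : `|atan v - atan u - (v - u) / (1 + u ^+ 2)| <= (v - u) ^+ 2.
Proof.
have mvt (x y : R) : x <= y -> exists2 w, x <= w <= y & atan y - atan x = (y - x) / (1 + w ^+ 2).
  move=> xy; have [|w] := @MVT_segment R atan (fun w => (1 + w ^+ 2)^-1) x y xy.
    by apply: derivable_within_continuous => w _; exact: ex_derive.
  by rewrite in_itv /= => xwy ->; exists w; rewrite // mulrC.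
have [w [wu ->]] : exists w, `|w - u| <= `|v - u| /\ atan v - atan u = (v - u) / (1 + w ^+ 2).
  have [uv|vu] := leP u v.
    have [w /andP[uw wv] ->] := mvt _ _ uv; exists w; split => //.
    by rewrite !ger0_norm; lra.
  have [w /andP[vw wu] h] := mvt _ _ (ltW vu); exists w; split.
    by rewrite !ler0_norm; lra.
  by rewrite -opprB h -mulNr opprB.
have du : 0 < 1 + u ^+ 2 by rewrite ltr_pwDl ?sqr_ge0.
have dw : 0 < 1 + w ^+ 2 by rewrite ltr_pwDl ?sqr_ge0.
have -> : (v - u) / (1 + w ^+ 2) - (v - u) / (1 + u ^+ 2)
   = (v - u) * ((u - w) * ((u + w) / ((1 + u ^+ 2) * (1 + w ^+ 2)))).
  by field; rewrite !gt_eqF.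
rewrite normrM -[leRHS]real_normK ?num_real// expr2 ler_wpM2l// normrM.
apply: le_trans wu; rewrite distrC -[leRHS]mulr1 ler_wpM2l//.
rewrite normrM normfV (gtr0_norm (mulr_gt0 du dw)) ler_pdivrMr ?mulr_gt0// mul1r.
rewrite ler_norml; apply/andP; split.
  have := sqr_ge0 (u + 1); have := sqr_ge0 (w + 1); have := mulr_ge0 (sqr_ge0 u) (sqr_ge0 w).
  have := sqr_ge0 u; have := sqr_ge0 w; nra.
have := sqr_ge0 (u - 1); have := sqr_ge0 (w - 1); have := mulr_ge0 (sqr_ge0 u) (sqr_ge0 w).
have := sqr_ge0 u; have := sqr_ge0 w; nra.
Qed.

(** Cutting [b, b'] into k equal pieces bounds the increment by K (b' - b)^2 / k. *)
Lemma quadratic_constant (D : R -> R) (K : R) :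
  (forall b h, `|D (b + h) - D b| <= K * h ^+ 2) -> forall b b', D b = D b'.
Proof.
move=> DK b b'; apply/eqP; rewrite eq_sym -subr_eq0 -normr_le0; apply/ler_addgt0Pl => e e0.
rewrite addr0; pose h := b' - b.
have K0 : 0 <= K.
  by have := le_trans (normr_ge0 _) (DK 0 1); rewrite expr1n mulr1.
have steps k (g : R) : `|D (b + k%:R * g) - D b| <= k%:R * (K * g ^+ 2).
  elim: k => [|k IH]; first by rewrite !mul0r addr0 subrr normr0.
  have h1 := DK (b + k%:R * g) g.
  have -> : b + k.+1%:R * g = b + k%:R * g + g by rewrite -natr1 mulrDl mul1r addrA.
  have -> : D (b + k%:R * g + g) - D b
    = (D (b + k%:R * g + g) - D (b + k%:R * g)) + (D (b + k%:R * g) - D b) by ring.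
  rewrite -natr1 mulrDl mul1r addrC.
  by apply: le_trans (ler_normD _ _) _; apply: lerD.
pose k := (Num.truncn (K * h ^+ 2 / e)).+1.
have k0 : 0 < k%:R :> R by rewrite ltr0n.
have := steps k (h / k%:R).
have -> : b + k%:R * (h / k%:R) = b' by rewrite mulrC mulfVK ?gt_eqF// /h; ring.
move=> /le_trans; apply.
have -> : k%:R * (K * (h / k%:R) ^+ 2) = K * h ^+ 2 / k%:R by field; rewrite gt_eqF.
rewrite ler_pdivrMr// [e * _]mulrC -ler_pdivrMr// ltW//.
by have := truncnS_gt (K * h ^+ 2 / e).
Qed.

Lemma cvg_atan_pinfty (u : nat -> R) : u k @[k --> \oo] --> +oo ->
  atan (u k) @[k --> \oo] --> (pi / 2 : R).
Proof. by move=> uoo; exact: (@cvg_comp _ _ _ u (@atan R) _ _ _ uoo (@cvgy_atan R)). Qed.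

Lemma normr_atan_le (x : R) : `|atan x| <= pi / 2.
Proof. by rewrite ler_norml !ltW ?atan_gtNpi2 ?atan_ltpi2. Qed.

Lemma measurable_atan_affine (p q : R) :
  measurable_fun (setT : set borelR) (fun x : borelR => atan (p * x + q)).
Proof.
apply: continuous_measurable_fun => x; apply: continuous_comp; last exact: continuous_atan.
by apply: cvgD; [apply: cvgMr|exact: cvg_cst].
Qed.

Definition arctan_integral (nu : {measure set borelR -> \bar R}) (y b : R) : R :=
  \int[nu]_x atan ((b - x) / y).

Section UnitMass.
Variable nu : {measure set borelR -> \bar R}.
Hypothesis nu1 : nu setT = 1%E.

Let affine (y b : R) : (fun x => atan ((b - x) / y)) = (fun x => atan (- y^-1 * x + b / y)).
Proof. by apply/funext => x; congr atan; ring. Qed.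

Let m_atan (y b : R) : bounded_measurable (fun x => atan ((b - x) / y)).
Proof.
split; last by exists (pi / 2) => x; exact: normr_atan_le.
by rewrite affine; exact: measurable_atan_affine.
Qed.

(** The derivative of arctan ((b - x) / y) in b is the imaginary part of
    1 / (x - (b + iy)). *)
Lemma arctan_integral_taylor (y b h : R) : 0 < y ->
  `|arctan_integral nu y (b + h) - arctan_integral nu y b
    - h * Imz (stieltjes nu (b +i* y))| <= (h / y) ^+ 2.
Proof.
move=> y0; have z0 : Imz (b +i* y : C) != 0 by rewrite gt_eqF.
have [_ mI] := cbounded_cauchy z0.
have -> : Imz (stieltjes nu (b +i* y)) = \int[nu]_x Imz (cauchy (b +i* y) x) by [].
rewrite /arctan_integral -integralB1// -integralZ1// -integralB1//; last 2 first.
- exact: bounded_measurableB.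
- exact: bounded_measurableZ.
apply: normr_integral1 => //.
  by apply: bounded_measurableB; [exact: bounded_measurableB|exact: bounded_measurableZ].
move=> x; have := atan_taylor ((b - x) / y) ((b + h - x) / y).
have -> : (b + h - x) / y - (b - x) / y = h / y by ring.
suff -> : h / y / (1 + ((b - x) / y) ^+ 2) = h * Imz (cauchy (b +i* y) x) by [].
rewrite Im_cauchy normc_sqrE /= sub0r sqrrN.
have d0 : 0 < (x - b) ^+ 2 + y ^+ 2 by rewrite ltr_wpDl ?sqr_ge0// exprn_gt0.
have -> : 1 + ((b - x) / y) ^+ 2 = ((x - b) ^+ 2 + y ^+ 2) / y ^+ 2.
  by field; rewrite gt_eqF.
by rewrite invf_div; field; rewrite !gt_eqF.
Qed.

Lemma arctan_integral_Ny (y : R) : 0 < y ->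
  arctan_integral nu y (- k%:R) @[k --> \oo] --> - (pi / 2 : R).
Proof.
move=> y0; rewrite -[X in _ --> X](integral_cst1 nu1).
apply: (@integral_cvg _ _ nu1 _ _ (pi / 2)) => [k|k x|x|].
- by have [] := m_atan y (- k%:R).
- exact: normr_atan_le.
- have e k : atan ((- k%:R - x) / y) = - atan ((k%:R + x) / y).
    by rewrite -atanN; congr atan; ring.
  rewrite (funext e); apply: cvgN; apply: cvg_atan_pinfty.
  apply/cvgryPge => a; near=> k; rewrite ler_pdivlMr// -lerBlDr.
  by near: k; exact: nbhs_infty_ger.
- exact: bounded_measurable_cst.
Unshelve. all: by end_near. Qed.

(** With b approached from the right slower than the width of the arctangent
    shrinks, the limit is the distribution function at b. *)
Lemma arctan_integral_dist (b : R) :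
  arctan_integral nu (k.+1%:R ^- 2) (b + k.+1%:R^-1) @[k --> \oo]
    --> pi * dist_fun nu b - pi / 2.
Proof.
pose f (x : R) : R := pi * \1_(`]-oo, b]%classic) x - pi / 2.
have mI : bounded_measurable (\1_(`]-oo, b]%classic : set borelR)).
  split; first exact: measurable_indic.
  by exists 1 => x; rewrite indicE ger0_norm ?ler0n// lern1 leq_b1.
have mf : bounded_measurable f.
  by apply: bounded_measurableB; [exact: bounded_measurableZ|exact: bounded_measurable_cst].
have -> : pi * dist_fun nu b - pi / 2 = \int[nu]_x f x.
  rewrite /f integralB1//; last 2 first.
  - exact: bounded_measurableZ.
  - exact: bounded_measurable_cst.
  rewrite integralZ1// integral_cst1//; congr (_ * _ - _).
  by rewrite /Rintegral integral_indic// setIT.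
apply: (@integral_cvg _ _ nu1 _ _ (pi / 2)) => // [k|k x|x].
- by have [] := m_atan (k.+1%:R ^- 2) (b + k.+1%:R^-1).
- exact: normr_atan_le.
have e k : (b + k.+1%:R^-1 - x) / k.+1%:R ^- 2 = k.+1%:R * ((b - x) * k.+1%:R + 1).
  have : k.+1%:R != 0 :> R by rewrite pnatr_eq0.
  by move: (k.+1%:R : R) => K K0; field.
under eq_fun do rewrite e.
rewrite /f indicE; have [xb|bx] := leP x b.
  rewrite mem_set ?mulr1; last by rewrite /= in_itv.
  have -> : pi - pi / 2 = pi / 2 :> R by field.
  apply: cvg_atan_pinfty; apply/cvgryPge => a; near=> k.
  apply: (@le_trans _ _ (k.+1%:R * 1)).
    by rewrite mulr1; near: k; apply: filterS (nbhs_infty_ger a) => k /le_trans; apply; rewrite ler_nat.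
  by rewrite ler_wpM2l// lerDr mulr_ge0// subr_ge0.
rewrite memNset ?mulr0 ?sub0r; last by rewrite /= in_itv /= leNgt bx.
have e2 k : atan (k.+1%:R * ((b - x) * k.+1%:R + 1)) = - atan (k.+1%:R * ((x - b) * k.+1%:R - 1)).
  by rewrite -atanN; congr atan; ring.
rewrite (funext e2); apply: cvgN; apply: cvg_atan_pinfty.
apply/cvgryPge => a; near=> k.
apply: (@le_trans _ _ (k.+1%:R * 1)).
  by rewrite mulr1; near: k; apply: filterS (nbhs_infty_ger a) => k /le_trans; apply; rewrite ler_nat.
rewrite ler_wpM2l// lerBrDr mulrC -ler_pdivrMr ?subr_gt0//.
by near: k; apply: filterS (nbhs_infty_ger ((1 + 1) / (x - b))) => k /le_trans; apply; rewrite ler_nat.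
Unshelve. all: by end_near. Qed.

End UnitMass.

(** The arctangent integrals of two measures with the same transform differ by
    a constant, which vanishes because both tend to - pi / 2 on the left. *)
Lemma stieltjes_dist_fun (mu nu : {measure set borelR -> \bar R}) :
  mu setT = 1%E -> nu setT = 1%E ->
  (forall z, 0 < Imz z -> stieltjes mu z = stieltjes nu z) ->
  forall b, dist_fun mu b = dist_fun nu b.
Proof.
move=> mu1 nu1 eqs b.
have same (y a : R) : 0 < y -> arctan_integral mu y a = arctan_integral nu y a.
  move=> y0; pose D a := arctan_integral mu y a - arctan_integral nu y a.
  have D_cst : forall a a', D a = D a'.
    apply: (@quadratic_constant D (2 * y ^- 2)) => a0 h.
    have h1 := arctan_integral_taylor mu1 a0 h y0; have h2 := arctan_integral_taylor nu1 a0 h y0.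
    rewrite eqs// in h1.
    have -> : D (a0 + h) - D a0 = (arctan_integral mu y (a0 + h) - arctan_integral mu y a0
      - h * Imz (stieltjes nu (a0 +i* y)))
      - (arctan_integral nu y (a0 + h) - arctan_integral nu y a0
      - h * Imz (stieltjes nu (a0 +i* y))) by rewrite /D; ring.
    apply: le_trans (ler_normB _ _) _; apply: le_trans (lerD h1 h2) _.
    by rewrite exprMn exprVn; lra.
  have D0 : D (- k%:R) @[k --> \oo] --> (0 : R).
    by rewrite -[X in _ --> X](subrr (- (pi / 2))); apply: cvgB; exact: arctan_integral_Ny.
  have Da : D (- k%:R) @[k --> \oo] --> D a.
    by under eq_fun => k do rewrite (D_cst _ a); exact: cvg_cst.
  by apply/eqP; rewrite -subr_eq0 -/(D a) (cvg_unique _ Da D0).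
have h1 := @arctan_integral_dist mu mu1 b; have h2 := @arctan_integral_dist nu nu1 b.
have e k : arctan_integral mu (k.+1%:R ^- 2) (b + k.+1%:R^-1)
   = arctan_integral nu (k.+1%:R ^- 2) (b + k.+1%:R^-1).
  by apply: same; rewrite invr_gt0 exprn_gt0.
rewrite (funext e) in h1.
have h : pi * dist_fun mu b - pi / 2 = pi * dist_fun nu b - pi / 2.
  exact: (cvg_unique _ h1 h2).
by move/addIr: h; apply: mulfI; rewrite gt_eqF// pi_gt0.
Qed.

Lemma dist_fun_measure (mu nu : {measure set borelR -> \bar R}) :
  mu setT = 1%E -> nu setT = 1%E -> dist_fun mu =1 dist_fun nu ->
  forall D : set borelR, measurable D -> mu D = nu D.
Proof.
move=> mu1 nu1 eqF D mD.
have fin (m : {measure set borelR -> \bar R}) (B : set borelR) : m setT = 1%E -> measurable B ->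
    m B \is a fin_num.
  move=> m1 mB; rewrite ge0_fin_numE//; apply: (@le_lt_trans _ _ (m setT)).
    by apply: le_measure; rewrite ?inE.
  by rewrite m1 ltry.
apply: (@measure_unique _ R borelR (@ocitv R) (fun k => `]- k%:R, k%:R]%classic)) => //.
- exact: ocitvI.
- by move=> k; exact: is_ocitv.
- exact: (bigcup_itvT false false).
- move=> _ [[a b] _ <-] /=; have [ab|ba] := leP a b; last first.
    by rewrite set_itv_ge ?measure0// bnd_simp -leNgt ltW.
  have mab : measurable (`]a, b]%classic : set borelR) by exact: measurable_itv.
  rewrite -[LHS]fineK ?fin// -[RHS]fineK ?fin//; congr (_%:E).
  by rewrite !measure_oc// !eqF.
- by move=> k; rewrite ltey_eq fin//; exact: measurable_itv.
Qed.

Lemma stieltjes_inj (mu nu : probability borelR R) :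
  (forall z, 0 < Imz z -> stieltjes mu z = stieltjes nu z) ->
  forall phi : R -> R, \int[mu]_x phi x = \int[nu]_x phi x.
Proof.
move=> eqs phi; congr fine; apply: eq_measure_integral => D mD _.
have mu1 : mu setT = 1%E by exact: probability_setT.
have nu1 : nu setT = 1%E by exact: probability_setT.
by apply: dist_fun_measure => //; exact: stieltjes_dist_fun.
Qed.

End Inversion.

(** * Limits in probability as limits along a filter *)

Section ProbabilityFilter.
Context {R : realType} {d : measure_display} {T : measurableType d}.
Variable P : probability T R.

(** The sets of pairs (k, w) that contain, for all large k, every w outside a
    measurable exceptional set of vanishing probability: convergence in
    probability of w-dependent sequences is convergence along this filter. *)
Definition prob_filter : set_system (nat * T) := [set S |
  exists B : nat -> set T, [/\ forall k, measurable (B k), P (B k) @[k --> \oo] --> 0%E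
    & \forall k \near \oo, forall w, ~ B k w -> S (k, w)]].

#[global] Instance prob_filter_filter : Filter prob_filter.
Proof.
split.
- by exists (fun=> set0); split=> //; [by rewrite measure0; exact: cvg_cst|exact: nearW].
- move=> S S' [B [mB B0 BS]] [B' [mB' B0' BS']].
  exists (fun k => B k `|` B' k); split=> [k||]; first exact: measurableU.
    apply: (@squeeze_cvge _ _ _ _ (fun=> 0%E) _ (fun k => P (B k) + P (B' k))%E).
    - by apply: nearW => k; rewrite measure_ge0 measureU2.
    - exact: cvg_cst.
    - by rewrite -[X in _ --> X]adde0; apply: cvgeD.
  near=> k => w /not_orP[nB nB']; split.
    by move: w nB {nB'}; near: k.
  by move: w nB' {nB}; near: k.
- move=> S S' SS' [B [mB B0 BS]]; exists B; split=> //.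
  by apply: filterS BS => k BS w /BS /SS'.
Unshelve. all: by end_near. Qed.

#[global] Instance prob_filter_proper : ProperFilter prob_filter.
Proof.
apply: Build_ProperFilter.
move=> [B [mB B0 BS]].
have : P (B k) @[k --> \oo] --> 1%E.
  apply: cvg_near_cst; apply: filterS BS => k Bk.
  rewrite -(probability_setT P); congr (P _); apply/seteqP; split => // w _.
  by apply: contrapT => /Bk.
move=> /(cvg_unique (@ereal_hausdorff R) B0) /eqP.
by rewrite eq_sym onee_eq0.
Qed.

Lemma prob_filter_nat (Q : nat -> Prop) : (\forall k \near \oo, Q k) ->
  \forall p \near prob_filter, Q p.1.
Proof.
move=> Qk; exists (fun=> set0); split=> //; first by rewrite measure0; exact: cvg_cst.
by apply: filterS Qk => k Qk w _.
Qed.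

Lemma prob_filter_cvg (X : nat -> T -> R) (e : R) :
  (forall k, measurable [set w | e < X k w]) ->
  P [set w | e < X k w] @[k --> \oo] --> 0%E ->
  \forall p \near prob_filter, X p.1 p.2 <= e.
Proof.
move=> mX X0; exists (fun k => [set w | e < X k w]); split=> //.
by apply: nearW => k w /= /negP; rewrite -leNgt.
Qed.

Lemma measurable_gt (X : T -> R) (e : R) : measurable_fun setT X ->
  measurable [set w | e < X w].
Proof.
move=> mX; have -> : [set w | e < X w] = setT `&` X @^-1` `]e, +oo[%classic.
  by apply/seteqP; split => w /=; rewrite in_itv /= andbT => //; case.
exact: mX.
Qed.

Lemma prob_filter_markov (X : nat -> T -> R) (b : nat -> R) (e : R) : 0 < e ->
  (forall k, measurable_fun setT (X k)) -> (forall k w, 0 <= X k w) ->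
  (\forall k \near \oo, (\int[P]_w (X k w)%:E <= (b k)%:E)%E) ->
  b k @[k --> \oo] --> 0 -> \forall p \near prob_filter, X p.1 p.2 <= e.
Proof.
move=> e0 mX X0 Xb b0.
have mS k : measurable [set w | e < X k w] by exact: measurable_gt.
apply: prob_filter_cvg => //.
apply: (@squeeze_cvge _ _ _ _ (fun=> 0%E) _ (fun k => (b k / e)%:E)).
- apply: filterS Xb => k Xb; rewrite measure_ge0 /= EFinM muleC.
  rewrite lee_pdivlMl//.
  apply: le_trans Xb.
  have -> : (\int[P]_w (X k w)%:E = \int[P]_w `|(X k w)%:E|)%E.
    by apply: eq_integral => w _ /=; rewrite ger0_norm.
  apply: le_trans (le_integral_abse P measurableT (a := e) _ e0).
    rewrite lee_pmul2l ?lte_fin// setTI; apply: le_measure; rewrite ?inE//.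
      rewrite -[X in measurable X]setTI; apply: emeasurable_fun_c_infty => //.
      by apply: measurableT_comp => //; exact/measurable_EFinP.
    by move=> w /= ew; rewrite lee_fin; apply: le_trans (ler_norm _); exact: ltW.
  exact/measurable_EFinP.
- exact: cvg_cst.
- by apply: cvg_EFin; [exact: nearW|rewrite -[X in _ --> X](mul0r e^-1); apply: cvgMl].
Qed.

Lemma cvg_prob_filter (X : nat -> T -> R) (l e : R) : 0 < e ->
  (forall k, measurable_fun setT (X k)) ->
  X p.1 p.2 @[p --> prob_filter] --> l ->
  P [set w | e < `|X k w - l|] @[k --> \oo] --> 0%E.
Proof.
move=> e0 mX /cvgrPdist_le /(_ _ e0) [B [mB B0 BS]].
have mE k : measurable [set w | e < `|X k w - l|].
  by apply: measurable_gt; apply: measurableT_comp => //; exact: measurable_funB.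
apply: (@squeeze_cvge _ _ _ _ (fun=> 0%E) _ (fun k => P (B k))) => //; last exact: cvg_cst.
apply: filterS BS => k BS; rewrite measure_ge0 /=; apply: le_measure; rewrite ?inE//.
move=> w /= ew; apply: contrapT => /BS /=; rewrite distrC => we.
by have := lt_le_trans ew we; rewrite ltxx.
Qed.

End ProbabilityFilter.

(** If a neighbourhood of l were missed, adding the complement of its preimage to
    F would give a proper filter, and an ultrafilter along which f does not tend
    to l. *)
Lemma cvg_ultra {I : Type} {V : topologicalType} (F : set_system I) {FF : ProperFilter F}
    (f : I -> V) (l : V) :
  (forall U : set_system I, UltraFilter U -> F `<=` U -> f i @[i --> U] --> l) ->
  f i @[i --> F] --> l.
Proof.
move=> fU Q lQ; apply: contrapT => nFQ; pose D := ~` (f @^-1` Q).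
have pD : ProperFilter (within D F).
  apply: Build_ProperFilter; rewrite /within /= => D0; apply: nFQ.
  have : F (f @^-1` Q) by apply: filterS D0 => i nD; apply: contrapT => /nD.
  by [].
have [U [UU FU]] := ultraFilterLemma pD.
have UP : ProperFilter U := @ultra_proper _ _ UU.
have UQ : U (f @^-1` Q).
  apply: (fU U UU _ Q lQ) => S FS; apply: FU; exact: filterS FS.
have UD : U D by apply: FU; exact: withinT.
have : U set0 by rewrite -(setICr (f @^-1` Q)); exact: filterI.
exact: filter_not_empty.
Qed.

(** * The limit equation along the probability filter *)

Section Truncation.
Context {R : realType}.
Local Notation borelR := (measurableTypeR R).

Implicit Types L x : R.

Definition trunc (L x : R) : R := x * \1_(`[- L, L]%classic) x.

Lemma measurable_trunc L : measurable_fun setT (trunc L).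
Proof. by apply: measurable_funM => //; exact: measurable_indic. Qed.

Lemma normr_trunc_le L x : 0 <= L -> `|trunc L x| <= L.
Proof.
move=> L0; rewrite /trunc indicE; case: (boolP (x \in _)) => [|_]; last by rewrite mulr0 normr0.
by rewrite mulr1 inE /= in_itv /= ler_norml.
Qed.

Lemma trunc_neq L x : trunc L x != x -> trunc L x = 0 /\ L < `|x|.
Proof.
rewrite /trunc indicE; case: (boolP (x \in _)) => [_|]; first by rewrite mulr1 eqxx.
by rewrite mulr0 notin_setE /= in_itv /= -ler_norml => /negP; rewrite -ltNge.
Qed.

(** A continuous majorant of the indicator of [L < |x|], vanishing as L grows. *)
Definition tail (L x : R) : R := 2 * (x * x * (x * x + L * L)^-1).

Lemma tail_denom L x : L != 0 -> 0 < x * x + L * L.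
Proof. by move=> L0; rewrite -!expr2 ltr_wpDl ?sqr_ge0// exprn_even_gt0. Qed.

Lemma continuous_tail L : L != 0 -> continuous (tail L).
Proof.
move=> L0 x; apply: cvgMr; apply: cvgM; first by apply: cvgM; exact: cvg_id.
apply: cvgV; first by rewrite gt_eqF//; exact: tail_denom.
by apply: cvgD; [apply: cvgM; exact: cvg_id|exact: cvg_cst].
Qed.

Lemma tail_ge0 L x : L != 0 -> 0 <= tail L x.
Proof.
by move=> /(tail_denom x)/ltW d0; rewrite mulr_ge0// mulr_ge0 ?invr_ge0// -expr2 sqr_ge0.
Qed.

Lemma tail_le L x : L != 0 -> `|tail L x| <= 2.
Proof.
move=> L0; rewrite ger0_norm ?tail_ge0// /tail ler_piMr// ler_pdivrMr ?tail_denom//.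
by rewrite mul1r lerDl -expr2 sqr_ge0.
Qed.

Lemma tail_ge1 L x : 0 < L -> L < `|x| -> 1 <= tail L x.
Proof.
move=> L0 Lx; rewrite /tail mulrA ler_pdivlMr ?mul1r; last by rewrite tail_denom// gt_eqF.
suff : L * L <= x * x by lra.
rewrite -!expr2 -[leRHS](real_normK (num_real x)) lerXn2r ?nnegrE ?(ltW L0)//.
exact: ltW.
Qed.

Lemma tail_cvg x : tail k.+1%:R x @[k --> \oo] --> (0 : R).
Proof.
rewrite /tail -[X in _ --> X](mulr0 2); apply: cvgMr.
apply: (@squeeze_cvgr _ _ _ _ (fun=> 0) (fun k => x * x * k.+1%:R^-1)).
- apply: nearW => k; have xx : 0 <= x * x by rewrite -expr2 sqr_ge0.
  have k1 : 1 <= k.+1%:R :> R by rewrite ler1n.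
  have d0 : 0 < x * x + k.+1%:R * k.+1%:R by apply: tail_denom; rewrite pnatr_eq0.
  rewrite mulr_ge0 ?invr_ge0 ?(ltW d0)//= ler_wpM2l// lef_pV2 ?posrE//.
    by move: k1; move: (k.+1%:R : R) => K k1; nra.
- exact: cvg_cst.
- by rewrite -[X in _ --> X](mulr0 (x * x)); apply: cvgMr; exact: cvg_harmonic.
Qed.

End Truncation.

Section Model.
Context {R : realType} {d : measure_display} {T : measurableType d}.
Variable P : probability T R.
Variables (A : forall m n : nat, T -> 'M[R[i]]_(n, m)) (t : forall m : nat, T -> 'I_m -> R).
Arguments t : clear implicits.
Variables (a4 c : R) (sigma : probability (measurableTypeR R) R) (m_ n_ : nat -> nat).
Local Notation C := R[i].
Local Notation borelR := (measurableTypeR R).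
Hypothesis A_iid : forall m n, iid_family P (entry_pair (A m n)).
Hypothesis A_mean : forall m n j k, complex_expectation P (fun w => A m n w j k) = 0.
Hypothesis A_var : forall m n j k, ('E_P[fun w => (normc (A m n w j k) ^+ 2)%R] = 1)%E.
Hypothesis A_fourth : forall m n j k, ('E_P[fun w => (normc (A m n w j k) ^+ 4)%R] <= a4%:E)%E.
Hypothesis mt : forall m l, measurable_fun setT (fun w => t m w l).
Hypothesis tA : forall m n,
  independent_families P (fun l => (fun w => t m w l) : T -> borelR) (entry_pair (A m n)).
Hypothesis t_cvg : cvg_weakly_in_probability P
  (fun m w => normalized_counting (codom (t m w))) sigma.
Hypothesis m_infty : m_ k @[k --> \oo] --> \oo.
Hypothesis n_infty : n_ k @[k --> \oo] --> \oo.
Hypothesis mn_c : ((m_ k)%:R / (n_ k)%:R : R) @[k --> \oo] --> c.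

Local Notation FF := (prob_filter P).
Let s1 : sigma setT = 1%E. Proof. exact: probability_setT. Qed.

Let m (p : nat * T) := m_ p.1.
Let n (p : nat * T) := n_ p.1.
Let tt p : 'I_(m p) -> R := t (m p) p.2.
Let AA p : 'M[C]_(n p, m p) := A (m p) (n p) p.2.
Let s z p : C := ntrace (AA p) z (tt (p := p)).
Let ratio p : R := (m p)%:R / (n p)%:R.
Let mean (phi : R -> R) p : R := (n p)%:R^-1 * \sum_l phi (tt (p := p) l).

Let fst_cvg : p.1 @[p --> FF] --> \oo.
Proof. by move=> Q /= Qk; exact: prob_filter_nat. Qed.

Let ratio_cvg : ratio p @[p --> FF] --> c.
Proof. exact: (cvg_comp _ _ fst_cvg mn_c). Qed.

Lemma limit_ratio_ge0 : 0 <= c.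
Proof. by apply: (cvgr_to_ge mn_c); apply: nearW => k; rewrite divr_ge0. Qed.

Let ratio_le : \forall p \near FF, ratio p <= c + 1.
Proof.
have /cvgrPdist_le /(_ _ ltr01) := ratio_cvg; apply: filterS => p /= h.
by have := le_trans (ler_norm _) h; have := lerNnormlW h; lra.
Qed.

Let n_gt : forall N, \forall p \near FF, (N < n p)%N.
Proof. by move=> N; exact: (prob_filter_nat P (n_infty (nbhs_infty_gt N))). Qed.

(** The mean over the weights is m/n times the integral against their counting
    measure. *)
Lemma mean_cvg phi : continuous phi -> bounded_fun phi ->
  mean phi p @[p --> FF] --> c * \int[sigma]_x phi x.
Proof.
move=> cphi bphi; have mphi : measurable_fun (setT : set borelR) (phi : borelR -> R).
  exact: continuous_measurable_fun.
pose X k w := \int[normalized_counting (codom (t (m_ k) w))]_x phi x.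
have mX k : measurable_fun setT (X k).
  exact: (@measurable_counting _ _ _ _ (fun l w => t (m_ k) w l)).
have meanE : mean phi = fun p => ratio p * X p.1 p.2.
  apply/funext => p; rewrite /X Rintegral_counting// size_codom card_ord big_image /= /mean.
  have [m0|m0] := posnP (m_ p.1).
    have -> : ratio p = 0 by rewrite /ratio /m m0 mul0r.
    rewrite mul0r big1 ?mulr0// => l _; have := ltn_ord l.
    by rewrite [X in (_ < X)%N]m0.
  have m0' : (m p)%:R != 0 :> R by rewrite pnatr_eq0 -lt0n.
  have e S : (n p)%:R^-1 * S = ratio p * ((m p)%:R^-1 * S).
    rewrite /ratio; move: ((m p)%:R : R) ((n p)%:R^-1 : R) m0' => x y x0.
    by field.
  by rewrite [LHS]e; congr (_ * (_ * _)); apply: eq_bigl.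
rewrite meanE; apply: cvgM; first exact: ratio_cvg.
apply/cvgrPdist_le => e e0.
have := @prob_filter_cvg _ _ _ P (fun k w => `|X k w - \int[sigma]_x phi x|) e.
have mY k : measurable_fun setT (fun w => `|X k w - \int[sigma]_x phi x|).
  by apply: measurableT_comp => //; exact: measurable_funB.
move=> h; apply: filterS (h _ _).
- by move=> p; rewrite distrC.
- by move=> k; exact: measurable_gt.
- exact: (cvg_comp _ _ m_infty (t_cvg cphi bphi e0)).
Qed.

Let tau L p : 'I_(m p) -> R := fun l => trunc L (tt (p := p) l).
Let V L z p : R := total_defect (AA p) z (tau L (p := p)).
Let rem L p : R := @removed R (m p) (n p) (tt (p := p)) (tau L (p := p)).

Let V_small L z e : 0 < Imz z -> 0 < e -> \forall p \near FF, V L z p <= e.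
Proof.
move=> z0 e0.
pose tl k (l : 'I_(m_ k)) w := t (m_ k) w l.
pose X k := defect (A (m_ k) (n_ k)) (@tl k) z (trunc L).
pose b k : R := (m_ k)%:R / (n_ k)%:R * (2 * (a4 + 5) * ((Imz z)^-2 + 1) / (n_ k)%:R).
have mX k : measurable_fun setT (X k).
  apply: (measurable_defect (A_iid _ _)) => //; last exact: measurable_trunc.
  by move=> l; exact: mt.
have X0 k w : 0 <= X k w by exact: defect_ge0.
have Xb : \forall k \near \oo, (\int[P]_w (X k w)%:E <= (b k)%:E)%E.
  have n1 : \forall k \near \oo, (0 < n_ k)%N by exact: n_infty (nbhs_infty_gt 0%N).
  apply: filterS n1 => k n0.
  apply: integral_defect_le => //.
  - by move=> l; exact: mt.
  - exact: measurable_trunc.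
have b0 : b k @[k --> \oo] --> 0.
  rewrite -[X in _ --> X](mulr0 c); apply: cvgM; first exact: mn_c.
  rewrite -[X in _ --> X](mulr0 (2 * (a4 + 5) * ((Imz z)^-2 + 1))); apply: cvgMr.
  have inv0 : (k%:R^-1 : R) @[k --> \oo] --> (0 : R).
    rewrite gtr0_cvgV0; first exact: cvgr_idn.
    by apply: filterS (nbhs_infty_gt 0%N) => k; rewrite ltr0n.
  exact: (cvg_comp _ _ n_infty inv0).
exact: (prob_filter_markov e0 mX X0 Xb b0).
Qed.

Let rem_small e : 0 < e -> exists2 L : R, 0 < L & \forall p \near FF, rem L p <= e.
Proof.
move=> e0; have k0 k : (k.+1%:R : R) != 0 by rewrite pnatr_eq0.
have mtail k : bounded_measurable (tail k.+1%:R : R -> R).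
  by apply: (@continuous_bounded_measurable _ _ 2) => [|x]; [exact: continuous_tail|exact: tail_le].
have : c * \int[sigma]_x tail k.+1%:R x @[k --> \oo] --> c * \int[sigma]_x 0.
  apply: cvgMr; apply: (@integral_cvg _ _ s1 _ _ 2) => //.
  - by move=> k; have [] := mtail k.
  - by move=> k x; exact: tail_le.
  - exact: tail_cvg.
  - exact: bounded_measurable_cst.
rewrite integral_cst1// mulr0 => /cvgrPdist_lt /(_ _ e0) [k _ /(_ _ (leqnn k))].
rewrite /= sub0r normrN => ke; exists k.+1%:R => //.
have btail : bounded_fun (tail k.+1%:R : R -> R).
  by exists 2; split; [exact: num_real|move=> b b2 x _; apply: le_trans (tail_le _ _) (ltW b2)].
have /cvgrPdist_lt := mean_cvg (continuous_tail (k0 k)) btail.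
have e1 : 0 < e - `|c * \int[sigma]_x tail k.+1%:R x| by rewrite subr_gt0.
move=> /(_ _ e1); apply: filterS => p h.
apply: (@le_trans _ _ (mean (tail k.+1%:R) p)).
  apply: ler_wpM2l; first by rewrite invr_ge0.
  apply: ler_sum => l _; rewrite /tau; case: eqP => [_|/eqP /trunc_neq [_ ?]].
    by rewrite tail_ge0.
  by rewrite tail_ge1// ltr0n.
rewrite distrC in h; have := ler_norm (mean (tail k.+1%:R) p - c * \int[sigma]_x tail k.+1%:R x).
have := ler_norm (c * \int[sigma]_x tail k.+1%:R x); lra.
Qed.

Let tau_le L p l : 0 <= L -> `|tau L (p := p) l| <= L.
Proof. exact: normr_trunc_le. Qed.

Let tau_neq L p l : tau L (p := p) l != tt (p := p) l -> tau L (p := p) l = 0.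
Proof. by move=> /trunc_neq[]. Qed.

(** Truncating the weights at L makes the proportion of changed weights small,
    uniformly in y; then y is taken large compared with L. *)
Lemma ntrace_tight e : 0 < e -> exists2 y : R, 0 < y &
  \forall p \near FF, 1 - y * Imz (s (0 +i* y) p) <= e.
Proof.
move=> e0; have e20 : 0 < e / 2 by rewrite divr_gt0.
have [L L0 remL] := rem_small e20.
have c0 := limit_ratio_ge0.
pose K := 2 * (c + 1) + 1; have K0 : 0 < K by rewrite /K; lra.
(* so that L / y * K = e / 2 *)
pose y := 2 * L * K / e; have y0 : 0 < y by rewrite /y divr_gt0// !mulr_gt0.
have z0 : 0 < Imz (0 +i* y : C) by [].
exists y => //; near=> p.
have n0 : (0 < n p)%N by near: p; exact: n_gt.
have r : ratio p <= c + 1 by near: p; exact: ratio_le.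
have v : V L (0 +i* y) p <= 1 by near: p; exact: V_small.
have rm : rem L p <= e / 2 by near: p.
have := ntrace_rough (AA p) z0 n0 (ltW L0) (fun l => tau_le l (ltW L0)) (@tau_neq L p).
rewrite -/(V L (0 +i* y) p) -/(rem L p) -/(ratio p) -/(s (0 +i* y) p).
have -> : normc (0 +i* y : C) = y by rewrite /normc /= expr0n add0r sqrtr_sqr gtr0_norm.
rewrite /= [y * (rem L p / y)]mulrC mulfVK ?gt_eqF// => h.
have h1 : 1 - y * Imz (s (0 +i* y) p) <= normc (1 + (0 +i* y) * s (0 +i* y) p).
  apply: le_trans (le_trans (ler_norm _) (abs_Re_le _)).
  by rewrite Re_add Re_mul /= mul0r sub0r.
apply: (le_trans h1); apply: (le_trans h).
have -> : e = L / y * K + e / 2.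
  by rewrite /y; field; rewrite !gt_eqF.
apply: lerD => //; apply: ler_wpM2l; first exact/ltW/divr_gt0.
by rewrite /K; move: r v; move: (ratio p) (V _ _ _) => x1 x2; lra.
Unshelve. all: by end_near. Qed.

(** The truncation level is chosen after the proportion of removed entries, on
    which the terms without truncation constant depend, and before the scale at
    which the defect and 1/n have to be small. *)
Lemma ntrace_equation z delta e : 0 < Imz z -> 0 < delta -> 0 < e ->
  \forall p \near FF, delta <= Imz (s z p) ->
    normc (1 + z * s z p - (n p)%:R^-1 * \sum_l moebius (tt (p := p) l) (s z p)) <= e.
Proof.
move=> z0 d0 e0; have c0 := limit_ratio_ge0; set y := Imz z.
have cp : 0 < c + 1 by lra.
have e40 : 0 < e / 4 by rewrite divr_gt0.
(* K bounds the terms of the error that are proportional to the removed part *)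
pose k1 := y^-1 / (delta * (delta / 2)).
have k10 : 0 < k1 by rewrite /k1 divr_gt0 ?invr_gt0// mulr_gt0// divr_gt0.
pose K := normc z / y + (c + 1) * (k1 / y) + y^-1 / delta.
have K0 : 0 < K.
  rewrite /K; have := normc_ge0 z; have : 0 < y^-1 / delta by rewrite divr_gt0 ?invr_gt0.
  have : 0 < (c + 1) * (k1 / y) by apply: mulr_gt0 => //; exact: divr_gt0.
  move=> h1 h2 h3; have : 0 <= normc z / y by apply: divr_ge0 => //; exact: ltW.
  lra.
pose rho := Num.min (delta / 2 * y) (e / 4 / K).
have rho0 : 0 < rho.
  by rewrite lt_min; apply/andP; split; [rewrite mulr_gt0// divr_gt0|rewrite divr_gt0].
have [L L0 remL] := rem_small rho0.
pose Q := comparison_const (delta / 2) y^-1 (L / y) + 1.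
have Q0 : 0 < Q.
  have h1 : 0 < y^-1 by rewrite invr_gt0.
  have h2 : 0 < delta / 2 by rewrite divr_gt0.
  have h3 : 0 < L / y by rewrite divr_gt0.
  rewrite /Q /comparison_const.
  have q1 : 0 < y^-1 / (delta / 2 * (delta / 2 / 2)).
    by rewrite divr_gt0// mulr_gt0// divr_gt0.
  have q2 : 0 < (L / y + y^-1 / (delta / 2)) * (2 / (delta / 2)).
    by rewrite mulr_gt0// ?divr_gt0// addr_gt0// divr_gt0.
  lra.
pose kappa := e / 4 / (2 * (c + 1) * Q).
have kappa0 : 0 < kappa by rewrite divr_gt0// !mulr_gt0.
pose nu := e / 4 / Q * kappa.
have nu0 : 0 < nu by rewrite mulr_gt0// divr_gt0.
pose N := (Num.truncn ((c + 1) / y * (Q / (e / 4)))).+1.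
near=> p => ds.
have n0 : (0 < n p)%N by near: p; exact: n_gt.
have nN : (N < n p)%N by near: p; exact: n_gt.
have r : ratio p <= c + 1 by near: p; exact: ratio_le.
have v : V L z p <= nu by near: p; exact: V_small.
have rm : rem L p <= rho by near: p.
have rm0 : 0 <= rem L p by exact: removed_ge0.
have r0 : 0 <= ratio p by rewrite divr_ge0.
have small : rem L p / y <= delta / 2.
  rewrite ler_pdivrMr//; apply: (le_trans rm); rewrite ge_min lexx//.
have := ntrace_self_consistent (A := AA p) z0 n0 (ltW L0) (fun l => tau_le l (ltW L0))
  (@tau_neq L p) d0 kappa0 ds small.
rewrite -/(V L z p) -/(rem L p) -/(ratio p) -/(s z p) -/y -/k1.
move/le_trans; apply.
have b1 : normc z * (rem L p / y) + ratio p * (k1 * (rem L p / y)) + rem L p * (y^-1 / delta)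
    <= e / 4.
  apply: (@le_trans _ _ (K * rem L p)).
    have -> : normc z * (rem L p / y) + ratio p * (k1 * (rem L p / y)) + rem L p * (y^-1 / delta)
      = (normc z / y + ratio p * (k1 / y) + y^-1 / delta) * rem L p by ring.
    rewrite ler_wpM2r// /K; apply: lerD => //; rewrite lerD2l.
    by rewrite ler_wpM2r// divr_ge0// ltW.
  rewrite mulrC -ler_pdivlMr//; apply: (le_trans rm); by rewrite ge_min lexx orbT.
have b2 : comparison_const (delta / 2) y^-1 (L / y)
   * (2 * kappa * ratio p + V L z p / kappa + ratio p / ((n p)%:R * y)) <= 3 * (e / 4).
  have nn0 : 0 < (n p)%:R :> R by rewrite ltr0n.
  have v0 : 0 <= V L z p.
    apply: mulr_ge0; first by rewrite invr_ge0.
    by apply: sumr_ge0 => l _; rewrite addr_ge0// sqr_ge0.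
  have q0 : 0 <= 2 * kappa * ratio p + V L z p / kappa + ratio p / ((n p)%:R * y).
    apply: addr_ge0; last by rewrite divr_ge0// mulr_ge0// ltW.
    apply: addr_ge0; last by apply: divr_ge0 => //; exact: ltW.
    by apply: mulr_ge0 => //; apply: mulr_ge0 => //; exact: ltW.
  apply: (@le_trans _ _ (Q * (2 * kappa * ratio p + V L z p / kappa + ratio p / ((n p)%:R * y)))).
    by rewrite ler_wpM2r// /Q lerDl.
  have -> : 3 * (e / 4) = Q * (2 * kappa * (c + 1) + nu / kappa + e / 4 / Q).
    by rewrite /nu /kappa; field; rewrite !gt_eqF.
  rewrite ler_wpM2l ?(ltW Q0)//; apply: lerD; first apply: lerD.
  - by rewrite ler_wpM2l// mulr_ge0// ltW.
  - by rewrite ler_wpM2r// invr_ge0 ltW.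
  - have Nn : (c + 1) / y * (Q / (e / 4)) <= (n p)%:R.
      apply: ltW; apply: lt_trans (truncnS_gt _) _.
      by rewrite ltr_nat.
    rewrite ler_pdivlMr// mulrAC ler_pdivrMr ?mulr_gt0//.
    apply: (@le_trans _ _ ((c + 1) * Q)); first by rewrite ler_wpM2r// ltW.
    have -> : (c + 1) * Q = (c + 1) / y * (Q / (e / 4)) * (e / 4 * y).
      by field; rewrite !gt_eqF.
    by rewrite [leRHS]mulrCA ler_wpM2r// ltW// mulr_gt0.
lra.
Unshelve. all: by end_near. Qed.

Let spectrum p : seq R := eigenvalues (sample_matrix (AA p) (tt (p := p))).
Let N p : {measure set borelR -> \bar R} := normalized_counting (spectrum p).

Let spectrum_diag p : exists d : 'I_(n p) -> R,
  [/\ size (spectrum p) = n p,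
      forall phi : R -> R, \sum_(x <- spectrum p) phi x = \sum_i phi (d i),
      forall k, \tr (mxpow (sample_matrix (AA p) (tt (p := p))) k) = (\sum_i d i ^+ k)%:C
    & forall z, Imz z != 0 -> \tr (resolvent (sample_matrix (AA p) (tt (p := p))) z)
        = \sum_i ((d i)%:C - z)^-1].
Proof. by apply: eigenvalues_sum; exact: sample_matrix_herm. Qed.

Let size_spectrum p : size (spectrum p) = n p.
Proof. by have [d' []] := spectrum_diag p. Qed.

Let N_integral p phi : measurable_fun (setT : set borelR) (phi : borelR -> R) ->
  \int[N p]_x phi x = (n p)%:R^-1 * \sum_(x <- spectrum p) phi x.
Proof. by move=> mphi; rewrite Rintegral_counting// size_spectrum. Qed.

Let N1 : \forall p \near FF, N p setT = 1%E.
Proof.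
apply: filterS (n_gt 0%N) => p n0; apply: normalized_counting_setT.
by apply/eqP => e; move: n0; rewrite -size_spectrum e.
Qed.

Lemma ntrace_stieltjes z p : Imz z != 0 -> s z p = stieltjes (N p) z.
Proof.
move=> z0; have [d' [_ dsum _ dtr]] := spectrum_diag p.
have [[mR _] [mI _]] := cbounded_cauchy z0.
rewrite /s ntrace.unlock dtr//; set r := (n p)%:R^-1.
have -> : r = ((n p)%:R^-1 : R)%:C by rewrite /r fmorphV rmorph_nat.
apply: complexP.
  rewrite Re_mul /= mul0r subr0 Re_sum N_integral//.
  by rewrite (dsum (fun x => Rez (cauchy z x))).
rewrite Im_mul /= mul0r addr0 Im_sum N_integral//.
by rewrite (dsum (fun x => Imz (cauchy z x))).
Qed.

Let measurable_spectral k phi : continuous phi ->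
  measurable_fun setT (fun w => \int[N (k, w)]_x phi x).
Proof.
move=> cphi; have mphi : measurable_fun (setT : set borelR) (phi : borelR -> R).
  exact: continuous_measurable_fun.
under eq_fun do rewrite N_integral//.
have mc : measurable_fun (setT : set T) (fun=> (n_ k)%:R^-1 : R) by exact: measurable_cst.
have powers j : measurable_fun setT (fun w => \sum_(x <- spectrum (k, w)) x ^+ j); last first.
  exact: (measurable_funM mc (sum_measurable_continuous powers cphi)).
have mM : mxmeasurable (fun w => sample_matrix (A (m_ k) (n_ k) w) (t (m_ k) w)).
  apply: mxmeasurable_sample_matrix => l; right; split; first exact: mt.
  by move=> i; exact: (mxmeasurable_A (A_iid _ _)).
have [mT _] := cmeasurable_tr (mxmeasurable_pow j mM).
have e w : \sum_(x <- spectrum (k, w)) x ^+ j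
    = Rez (\tr (mxpow (sample_matrix (A (m_ k) (n_ k) w) (t (m_ k) w)) j)).
  by have [d' [_ dsum dpow _]] := spectrum_diag (k, w); rewrite dpow dsum.
by rewrite (funext e).
Qed.

Section UltraLimit.
Variable U : set_system (nat * T).
Hypothesis UU : UltraFilter U.
Hypothesis FU : FF `<=` U.
Let UP : ProperFilter U := @ultra_proper _ _ UU.

Let near_U (Q : nat * T -> Prop) : (\forall p \near FF, Q p) -> \forall p \near U, Q p.
Proof. exact: FU. Qed.

Let cvg_U (f : nat * T -> R) (l : R) : f p @[p --> FF] --> l -> f p @[p --> U] --> l.
Proof. by move=> fl Q /fl /FU. Qed.

(** Tightness holds along the probability filter, hence along U. *)
Lemma limit_measure : exists mu : probability borelR R, forall phi : R -> R,
  continuous phi -> bounded_fun phi -> \int[N p]_x phi x @[p --> U] --> \int[mu]_x phi x.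
Proof.
apply: helly => //; first exact: near_U N1.
move=> e e0; have e20 : 0 < e / 2 by rewrite divr_gt0.
have [y y0 ye] := ntrace_tight e20; exists y => //; apply: near_U.
near=> p; have N1p : N p setT = 1%E by near: p.
have z0 : Imz (0 +i* y : C) != 0 by rewrite gt_eqF.
apply: le_trans (stieltjes_tight N1p y0) _.
rewrite -ntrace_stieltjes// mulrC -ler_pdivlMr//.
by near: p.
Unshelve. all: by end_near. Qed.

Variable mu : probability borelR R.
Hypothesis N_mu : forall phi : R -> R, continuous phi -> bounded_fun phi ->
  \int[N p]_x phi x @[p --> U] --> \int[mu]_x phi x.

Let mu1 : mu setT = 1%E. Proof. exact: probability_setT. Qed.

Let bounded_part (g : R -> C) (b : R) : (forall x, normc (g x) <= b) ->
  bounded_fun (fun x => Rez (g x)) /\ bounded_fun (fun x => Imz (g x)).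
Proof.
move=> gb; split; exists b; split; try exact: num_real; move=> b' /ltW bb' x _.
  exact: le_trans (abs_Re_le _) (le_trans (gb x) bb').
exact: le_trans (abs_Im_le _) (le_trans (gb x) bb').
Qed.

Let ntrace_cvg z e : Imz z != 0 -> 0 < e ->
  \forall p \near U, normc (stieltjes mu z - s z p) <= e.
Proof.
move=> z0 e0; have e20 : 0 < e / 2 by rewrite divr_gt0.
have [cR cI] := ccontinuous_cauchy z0.
have [bR bI] := bounded_part (fun x => normc_cauchy_le x z0).
have /cvgrPdist_le /(_ _ e20) hR := N_mu cR bR.
have /cvgrPdist_le /(_ _ e20) hI := N_mu cI bI.
near=> p; have hRp : `|\int[mu]_x Rez (cauchy z x) - \int[N p]_x Rez (cauchy z x)| <= e / 2.
  by near: p.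
have hIp : `|\int[mu]_x Imz (cauchy z x) - \int[N p]_x Imz (cauchy z x)| <= e / 2.
  by near: p.
rewrite ntrace_stieltjes//; apply: le_trans (normc_le_abs _) _.
by rewrite Re_add Im_add Re_opp Im_opp (splitr e); exact: lerD.
Unshelve. all: by end_near. Qed.

Let mean_ccvg (g : R -> C) (b e : R) : ccontinuous g -> (forall x, normc (g x) <= b) -> 0 < e ->
  \forall p \near U, normc ((n p)%:R^-1 * \sum_l g (tt (p := p) l)
                           - c%:C * complex_integral sigma g) <= e.
Proof.
move=> [cR cI] gb e0; have e20 : 0 < e / 2 by rewrite divr_gt0.
have [bR bI] := bounded_part gb.
have /cvgrPdist_le /(_ _ e20) hR := cvg_U (mean_cvg cR bR).
have /cvgrPdist_le /(_ _ e20) hI := cvg_U (mean_cvg cI bI).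
near=> p.
have hRp : `|c * \int[sigma]_x Rez (g x) - mean (fun x => Rez (g x)) p| <= e / 2 by near: p.
have hIp : `|c * \int[sigma]_x Imz (g x) - mean (fun x => Imz (g x)) p| <= e / 2 by near: p.
have -> : (n p)%:R^-1 = ((n p)%:R^-1 : R)%:C by rewrite fmorphV rmorph_nat.
apply: le_trans (normc_le_abs _) _.
rewrite Re_add Im_add Re_opp Im_opp !Re_mul !Im_mul /= !mul0r !subr0 !addr0 Re_sum Im_sum.
by rewrite (splitr e) distrC [X in _ + X <= _]distrC; exact: lerD.
Unshelve. all: by end_near. Qed.

(** Along U the normalized trace tends to q = stieltjes mu z, whose imaginary part
    is positive, so that the approximate equation applies eventually and passes
    to the limit. *)
Lemma limit_equation_upper z : 0 < Imz z ->
  stieltjes mu z = - (z - c%:C * complex_integral sigma (kernel (stieltjes mu z)))^-1.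
Proof.
move=> z0; have z0' : Imz z != 0 by rewrite gt_eqF.
set q := stieltjes mu z.
have q0 : 0 < Imz q by have := Im_stieltjes_gt0 mu1 z0'; rewrite pmulr_lgt0.
have q0' : Imz q != 0 by rewrite gt_eqF.
have c0 := limit_ratio_ge0.
have moebiusE x : moebius x q = q * kernel q x by rewrite /moebius /kernel; ring.
have cm : ccontinuous (fun x => moebius x q).
  rewrite (funext moebiusE); apply: ccontinuousM; first exact: ccontinuous_cst.
  exact: ccontinuous_kernel.
pose I := complex_integral sigma (fun x => moebius x q).
pose delta := Imz q / 2; have d0 : 0 < delta by rewrite divr_gt0.
have dq : delta <= Imz q by rewrite /delta; lra.
pose k1 := (Imz z)^-1 / (delta * delta).
have k10 : 0 <= k1.
  by apply: divr_ge0; [rewrite invr_ge0 ltW|apply: mulr_ge0; exact: ltW].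
pose K := 2 + normc z + (c + 1) * k1.
have E0 : 1 + z * q - c%:C * I = 0.
  apply/eqP; rewrite -normc_eq0 eq_le normc_ge0 andbT; apply/ler_addgt0Pl => e0 e0_gt0.
  rewrite addr0; pose e := Num.min delta (e0 / K).
  have K0 : 0 < K.
    rewrite /K; have := normc_ge0 z; have : 0 <= (c + 1) * k1 by apply: mulr_ge0 => //; lra.
    lra.
  have e_gt0 : 0 < e by rewrite lt_min d0 divr_gt0.
  have [p [h1 h2 h3 h4 n0]] : exists p, [/\ normc (q - s z p) <= e, ratio p <= c + 1,
      normc ((n p)%:R^-1 * \sum_l moebius (tt (p := p) l) q - c%:C * I) <= e,
      delta <= Imz (s z p) -> normc (1 + z * s z p
        - (n p)%:R^-1 * \sum_l moebius (tt (p := p) l) (s z p)) <= e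
      & (0 < n p)%N].
    apply: (@filter_ex _ U UP); near=> p; split; near: p.
    - exact: ntrace_cvg.
    - exact: near_U ratio_le.
    - exact: (mean_ccvg cm (fun x => normc_moebius_le x q0')).
    - exact: near_U (ntrace_equation _ _ _).
    - exact: near_U (n_gt 0%N).
  have ds : delta <= Imz (s z p).
    have := le_trans (ler_norm _) (abs_Im_le (q - s z p)).
    have : e <= delta by rewrite ge_min lexx.
    rewrite Im_add Im_opp /delta => ed h; have := le_trans h h1; rewrite /delta in ed; lra.
  have {}h4 := h4 ds.
  have -> : 1 + z * q - c%:C * I
    = (1 + z * s z p - (n p)%:R^-1 * \sum_l moebius (tt (p := p) l) (s z p))
      + z * (q - s z p)
      + (((n p)%:R^-1 * \sum_l moebius (tt (p := p) l) q - c%:C * I)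
         - (n p)%:R^-1 * \sum_l (moebius (tt (p := p) l) q - moebius (tt (p := p) l) (s z p))).
    by rewrite sumrB mulrBr; ring.
  apply: le_trans (normcD _ _) _; apply: (@le_trans _ _ (e + normc z * e + (e + (c + 1) * k1 * e))).
    apply: lerD.
      apply: le_trans (normcD _ _) _; apply: lerD => //.
      by rewrite normcM ler_wpM2l// normc_ge0.
    apply: le_trans (normcB _ _) _; apply: lerD => //.
    have -> : (n p)%:R^-1 = ((n p)%:R^-1 : R)%:C by rewrite fmorphV rmorph_nat.
    rewrite normcM normc_real ger0_norm ?invr_ge0//.
    apply: (@le_trans _ _ ((n p)%:R^-1 * \sum_(l < m p) (k1 * e))).
      rewrite ler_wpM2l ?invr_ge0//; apply: le_trans (normc_sum _ _ _) _.
      apply: ler_sum => l _.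
      apply: le_trans (moebius_lipschitz _ d0 d0 ds dq (normc_ntrace_le _ z0 n0 _)) _.
      exact: ler_wpM2l.
    have -> : (n p)%:R^-1 * \sum_(l < m p) (k1 * e) = ratio p * (k1 * e).
      by rewrite sumr_const card_ord /ratio -[(k1 * e) *+ _]mulr_natl mulrA [_^-1 * _]mulrC.
    rewrite -[(c + 1) * k1 * e]mulrA.
    by apply: ler_wpM2r => //; apply: mulr_ge0 => //; exact: ltW.
  have : e * K <= e0 by rewrite -ler_pdivlMr// ge_min lexx orbT.
  by apply: le_trans; rewrite /K le_eqVlt; apply/orP; left; apply/eqP; ring.
have qn0 := Im_neq0 q0'.
have IE : I = q * complex_integral sigma (kernel q).
  rewrite /I (funext moebiusE) complex_integralZ//; exact: cbounded_kernel.
move: E0; rewrite IE => /eqP; rewrite subr_eq0 => /eqP E0.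
have E1 : (c%:C * complex_integral sigma (kernel q) - z) * q = 1.
  by have -> : 1 = (1 + z * q) - z * q by [rewrite addrK]; rewrite E0; ring.
have d1 : c%:C * complex_integral sigma (kernel q) - z != 0.
  by apply/eqP => d1; move: E1; rewrite d1 mul0r => /eqP; rewrite eq_sym oner_eq0.
by rewrite -invrN opprB; apply: (mulfI d1); rewrite E1 mulfV.
Unshelve. all: by end_near. Qed.

End UltraLimit.

(** The limits along all ultrafilters above the probability filter solve the same
    equation, hence have the same Stieltjes transform and are equal; so there is
    a limit along the filter itself. The equation in the lower half-plane follows
    by conjugation. *)
Theorem eigenvalue_limit : exists mu : probability borelR R,
  unique_solution c sigma (stieltjes mu) /\
  cvg_weakly_in_probability P
    (fun k w => normalized_counting
       (eigenvalues (sample_matrix (A (m_ k) (n_ k) w) (t (m_ k) w)))) mu.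
Proof.
have [U [UU FU]] := ultraFilterLemma (prob_filter_proper P).
have [mu mu_lim] := limit_measure UU FU.
have mu1 : mu setT = 1%E by exact: probability_setT.
have mu_eq := limit_equation_upper UU FU mu_lim.
exists mu; split.
  have realJ (x : R) : (x%:C^*)%R = x%:C :> C.
    by apply: complexP; rewrite ?cRe_conj ?cIm_conj /= ?oppr0.
  have mu_leq : limit_equation c sigma (stieltjes mu).
    move=> z z0; have [z_gt0|z_le0] := ltP 0 (Imz z); first exact: mu_eq.
    have zc0 : 0 < Imz (z^*)%R by rewrite cIm_conj oppr_gt0 lt_neqAle z0.
    have := mu_eq _ zc0; rewrite stieltjes_conj//; set q := stieltjes mu z.
    have q0 : Imz q != 0.
      by apply/eqP => h; have := Im_stieltjes_gt0 mu1 z0; rewrite h mul0r ltxx.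
    have -> : complex_integral sigma (kernel (q^*)%R) = (complex_integral sigma (kernel q))^*%R.
      rewrite -complex_integralJ//; last by have [] := cbounded_kernel q0.
      congr complex_integral; apply/funext => x.
      rewrite /kernel fmorph_div rmorphD rmorph1 rmorphM.
      by congr (_ / (1 + _ * _)); exact: esym (realJ _).
    move=> /(congr1 (fun y : C => (y^*)%R)); rewrite conjCK => h; rewrite [LHS]h.
    rewrite rmorphN fmorphV rmorphB rmorphM.
    by congr (- (_ - _ * _)^-1); [exact: conjCK|exact: realJ|exact: conjCK].
  split => //; first exact: stieltjes_solution_class.
  move=> g [_ g_im _] g_eq z z0.
  apply: (equation_unique limit_ratio_ge0 (g_im z z0) (Im_stieltjes_gt0 mu1 z0)).
    exact: g_eq.
  exact: mu_leq.
move=> phi cphi bphi e e0.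
apply: (@cvg_prob_filter _ _ _ P (fun k w => \int[N (k, w)]_x phi x)) => //.
  by move=> k; exact: measurable_spectral.
apply: cvg_ultra => W WU FW.
have [nu nu_lim] := limit_measure WU FW.
have nu_eq := limit_equation_upper WU FW nu_lim.
have nu1 : nu setT = 1%E by exact: probability_setT.
have -> : \int[mu]_x phi x = \int[nu]_x phi x.
  apply: stieltjes_inj => z z0; have z0' : Imz z != 0 by rewrite gt_eqF.
  by apply: (equation_unique limit_ratio_ge0 (Im_stieltjes_gt0 mu1 z0') (Im_stieltjes_gt0 nu1 z0'));
    [exact: mu_eq|exact: nu_eq].
by under eq_fun => p do rewrite -surjective_pairing; exact: nu_lim.
Qed.

End Model.

(** * Nonrandom weights *)

Section Nonrandom.
Context {R : realType} {d : measure_display} {T : measurableType d}.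
Variable P : probability T R.
Local Notation borelR := (measurableTypeR R).

(** The preimages under a constant are empty or full, and these two sets form a
    sigma-algebra. *)
Lemma family_sigma_algebra_cst {I : Type} (X : I -> T -> borelR) (x : I -> R) :
  (forall i w, X i w = x i) ->
  forall U : set T, family_sigma_algebra X U -> U = set0 \/ U = setT.
Proof.
move=> Xx U; pose S := [set V : set T | V = set0 \/ V = setT].
suff : family_sigma_algebra X `<=` S by apply.
apply: smallest_sub.
  split; first by left.
    by move=> V [->|->]; [right|left]; rewrite setTD ?setC0 ?setCT.
  move=> F FS; have [[k Fk]|nF] := pselect (exists k, F k = setT).
    by right; apply/seteqP; split => // w _; exists k => //; rewrite Fk.
  left; apply: bigcup0 => k _; have [//|Fk] := FS k.
  by exfalso; apply: nF; exists k.
move=> _ [i _ [B _ <-]]; have [Bx|nBx] := pselect (B (x i)).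
  by right; apply/seteqP; split => // w _; split => //=; rewrite Xx.
by left; apply/seteqP; split => // w [_] /=; rewrite Xx.
Qed.

Lemma independent_cst {d'} {E : measurableType d'} {I J : Type} (X : I -> T -> borelR)
    (Y : J -> T -> E) (x : I -> R) : (forall i w, X i w = x i) ->
  independent_families P X Y.
Proof.
move=> Xx U V /(family_sigma_algebra_cst Xx)[->|->] _.
  by rewrite set0I measure0 mul0e.
by rewrite setTI probability_setT mul1e.
Qed.

Lemma cvg_weakly_in_probability_cst (mu : nat -> {measure set borelR -> \bar R})
    (nu : {measure set borelR -> \bar R}) : cvg_weakly mu nu ->
  cvg_weakly_in_probability P (fun k _ => mu k) nu.
Proof.
move=> mu_nu phi cphi bphi e e0.
have /cvgrPdist_le /(_ _ e0) near_e := mu_nu phi cphi bphi.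
apply: cvg_near_cst; apply: filterS near_e => k ke.
have -> : [set w : T | e < `|\int[mu k]_x phi x - \int[nu]_x phi x|] = set0.
  by apply/seteqP; split => // w /=; rewrite ltNge distrC ke.
exact: measure0.
Qed.

End Nonrandom.

Theorem theorem5p1 (R : realType) (d : measure_display) (T : measurableType d)
    (P : probability T R)
    (A : forall m n : nat, T -> 'M[R[i]]_(n, m))
    (t : forall m : nat, T -> 'I_m -> R)
    (a4 c : R) (sigma : probability (measurableTypeR R) R)
    (m_ n_ : nat -> nat)
    (A_iid : forall m n, iid_family P (entry_pair (A m n)))
    (A_mean : forall m n j k,
       complex_expectation P (fun w => A m n w j k) = 0)
    (A_sqr : forall m n j k,
       complex_expectation P (fun w => A m n w j k ^+ 2) = 0)
    (A_var : forall m n j k,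
       ('E_P[fun w => (ComplexField.Normc.normc (A m n w j k) ^+ 2)%R] = 1)%E)
    (A_fourth : forall m n j k,
       ('E_P[fun w => (ComplexField.Normc.normc (A m n w j k) ^+ 4)%R]
          <= a4%:E)%E)
    (t_hyp : nonrandom_t t sigma \/ iid_t P A t sigma)
    (m_infty : m_ k @[k --> \oo] --> \oo)
    (n_infty : n_ k @[k --> \oo] --> \oo)
    (mn_c : ((m_ k)%:R / (n_ k)%:R : R) @[k --> \oo] --> c) :
  exists mu : probability (measurableTypeR R) R,
    unique_solution c sigma (stieltjes mu) /\
    cvg_weakly_in_probability P
      (fun k w => normalized_counting
         (eigenvalues (sample_matrix (A (m_ k) (n_ k) w) (t (m_ k) w))))
      mu.
Proof.
have [mt tA t_cvg] : [/\ forall m l, measurable_fun setT (fun w => t m w l),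
    forall m n, independent_families P
      (fun l => (fun w => t m w l) : T -> measurableTypeR R) (entry_pair (A m n))
  & cvg_weakly_in_probability P (fun m w => normalized_counting (codom (t m w))) sigma].
  case: t_hyp => [[t0 tt0 t0_cvg]|[t_iid tA t_cvg]]; last first.
    by split => // m l; have [h _ _] := t_iid m; exact: (h l).
  split=> [m l|m n|].
  - by under eq_fun do rewrite tt0; exact: measurable_cst.
  - by apply: (@independent_cst _ _ _ _ _ _ _ _ _ _ (t0 m)) => l w; exact: tt0.
  - have e : (fun m w => normalized_counting (codom (t m w)))
       = (fun m _ => normalized_counting (codom (t0 m))).
      apply/funext => m; apply/funext => w; congr normalized_counting.
      by apply: eq_codom => l; exact: tt0.
    by rewrite e; exact: cvg_weakly_in_probability_cst.
exact: (eigenvalue_limit A_iid A_mean A_var A_fourth mt tA t_cvg m_infty n_infty mn_c).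
Qed.
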